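(* Let $n\ge 2$. Define $$\Phi_{\mathrm{OL}}:\mathcal S^+(n-1)\to\mathrm{Cor}^+(n),\quad \Phi_{\mathrm{OL}}(X)=\exp\bigl(\mathcal D(\psi_{\mathrm{OL}}(\log X))+\psi_{\mathrm{OL}}(\log X)\bigr),$$ $$\Phi_{\mathrm{LS}}:\mathcal S^+(n-1)\to\mathrm{Cor}^+(n),\quad \Phi_{\mathrm{LS}}(X)=\pi_1\bigl(\exp(B_n^\top\log(X)B_n)\bigr).$$ Then: (i) $\Phi_{\mathrm{OL}}:(\mathcal S^+(n-1),g^{\mathrm{LE}})\to(\mathrm{Cor}^+(n),g^{\mathrm{OL}})$ is a Riemannian isometry and a Lie group isomorphism (for the log-Euclidean group law on $\mathcal S^+(n-1)$ and the off-log group law on $\mathrm{Cor}^+(n)$); (ii) $\Phi_{\mathrm{LS}}:(\mathcal S^+(n-1),g^{\mathrm{LE}})\to(\mathrm{Cor}^+(n),g^{\mathrm{LS}})$ is a Riemannian isometry and a Lie group isomorphism (for the log-Euclidean group law on $\mathcal S^+(n-1)$ and the log-scaling group law on $\mathrm{Cor}^+(n)$); (iii) $\Phi_{\mathrm{LS}}\circ\Phi_{\mathrm{OL}}^{-1}:(\mathrm{Cor}^+(n),g^{\mathrm{OL}})\to(\mathrm{Cor}^+(n),g^{\mathrm{LS}})$, given by $$X\longmapsto \pi_1\Bigl(\exp\bigl(B_n^\top\,\psi_{\mathrm{OL}}^{-1}(\mathrm{off}(\log X))\,B_n\bigr)\Bigr),$$ is a Riemannian isometry and a Lie group isomorphism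 from the off-log group law to the log-scaling group law.
   Context: Notation: $\mathcal S(k)$ = real symmetric $k\times k$ matrices, $\mathcal S^+(k)$ = symmetric positive-definite ones, $\mathrm{Cor}^+(n)$ = matrices in $\mathcal S^+(n)$ with unit diagonal (full-rank correlation matrices), $\mathrm{Hol}(n)$ = symmetric matrices with zero diagonal, $\mathrm{Row}_0(n)$ = symmetric matrices with all row sums zero, $\mathrm{Diag}(n)$ = diagonal matrices, $\mathrm{Diag}^+(n)$ = diagonal matrices with positive diagonal entries. $\mathrm{Diag}(A)$ is the diagonal part of $A$ and $\mathrm{off}(A)=A-\mathrm{Diag}(A)$. $\exp,\log$ are the matrix exponential and logarithm; $\log:\mathcal S^+(k)\to\mathcal S(k)$ is a diffeomorphism. $\langle A,B\rangle=\mathrm{tr}(AB)$ is the Frobenius inner product on spaces of symmetric matrices. Known facts: for each $S\in\mathcal S(n)$ there is a unique $\mathcal D(S)\in\mathrm{Diag}(n)$ with $\exp(\mathcal D(S)+S)\in\mathrm{Cor}^+(n)$, and $\mathrm{Log}:=\mathrm{off}\circ\log:\mathrm{Cor}^+(n)\to\mathrm{Hol}(n)$ is a diffeomorphism with inverse $S\mapsto\exp(\mathcal D(S)+S)$. For each $\Sigma\in\mathcal S^+(n)$ there is a unique $\mathcal D^*(\Sigma)\in\mathrm{Diag}^+(n)$ with $\log(\mathcal D^*(\Sigma)\Sigma\mathcal D^*(\Sigma))\in\mathrm{Row}_0(n)$, and $\mathrm{Log}^\bullet:\mathrm{Cor}^+(n)\to\mathrm{Row}_0(n)$, $C\mapsto\log(\mathcal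 D^*(C)C\mathcal D^*(C))$ is a diffeomorphism with inverse $S\mapsto\pi_1(\exp S)$, where $\pi_1(\Sigma)=\mathrm{Diag}(\Sigma)^{-1/2}\Sigma\,\mathrm{Diag}(\Sigma)^{-1/2}$. Metrics: $g^{\mathrm{LE}}=\log^*\langle\cdot,\cdot\rangle$ on $\mathcal S^+(k)$, $g^{\mathrm{OL}}=\mathrm{Log}^*\langle\cdot,\cdot\rangle$ and $g^{\mathrm{LS}}=(\mathrm{Log}^\bullet)^*\langle\cdot,\cdot\rangle$ on $\mathrm{Cor}^+(n)$ (pullbacks of the constant Frobenius metric). Group laws: a diffeomorphism $\phi:M\to V$ onto a vector space induces $u\star v=\phi^{-1}(\phi(u)+\phi(v))$; the log-Euclidean, off-log and log-scaling group laws are those given by $\phi=\log$, $\mathrm{Log}$, $\mathrm{Log}^\bullet$ respectively. $\psi_{\mathrm{OL}}:\mathcal S(n-1)\to\mathrm{Hol}(n)$ is the linear isomorphism $$\psi_{\mathrm{OL}}(S)=\begin{bmatrix}0&\tfrac1{\sqrt2}\mathrm{diag}(S)^\top\\ \tfrac1{\sqrt2}\mathrm{diag}(S)&\mathrm{off}(S)\end{bmatrix},$$ where $\mathrm{diag}(S)\in\mathbb R^{n-1}$ is the column vector of diagonal entries of $S$. $B_n\in\mathbb R^{(n-1)\times n}$ is the Helmert-contrast matrix: for $1\le i\le n-1$, its $i$-th row has entries $\frac1{\sqrt{i(i+1)}}$ in columns $1,\dots,i$, entry $-\frac{i}{\sqrt{i(i+1)}}$ in column $i+1$, and $0$ elsewhere.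 *)

(* Defs.v *)
From HB Require Import structures.
From mathcomp Require Import all_boot all_order all_algebra.
From mathcomp Require Import all_classical all_reals all_analysis.

Set Implicit Arguments.
Unset Strict Implicit.
Unset Printing Implicit Defensive.

Import Order.TTheory GRing.Theory Num.Theory.
Import numFieldNormedType.Exports.

Local Open Scope classical_set_scope.
Local Open Scope ring_scope.

(* All manifolds below are relatively open subsets of affine subspaces of a
   normed space.  Such a manifold is given by its set of points [A] and the
   direction [T] of the affine subspace; [T] is the tangent space at every
   point.  If [X] is in [A] and [U] in [T], then [X + h *: U] is in [A] for all
   small [h], so ['D_U f X] only depends on [f] on [A]: it is the differential
   of [f] at [X] applied to the tangent vector [U]. *)

Section Manifolds.
Context {R : realType}.

(* [f] is of class C^r on [A]: the iterated directional derivatives of order at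
   most [r] along tangent vectors exist and are continuous on [A]. *)
Fixpoint of_class (r : nat) (V W : normedModType R) (A T : set V)
    (f : V -> W) : Prop :=
  match r with
  | 0 => {within A, continuous f}
  | s.+1 => {within A, continuous f} /\
            forall v, T v ->
              (forall x, A x -> derivable f x v) /\ of_class s A T ('D_v f)
  end.

Definition smooth (V W : normedModType R) (A T : set V) (f : V -> W) : Prop :=
  forall r, of_class r A T f.

(* The inverse of the bijection [f] from [A] onto its image. *)
Definition inv_on (V W : normedModType R) (A : set V) (f : V -> W) : W -> V :=
  'pinv_(fun=> 0) A f.

Definition diffeo (V W : normedModType R) (A TA : set V) (B TB : set W)
    (f : V -> W) : Prop :=
  [/\ set_bij A B f, smooth A TA f & smooth B TB (inv_on A f)].

(* A metric maps a point and two tangent vectors at that point to a scalar. *)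
Definition riem_isometry (V W : normedModType R)
    (A TA : set V) (gA : V -> V -> V -> R)
    (B TB : set W) (gB : W -> W -> W -> R) (f : V -> W) : Prop :=
  diffeo A TA B TB f /\
  forall X, A X -> forall U U', TA U -> TA U' ->
    gB (f X) ('D_U f X) ('D_U' f X) = gA X U U'.

Definition lie_isomorphism (V W : normedModType R)
    (A TA : set V) (opA : V -> V -> V)
    (B TB : set W) (opB : W -> W -> W) (f : V -> W) : Prop :=
  diffeo A TA B TB f /\
  forall X Y, A X -> A Y -> f (opA X Y) = opB (f X) (f Y).

Definition pullback_law (V W : normedModType R) (A : set V) (phi : V -> W) :
    V -> V -> V :=
  fun X Y => inv_on A phi (phi X + phi Y).

End Manifolds.

Section Spaces.
Context {R : realType} {k : nat}.
Implicit Types A : 'M[R]_k.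

Definition Sym : set 'M[R]_k := [set A | A^T = A].

Definition SymPos : set 'M[R]_k :=
  [set A | A^T = A /\
           forall x : 'cV[R]_k, x != 0 -> 0 < (x^T *m A *m x) ord0 ord0].

Definition Cor : set 'M[R]_k :=
  [set A | SymPos A /\ forall i, A i i = 1].

Definition Hol : set 'M[R]_k :=
  [set A | A^T = A /\ forall i, A i i = 0].

Definition Row0 : set 'M[R]_k :=
  [set A | A^T = A /\ forall i, \sum_j A i j = 0].

Definition Diag : set 'M[R]_k := [set A | is_diag_mx A].

Definition DiagPos : set 'M[R]_k :=
  [set A | is_diag_mx A /\ forall i, 0 < A i i].

Definition diag_part A : 'M[R]_k := diag_mx (\row_i A i i).

Definition off A : 'M[R]_k := A - diag_part A.

Definition frob A B : R := \tr (A *m B).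

End Spaces.

Arguments Sym R k : clear implicits.
Arguments SymPos R k : clear implicits.
Arguments Cor R k : clear implicits.
Arguments Hol R k : clear implicits.
Arguments Row0 R k : clear implicits.
Arguments Diag R k : clear implicits.
Arguments DiagPos R k : clear implicits.

Section Logarithms.
Context {R : realType} {k : nat}.
Implicit Types A S X : 'M[R]_k.

Definition mexp A : 'M[R]_k :=
  limn (series (fun j : nat => (j`!%:R)^-1 *: A ^+ j)).

(* On [SymPos R k], the inverse of the bijection [mexp : Sym R k -> SymPos R k]. *)
Definition mlog : 'M[R]_k -> 'M[R]_k := inv_on (Sym R k) mexp.

(* The unique diagonal matrix [D] with [mexp (D + S)] a correlation matrix. *)
Definition calD S : 'M[R]_k :=
  xget 0 [set D | Diag R k D /\ Cor R k (mexp (D + S))].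

Definition offlog X : 'M[R]_k := off (mlog X).

(* The unique positive diagonal [D] such that [mlog (D X D)] has null row sums. *)
Definition calDstar X : 'M[R]_k :=
  xget 0 [set D | DiagPos R k D /\ Row0 R k (mlog (D *m X *m D))].

Definition logscaled X : 'M[R]_k := mlog (calDstar X *m X *m calDstar X).

Definition cor_of X : 'M[R]_k :=
  let D := diag_mx (\row_i (Num.sqrt (X i i))^-1) in D *m X *m D.

Definition pullback_metric (phi : 'M[R]_k -> 'M[R]_k) :
    'M[R]_k -> 'M[R]_k -> 'M[R]_k -> R :=
  fun X U U' => frob ('D_U phi X) ('D_U' phi X).

Definition gLE := pullback_metric mlog.
Definition gOL := pullback_metric offlog.
Definition gLS := pullback_metric logscaled.

Definition lawLE := pullback_law (SymPos R k) mlog.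
Definition lawOL := pullback_law (Cor R k) offlog.
Definition lawLS := pullback_law (Cor R k) logscaled.

End Logarithms.

Section Maps.
Context {R : realType} {k : nat}.

Definition psiOL (S : 'M[R]_k) : 'M[R]_(1 + k) :=
  let d : 'cV[R]_k := \col_i S i i in
  block_mx 0                           ((Num.sqrt 2)^-1 *: d^T)
           ((Num.sqrt 2)^-1 *: d)      (off S).

(* Helmert contrasts; rows and columns are numbered from 0, so that row [i]
   here is row [i.+1] in the usual numbering. *)
Definition helmert : 'M[R]_(k, 1 + k) :=
  \matrix_(i, j)
    if (j <= i)%N then (Num.sqrt (i.+1 * i.+2)%:R)^-1
    else if j == i.+1 :> nat then - (i.+1%:R / Num.sqrt (i.+1 * i.+2)%:R)
    else 0.

Definition PhiOL (X : 'M[R]_k) : 'M[R]_(1 + k) :=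
  mexp (calD (psiOL (mlog X)) + psiOL (mlog X)).

Definition PhiLS (X : 'M[R]_k) : 'M[R]_(1 + k) :=
  cor_of (mexp (helmert^T *m mlog X *m helmert)).

End Maps.

(* Main.v *)
Require Import Defs.
From HB Require Import structures.
From mathcomp Require Import all_boot all_order all_algebra.
From mathcomp Require Import all_classical all_reals all_analysis.
From mathcomp Require Import ring lra.

Set Implicit Arguments.
Unset Strict Implicit.
Unset Printing Implicit Defensive.

Import Order.TTheory GRing.Theory Num.Theory.
Import numFieldNormedType.Exports.

Local Open Scope classical_set_scope.
Local Open Scope ring_scope.

(* Read in the global charts [mlog], [offlog] and [logscaled], the three maps are the
   linear Frobenius isometries [psiOL], [S |-> B^T S B] and the second after the inverse of
   the first.  What needs proof is that these charts are diffeomorphisms onto the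
   symmetric, hollow and null row sum matrices.

   - Smoothness of [mexp]: if [M T = T N] then [mexp M T = T mexp N], and this shows that
     the upper right block of [mexp] at [[X, X - Y], [0, Y]] is [mexp X - mexp Y]; so the
     derivative of [mexp] at [X] along [H] is the same block at [[X, H], [0, X]].
   - Expanding traces over the eigenvectors of two symmetric matrices [A] and [B] gives
     [c |A - B|^2 <= tr ((mexp A - mexp B) (A - B))] when [c] bounds the spectra of [mexp A]
     and [mexp B] from below, and Klein's inequality
     [tr (mexp A) + tr (mexp A (B - A)) <= tr (mexp B)].
   - [calD S] minimises [tr (mexp (D + S)) - tr D] over the diagonal matrices [D].
   - [mlog M] has null row sums if and only if [M 1 = 1], so [calDstar X] has the diagonal
     [x > 0] determined by [x_i (X x)_i = 1], a critical point of
     [x^T X x / 2 - sum_i ln x_i].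
   - Each chart is continuous by the strong monotonicity above, and is then smooth because
     it solves an equation [f (g x) = h x] with [f], [h] smooth and the derivative of [f]
     injective. *)

(** * Smooth maps between matrix spaces *)

(** The sets involved have in general empty interior among all matrices, and [smooth] only speaks of
    derivatives along tangent vectors, a notion without a convenient chain rule. Every map is
    therefore extended to an open set of matrices by composing it with a linear projection, [symm]
    or [hol_proj], and [of_class_Cinf] returns to the original set at the end. The price is that an
    implicit equation must be nondegenerate in all directions of the matrix space: the skew part
    [A - symm A] is added to the equations for [mlog] and [unlog]; it vanishes at the solution and
    splits off from the linearised equation by symmetry. The solutions are already known to exist
    globally, so the implicit function theorem serves only to raise regularity. It takes continuity
    of the solution as a hypothesis, which is why a Lipschitz estimate precedes each smoothness
    lemma. *)

Section MatrixNorm.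
Context {R : realType}.

Lemma mx_entry_le_norm m n (A : 'M[R]_(m, n)) i j : `|A i j| <= `|A|.
Proof. by rewrite [leRHS]/Num.Def.normr/= mx_normrE; exact: (le_bigmax _ _ (i, j)). Qed.

Lemma mx_norm_le m n (A : 'M[R]_(m, n)) c :
  0 <= c -> (forall i j, `|A i j| <= c) -> `|A| <= c.
Proof.
by move=> c0 Ac; rewrite [leLHS]/Num.Def.normr/= mx_normrE bigmax_le// => -[i j] _; exact: Ac.
Qed.

Lemma mx_norm_mul m n p (A : 'M[R]_(m, n)) (B : 'M[R]_(n, p)) :
  `|A *m B| <= n%:R * (`|A| * `|B|).
Proof.
apply: mx_norm_le => [|i j]; first by rewrite !mulr_ge0.
rewrite mxE (le_trans (ler_norm_sum _ _ _))//.
rewrite (@le_trans _ _ (\sum_(k < n) `|A| * `|B|))//.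
  by apply: ler_sum => k _; rewrite normrM ler_pM ?mx_entry_le_norm.
by rewrite sumr_const card_ord mulr_natl.
Qed.

Lemma linear_mx_continuous m n (W : normedModType R)
  (f : {linear 'M[R]_(m, n) -> W}) : continuous f.
Proof.
have -> : (f : _ -> _) = fun x => \sum_i \sum_j x i j *: f (delta_mx i j).
  apply/funext => x; rewrite {1}[x]matrix_sum_delta linear_sum/=.
  by apply: eq_bigr => i _; rewrite linear_sum/=; apply: eq_bigr => j _; rewrite linearZ.
apply: (continuous_big add_continuous) => i _.
apply: (continuous_big add_continuous) => j _ x.
exact: (cvgZr_tmp (@coord_continuous _ m n i j x)).
Qed.

Lemma continuous_mx (V : topologicalType) m n (f : V -> 'M[R]_(m, n)) x :
  (forall i j, {for x, continuous (fun y => f y i j)}) -> {for x, continuous f}.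
Proof.
move=> cf; apply/cvgrPdist_le => e e0.
have : \forall y \near x, forall i j, `|f x i j - f y i j| <= e.
  apply: filter_forall => i; apply: filter_forall => j.
  by have /cvgrPdist_le := cf i j; apply.
by apply: filterS => y fy; apply: mx_norm_le => [|i j]; [exact: ltW|rewrite !mxE].
Qed.

End MatrixNorm.

(** * Frechet derivatives in epsilon form *)

Section FrechetDerivative.
Context {R : realType}.

Lemma differentiable_epsP (V W : normedModType R) (f : V -> W) x
    (L : {linear V -> W}) : continuous L ->
  (forall e, 0 < e -> \forall y \near x, `|f y - f x - L (y - x)| <= e * `|y - x|) ->
  differentiable f x /\ 'd f x = L :> (V -> W).
Proof.
move=> Lc Lf.
have fE : f \o shift x = cst (f x) + L +o_ 0 id.
  apply/eqaddoP => e e0 /=.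
  have := Lf _ e0; rewrite (near_shift 0 x) /=.
  by apply: filterS => h /=; rewrite !fctE /= subr0 addrK opprD addrA.
by have dL := diff_unique Lc fE; split=> //; apply/diff_locallyP; rewrite dL.
Qed.

Lemma differentiable_eps (V W : normedModType R) (f : V -> W) x :
  differentiable f x -> forall e, 0 < e ->
  \forall y \near x, `|f y - f x - 'd f x (y - x)| <= e * `|y - x|.
Proof.
move=> /diff_locally /eqaddoP H e e0; rewrite (near_shift 0 x) /=.
by apply: filterS (H e e0) => h /=; rewrite !fctE /= subr0 addrK opprD addrA.
Qed.

Lemma near_eq_differentiable (V W : normedModType R) (f g : V -> W) x :
  {near x, f =1 g} -> differentiable f x -> differentiable g x.
Proof.
move=> fg df; have fgx := nbhs_singleton fg.
apply: (proj1 (differentiable_epsP (diff_continuous df) _)) => e e0.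
by near=> y; rewrite -fgx -(near fg y)//; near: y; exact: differentiable_eps.
Unshelve. all: by end_near. Qed.

Lemma differentiable_mx (V : normedModType R) m n (f : V -> 'M[R]_(m, n)) x :
  (forall i j, differentiable (fun y => f y i j) x) -> differentiable f x.
Proof.
move=> df.
have -> : f = \sum_i \sum_j (fun y => f y i j *: delta_mx i j).
  apply/funext => y; rewrite fct_sumE {1}[f y]matrix_sum_delta.
  by apply: eq_bigr => i _; rewrite fct_sumE.
by do 2! (apply: differentiable_sum => ?); apply: differentiableZl.
Qed.

Lemma derive_entry (V : normedModType R) m n (f : V -> 'M[R]_(m, n)) x v i j :
  differentiable f x -> 'D_v (fun y => f y i j) x = 'D_v f x i j.
Proof. by move=> df; rewrite derive_mx ?mxE//; exact: diff_derivable. Qed.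

Lemma derive_comp (V : normedModType R) m n (f : V -> 'M[R]_(m, n))
    (W : normedModType R) (g : 'M[R]_(m, n) -> W) x v :
  differentiable f x -> differentiable g (f x) ->
  'D_v (g \o f) x = \sum_i \sum_j 'D_v (fun y => f y i j) x *: 'D_(delta_mx i j) g (f x).
Proof.
move=> df dg; rewrite deriveE; last exact: differentiable_comp.
rewrite diff_comp// /= -[in LHS](deriveE _ df) [X in 'd _ _ X]matrix_sum_delta.
rewrite linear_sum; apply: eq_bigr => i _; rewrite linear_sum; apply: eq_bigr => j _.
by rewrite linearZ/= derive_entry// (deriveE _ dg).
Qed.

End FrechetDerivative.

(** * Scalar functions of class C^r on open sets *)

Section Cr.
Context {R : realType}.

(** Frechet differentiability is required at each stage, since mere directional derivatives do not
    satisfy the chain rule. Values are scalar so that products, quotients and square roots make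
    sense; matrices are treated entrywise by [Cinf]. *)
Fixpoint Cr (r : nat) (V : normedModType R) (O : set V) (f : V -> R) : Prop :=
  match r with
  | 0 => forall x, O x -> {for x, continuous f}
  | s.+1 => (forall x, O x -> differentiable f x) /\ forall v, Cr s O ('D_v f)
  end.

Lemma CrS r (V : normedModType R) (O : set V) f : Cr r.+1 O f -> Cr r O f.
Proof.
elim: r f => [f [df _] x Ox|r IH f [df Df]].
  exact/differentiable_continuous/df.
by split=> // v; exact: IH.
Qed.

(** Derivatives depend only on germs, so agreement on an open set suffices. The closure lemmas below
    compute a derivative on [O] only and conclude through this lemma. *)
Lemma Cr_eq r (V : normedModType R) (O : set V) f g : open O ->
  (forall x, O x -> f x = g x) -> Cr r O f -> Cr r O g.
Proof.
move=> oO; elim: r f g => [|r IH] f g fg.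
  have E x : O x -> {near x, f =1 g}.
    by move=> Ox; apply: filterS (open_nbhs_nbhs (conj oO Ox)); exact: fg.
  move=> cf x Ox; rewrite /prop_for /continuous_at -fg//.
  exact: cvg_trans (near_eq_cvg (E x Ox)) (cf x Ox).
have E x : O x -> {near x, f =1 g}.
  by move=> Ox; apply: filterS (open_nbhs_nbhs (conj oO Ox)); exact: fg.
move=> [df Df]; split=> [x Ox|v]; first exact: near_eq_differentiable (E x Ox) (df x Ox).
by apply: IH (Df v) => x Ox; apply: near_eq_derive; exact: E.
Qed.

Lemma Cr_cst r (V : normedModType R) (O : set V) c : Cr r O (cst c).
Proof.
elim: r c => [c x _|r IH c]; first exact: cst_continuous.
split=> [x _|v]; first exact: differentiable_cst.
by rewrite (_ : 'D_v _ = cst 0)//; apply/funext => x; rewrite derive_cst.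
Qed.

Lemma Cr_coord r m n (O : set 'M[R]_(m, n)) i j : Cr r O (fun x => x i j).
Proof.
case: r => [x _|r]; first exact: coord_continuous.
split=> [x _|v]; first exact: differentiable_coord.
rewrite (_ : 'D_v _ = cst (v i j)); first exact: Cr_cst.
apply/funext => x; rewrite (@derive_entry _ _ _ _ id)//.
by rewrite derive_id.
Qed.

Lemma CrD r (V : normedModType R) (O : set V) f g : open O -> Cr r O f -> Cr r O g ->
  Cr r O (fun x => f x + g x).
Proof.
move=> oO; elim: r f g => [f g cf cg x Ox|r IH f g [df Df] [dg Dg]].
  by apply: cvgD; [exact: cf|exact: cg].
split=> [x Ox|v]; first by apply: differentiableD; [exact: df|exact: dg].
apply: Cr_eq (IH _ _ (Df v) (Dg v)) => // x Ox.
by rewrite -deriveD//; apply: diff_derivable; [exact: df|exact: dg].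
Qed.

Lemma CrM r (V : normedModType R) (O : set V) f g : open O -> Cr r O f -> Cr r O g ->
  Cr r O (fun x => f x * g x).
Proof.
move=> oO; elim: r f g => [f g cf cg x Ox|r IH f g cf cg].
  by apply: cvgM; [exact: cf|exact: cg].
have [[df Df] [dg Dg]] := (cf, cg).
split=> [x Ox|v]; first by apply: differentiableM; [exact: df|exact: dg].
apply: Cr_eq (CrD oO (IH _ _ (CrS cf) (Dg v)) (IH _ _ (CrS cg) (Df v))) => // x Ox.
by rewrite -[LHS]deriveM//; apply: diff_derivable; [exact: df|exact: dg].
Qed.

Lemma CrZ r (V : normedModType R) (O : set V) c f : open O -> Cr r O f ->
  Cr r O (fun x => c * f x).
Proof. by move=> oO; apply: CrM => //; exact: Cr_cst. Qed.

Lemma CrB r (V : normedModType R) (O : set V) f g : open O -> Cr r O f -> Cr r O g ->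
  Cr r O (fun x => f x - g x).
Proof.
move=> oO cf cg; apply: Cr_eq (CrD oO cf (CrZ (-1) oO cg)) => // x _.
by rewrite mulN1r.
Qed.

Lemma Cr_sum r (V : normedModType R) (O : set V) I (s : seq I) (P : pred I) f :
  open O -> (forall i, P i -> Cr r O (f i)) -> Cr r O (fun x => \sum_(i <- s | P i) f i x).
Proof.
move=> oO cf; elim: s => [|i s IH].
  by apply: Cr_eq (Cr_cst r O 0) => // x _; rewrite big_nil.
case Pi : (P i).
  by apply: Cr_eq (CrD oO (cf _ Pi) IH) => // x _; rewrite big_cons Pi.
by apply: Cr_eq IH => // x _; rewrite big_cons Pi.
Qed.

Lemma Cr_prod r (V : normedModType R) (O : set V) I (s : seq I) f :
  open O -> (forall i, Cr r O (f i)) -> Cr r O (fun x => \prod_(i <- s) f i x).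
Proof.
move=> oO cf; elim: s => [|i s IH].
  by apply: Cr_eq (Cr_cst r O 1) => // x _; rewrite big_nil.
by apply: Cr_eq (CrM oO (cf i) IH) => // x _; rewrite big_cons.
Qed.

(** The derivative - f' / f^2 is a product of [f'] and of 1 / f itself, so the induction hypothesis
    at the lower order applies. [Cr_sqrt] follows the same pattern. *)
Lemma CrV r (V : normedModType R) (O : set V) f : open O -> (forall x, O x -> f x != 0) ->
  Cr r O f -> Cr r O (fun x => (f x)^-1).
Proof.
move=> oO f0; elim: r => [cf x Ox|r IH cf].
  by apply: cvgV; [exact: f0|exact: cf].
have [df Df] := cf; have IH' := IH (CrS cf).
split=> [x Ox|v]; first by apply: differentiableV; [exact: df|exact: f0].
apply: Cr_eq (CrZ (-1) oO (CrM oO (CrM oO IH' IH') (Df v))) => // x Ox.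
rewrite [RHS]deriveV ?f0//; last exact/diff_derivable/df.
by rewrite mulN1r /GRing.scale/= mulNr expr2 invfM.
Qed.

Lemma differentiable_sqrt (x : R) : 0 < x -> differentiable (@Num.sqrt R) x.
Proof. by move=> x0; apply/derivable1_diffP; have [] := is_derive1_sqrt x0. Qed.

Lemma Cr_sqrt r (V : normedModType R) (O : set V) f : open O -> (forall x, O x -> 0 < f x) ->
  Cr r O f -> Cr r O (fun x => Num.sqrt (f x)).
Proof.
move=> oO f0; elim: r => [cf x Ox|r IH cf].
  by apply: continuous_comp; [exact: cf|exact: sqrt_continuous].
have [df Df] := cf; have IH' := IH (CrS cf).
split=> [x Ox|v].
  by apply: differentiable_comp; [exact: df|exact/differentiable_sqrt/f0].
have s0 x : O x -> 2 * Num.sqrt (f x) != 0.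
  by move=> Ox; rewrite mulf_neq0 ?gt_eqF// sqrtr_gt0 f0.
apply: Cr_eq (CrM oO (Df v) (CrV oO s0 (CrZ 2 oO IH'))) => // x Ox.
have dfx := df x Ox; have ds := differentiable_sqrt (f0 x Ox).
rewrite [in RHS]deriveE; last exact: differentiable_comp.
rewrite diff_comp//= -(deriveE _ dfx) -[in RHS](mulr1 ('D_v f x)).
rewrite -[_ * 1]/(_ *: 1) linearZ/= -(deriveE _ ds) derive_sqrt//; exact: f0.
Qed.

(** The induction generalises [g], because the chain rule brings in the partial derivatives of [g]
    as new outer functions. *)
Lemma Cr_comp r (V : normedModType R) m n (O : set V) (O' : set 'M[R]_(m, n))
    (f : V -> 'M[R]_(m, n)) (g : 'M[R]_(m, n) -> R) : open O -> open O' ->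
  (forall i j, Cr r O (fun x => f x i j)) -> Cr r O' g -> (forall x, O x -> O' (f x)) ->
  Cr r O (g \o f).
Proof.
move=> oO oO'; elim: r f g => [|r IH] f g cf cg fO.
  move=> x Ox; apply: continuous_comp; last exact/cg/fO.
  by apply: continuous_mx => i j; exact: cf.
have df x : O x -> differentiable f x.
  by move=> Ox; apply: differentiable_mx => i j; case: (cf i j) => + _; apply.
have [dg Dg] := cg.
split=> [x Ox|v]; first by apply: differentiable_comp; [exact: df|exact/dg/fO].
have cf' i j := CrS (cf i j).
suff H : Cr r O (fun x => \sum_i \sum_j 'D_v (fun y => f y i j) x * ('D_(delta_mx i j) g \o f) x).
  by apply: Cr_eq H => // x Ox; rewrite derive_comp//; [exact: df|exact/dg/fO].
apply: Cr_sum => // i _; apply: Cr_sum => // j _; apply: CrM => //.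
  by have [_] := cf i j; apply.
exact: IH cf' (Dg _) fO.
Qed.

End Cr.

(** * Smooth matrix-valued maps and an implicit function theorem *)

Section SmoothMatrixMaps.
Context {R : realType}.

Lemma Cr_det r (V : normedModType R) (O : set V) n (M : V -> 'M[R]_n) : open O ->
  (forall i j, Cr r O (fun x => M x i j)) -> Cr r O (fun x => \det (M x)).
Proof.
move=> oO cM; apply: Cr_sum => // s _; apply: CrZ => //.
by apply: Cr_prod.
Qed.

(** Cramer's rule writes each entry as a quotient of determinants. *)
Lemma Cr_invmx r (V : normedModType R) (O : set V) n (M : V -> 'M[R]_n) : open O ->
  (forall i j, Cr r O (fun x => M x i j)) -> (forall x, O x -> M x \in unitmx) ->
  forall i j, Cr r O (fun x => invmx (M x) i j).
Proof.
move=> oO cM uM i j.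
apply: (@Cr_eq _ r V O (fun x => (\det (M x))^-1 *
    ((-1) ^+ (j + i) * \det (row' j (col' i (M x)))))) => //.
  by move=> x Ox; rewrite /invmx uM// !mxE.
apply: CrM => //.
  apply: CrV => //; last exact: Cr_det.
  by move=> x /uM; rewrite unitmxE unitfE.
apply: CrZ => //; apply: Cr_det => // a b.
by apply: Cr_eq (cM (lift j a) (lift i b)) => // x _; rewrite !mxE.
Qed.

Definition Cinf (V : normedModType R) m n (O : set V) (f : V -> 'M[R]_(m, n)) :=
  forall r i j, Cr r O (fun x => f x i j).

Lemma Cinf_eq (V : normedModType R) m n (O : set V) (f g : V -> 'M[R]_(m, n)) : open O ->
  (forall x, O x -> f x = g x) -> Cinf O f -> Cinf O g.
Proof. by move=> oO fg cf r i j; apply: Cr_eq (cf r i j) => // x Ox; rewrite fg. Qed.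

Lemma Cinf_comp (V : normedModType R) m n p q (O : set V) (O' : set 'M[R]_(m, n))
    (f : V -> 'M[R]_(m, n)) (g : 'M[R]_(m, n) -> 'M[R]_(p, q)) : open O -> open O' ->
  Cinf O f -> Cinf O' g -> (forall x, O x -> O' (f x)) -> Cinf O (g \o f).
Proof. by move=> oO oO' cf cg fO r i j; apply: (Cr_comp oO oO' (cf r) (cg r i j)). Qed.

Lemma Cinf_linear m n p q (O : set 'M[R]_(m, n)) (f : {linear 'M[R]_(m, n) -> 'M[R]_(p, q)}) :
  open O -> Cinf O f.
Proof.
move=> oO r i j.
apply: (@Cr_eq _ r _ O (fun x => \sum_a \sum_b f (delta_mx a b) i j * x a b)) => //.
  move=> x _; rewrite [in RHS](matrix_sum_delta x) linear_sum summxE.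
  apply: eq_bigr => a _; rewrite linear_sum summxE; apply: eq_bigr => b _.
  by rewrite linearZ/= mxE mulrC.
apply: Cr_sum => // a _; apply: Cr_sum => // b _; apply: CrZ => //; exact: Cr_coord.
Qed.

Lemma CinfD (V : normedModType R) m n (O : set V) (f g : V -> 'M[R]_(m, n)) : open O ->
  Cinf O f -> Cinf O g -> Cinf O (fun x => f x + g x).
Proof.
move=> oO cf cg r i j; apply: Cr_eq (CrD oO (cf r i j) (cg r i j)) => // x _.
by rewrite mxE.
Qed.

Lemma CinfB (V : normedModType R) m n (O : set V) (f g : V -> 'M[R]_(m, n)) : open O ->
  Cinf O f -> Cinf O g -> Cinf O (fun x => f x - g x).
Proof.
move=> oO cf cg r i j; apply: Cr_eq (CrB oO (cf r i j) (cg r i j)) => // x _.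
by rewrite !mxE.
Qed.

Lemma Cinf_mul (V : normedModType R) m n p (O : set V)
    (f : V -> 'M[R]_(m, n)) (g : V -> 'M[R]_(n, p)) : open O ->
  Cinf O f -> Cinf O g -> Cinf O (fun x => f x *m g x).
Proof.
move=> oO cf cg r i j.
apply: (@Cr_eq _ r _ O (fun x => \sum_k f x i k * g x k j)) => //.
  by move=> x _; rewrite mxE.
by apply: Cr_sum => // k _; apply: CrM; [|exact: cf|exact: cg].
Qed.

Lemma Cinf_cst (V : normedModType R) m n (O : set V) (A : 'M[R]_(m, n)) : Cinf O (fun=> A).
Proof. move=> r i j; exact: Cr_cst. Qed.

Lemma Cinf_differentiable (V : normedModType R) m n (O : set V) (f : V -> 'M[R]_(m, n)) x :
  Cinf O f -> O x -> differentiable f x.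
Proof. by move=> cf Ox; apply: differentiable_mx => i j; have [+ _] := cf 1 i j; apply. Qed.

Lemma Cinf_continuous (V : normedModType R) m n (O : set V) (f : V -> 'M[R]_(m, n)) x :
  Cinf O f -> O x -> {for x, continuous f}.
Proof. by move=> cf Ox; exact/differentiable_continuous/(Cinf_differentiable cf). Qed.

Lemma Cinf_derive (V : normedModType R) m n (O : set V) (f : V -> 'M[R]_(m, n)) v :
  open O -> Cinf O f -> Cinf O ('D_v f).
Proof.
move=> oO cf r i j; have [_ /(_ v)] := cf r.+1 i j; apply: Cr_eq => // x Ox.
by rewrite derive_entry//; exact: Cinf_differentiable cf _.
Qed.

(** With [D = g x - g x0], applying the left inverse [K] of the differential of [f] gives
    [D - L (x - x0) = K (r2 - r1)], where [r1] is small against [D] and [r2] against [x - x0]. A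
    first pass bounds [D] by a multiple of [x - x0]; a second pass then makes both remainders small
    against [x - x0]. *)
Lemma differentiable_implicit (V : normedModType R) m n (f : 'M[R]_(m, n) -> 'M[R]_(m, n))
    (g h : V -> 'M[R]_(m, n)) x0 (K : {linear 'M[R]_(m, n) -> 'M[R]_(m, n)}) :
  (\forall x \near x0, f (g x) = h x) -> {for x0, continuous g} ->
  differentiable f (g x0) -> differentiable h x0 ->
  (forall u, K ('d f (g x0) u) = u) ->
  differentiable g x0 /\ forall v, 'd g x0 v = K ('d h x0 v).
Proof.
move=> fgh cg df dh KD.
have Kc : continuous K by exact: linear_mx_continuous.
have [c c0 Kle] := linear_lipschitz Kc.
have [d d0 hle] := linear_lipschitz (diff_continuous dh).
pose L : {linear V -> 'M[R]_(m, n)} := K \o 'd h x0.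
have Lc : continuous L.
  by move=> x; apply: continuous_comp; [exact: diff_continuous|exact: Kc].
suff H : forall e, 0 < e -> \forall y \near x0, `|g y - g x0 - L (y - x0)| <= e * `|y - x0|.
  have [dg E] := differentiable_epsP Lc H.
  by split=> [|v]; [exact: dg|have /(congr1 (@^~ v)) := E].
move=> e e0.
(* In each minimum one bound serves the first pass ([1], and [(2 * c)^-1] to absorb half of [D]),
   the other makes the corresponding remainder at most [e / 2] times [x - x0]. *)
pose e2 := Num.min 1 (e / (2 * c)).
have e20 : 0 < e2 by rewrite lt_min ltr01 divr_gt0// mulr_gt0.
pose e1 := Num.min (2 * c)^-1 (e / (4 * c ^+ 2 * (d + 1))).
have e10 : 0 < e1.
  by rewrite lt_min invr_gt0 divr_gt0 ?mulr_gt0 ?exprn_gt0 ?addr_gt0.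
have fgh0 := nbhs_singleton fgh.
have near1 : \forall x \near x0,
    `|f (g x) - f (g x0) - 'd f (g x0) (g x - g x0)| <= e1 * `|g x - g x0|.
  exact: cg _ (differentiable_eps df e10).
have near2 := differentiable_eps dh e20.
near=> x.
pose D := g x - g x0; pose r1 := f (g x) - f (g x0) - 'd f (g x0) D.
pose r2 := h x - h x0 - 'd h x0 (x - x0).
have r1le : `|r1| <= e1 * `|D|.
  by rewrite /r1 /D; near: x.
have r2le : `|r2| <= e2 * `|x - x0| by rewrite /r2; near: x.
have DE : D - L (x - x0) = K (r2 - r1).
  rewrite /= -[D in LHS]KD -linearB; congr (K _).
  by rewrite /r1 /r2 (near fgh x)// fgh0 opprB [RHS]addrC addrA subrK.
have le1 : `|D - L (x - x0)| <= c * (e2 * `|x - x0| + e1 * `|D|).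
  rewrite DE (le_trans (Kle _))// ler_pM2l// (le_trans (ler_normB _ _))//.
  by rewrite lerD.
have Lle : `|L (x - x0)| <= c * (d * `|x - x0|).
  by rewrite /= (le_trans (Kle _))// ler_pM2l.
have Dle : `|D| <= `|D - L (x - x0)| + `|L (x - x0)|.
  by rewrite -{1}[D](subrK (L (x - x0))) ler_normD.
have e1c : c * e1 <= 2^-1.
  rewrite -(@ler_pM2l _ 2)// mulrA divff// -ler_pdivlMl ?mulr_gt0// mulr1.
  by rewrite ge_min lexx.
have e1c' : c * e1 * (2 * c * (d + 1)) <= e / 2.
  have : e1 <= e / (4 * c ^+ 2 * (d + 1)) by rewrite ge_min lexx orbT.
  rewrite ler_pdivlMr ?mulr_gt0 ?exprn_gt0 ?addr_gt0//; lra.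
have e2c : c * e2 <= e / 2.
  have : e2 <= e / (2 * c) by rewrite ge_min lexx orbT.
  rewrite ler_pdivlMr ?mulr_gt0//; lra.
have e21 : e2 <= 1 by rewrite ge_min lexx.
have t0 : 0 <= `|x - x0| by [].
have D0 : 0 <= `|D| by [].
move: le1 Lle Dle t0 D0; rewrite -/D.
move: (`|D - L (x - x0)|) (`|L (x - x0)|) (`|D|) (`|x - x0|) => a b D' t le1 Lle Dle t0 D0.
have D'le : D' <= 2 * c * (d + 1) * t.
  have A1 : c * e1 * D' <= 2^-1 * D' by rewrite ler_wpM2r.
  have A2 : c * e2 * t <= c * 1 * t by rewrite ler_wpM2r// ler_pM2l.
  lra.
have B1 : c * e1 * D' <= c * e1 * (2 * c * (d + 1) * t).
  by rewrite ler_wpM2l// mulr_ge0 ?ltW.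
have B2 : c * e1 * (2 * c * (d + 1)) * t <= e / 2 * t by rewrite ler_wpM2r.
have B3 : c * e2 * t <= e / 2 * t by rewrite ler_wpM2r.
lra.
Unshelve. all: by end_near. Qed.

(** Bootstrapping: the derivative of [g] is the inverse Jacobian of [f] at [g x] applied to the
    derivative of [h]. If [g] is C^r then so is this expression, by [Cr_invmx], hence [g] is
    C^(r+1). *)
Lemma Cinf_implicit (V : normedModType R) m n (O : set V) (O' : set 'M[R]_(m, n))
    (f : 'M[R]_(m, n) -> 'M[R]_(m, n)) (g h : V -> 'M[R]_(m, n)) :
  open O -> open O' -> Cinf O' f -> Cinf O h ->
  (forall x, O x -> O' (g x)) -> (forall x, O x -> f (g x) = h x) ->
  (forall x, O x -> {for x, continuous g}) ->
  (forall x u, O x -> 'D_u f (g x) = 0 -> u = 0) ->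
  Cinf O g.
Proof.
move=> oO oO' cf ch gO fgh cg inj.
(* The matrix of the differential on vectorised matrices. It is square, so an injective differential
   makes it invertible. *)
pose J y := lin_mx ('d f y).
have JE y a b : O' y -> J y a b = mxvec ('D_(vec_mx (delta_mx 0 a)) f y) 0 b.
  move=> O'y; rewrite deriveE; last exact: Cinf_differentiable cf _.
  by rewrite -mul_vec_lin vec_mxK -rowE [RHS]mxE.
have Ju x : O x -> J (g x) \in unitmx.
  move=> Ox; have df := Cinf_differentiable cf (gO x Ox).
  rewrite -row_free_unit; apply: inj_row_free => v.
  rewrite -[v]vec_mxK mul_vec_lin -(deriveE _ df) => /(congr1 vec_mx).
  by rewrite mxvecK linear0 => /(inj x _ Ox) ->; rewrite linear0.
have H x : O x -> differentiable g x /\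
    forall v, 'd g x v = vec_mx (mxvec ('d h x v) *m invmx (J (g x))).
  move=> Ox.
  apply: (@differentiable_implicit _ _ _ f _ _ _ (vec_mx \o mulmxr (invmx (J (g x))) \o mxvec)).
  - by apply: filterS (open_nbhs_nbhs (conj oO Ox)); exact: fgh.
  - exact: cg.
  - exact/(Cinf_differentiable cf)/gO.
  - exact: Cinf_differentiable ch _.
  - by move=> u /=; rewrite -mul_vec_lin mulmxK ?mxvecK ?Ju.
elim=> [i j x Ox|r IH i j].
  apply: (@continuous_comp _ _ _ g (fun M : 'M[R]_(m, n) => M i j) x).
    exact: cg.
  exact: coord_continuous.
have gE v x : O x -> 'D_v (fun y => g y i j) x =
    \sum_b (mxvec ('D_v h x)) 0 b * invmx (J (g x)) b (mxvec_index i j).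
  move=> Ox; have [dg dgE] := H x Ox; rewrite derive_entry// deriveE// dgE.
  by rewrite (deriveE _ (Cinf_differentiable ch Ox)) -mxvecE vec_mxK mxE.
split=> [x Ox|v].
  have [dg _] := H x Ox.
  apply: (differentiable_comp (g := fun M : 'M[R]_(m, n) => M i j)) => //.
  exact: differentiable_coord.
apply: (Cr_eq oO (fun x Ox => esym (gE v x Ox))).
apply: Cr_sum => // b _; apply: CrM => //.
  case/mxvec_indexP: b => a b.
  by apply: Cr_eq (Cinf_derive v oO ch r a b) => // x Ox; rewrite mxvecE.
apply: Cr_invmx => // a c.
have {}cJ : Cr r O' (fun y => J y a c).
  case/mxvec_indexP: c => c1 c2.
  apply: Cr_eq (Cinf_derive (vec_mx (delta_mx 0 a)) oO' cf r c1 c2) => // y O'y.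
  by rewrite JE// mxvecE.
exact: Cr_comp oO oO' IH cJ gO.
Qed.

Lemma derive_eq_line (V W : normedModType R) (f F : V -> W) x v : f x = F x ->
  (\forall h \near 0, f (h *: v + x) = F (h *: v + x)) -> 'D_v f x = 'D_v F x.
Proof.
move=> fx fF; rewrite /derive; congr (lim _); apply/seteqP; split;
  apply: near_eq_cvg; apply: cvg_within; apply: filterS fF => h /= E; by rewrite E fx.
Qed.

Lemma derivable_eq_line (V W : normedModType R) (f F : V -> W) x v : f x = F x ->
  (\forall h \near 0, f (h *: v + x) = F (h *: v + x)) -> derivable F x v -> derivable f x v.
Proof.
move=> fx fF /cvg_ex[/= l Fl]; apply/cvg_ex; exists l => /=.
apply: cvg_trans Fl; apply: near_eq_cvg; apply: cvg_within.
by apply: filterS fF => h /= E; rewrite E fx.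
Qed.

(** Near a point of [A], lines in tangent directions stay in [A], where [f] and [F] agree.
    Tangential derivatives of [f] on [A] are thus those of [F], and the pair of derivatives
    satisfies the same hypotheses again. *)
Lemma of_class_Cinf (V : normedModType R) m n (A T O : set V) (f F : V -> 'M[R]_(m, n)) r :
  open O -> A `<=` O -> (forall x, A x -> f x = F x) ->
  (forall x v, A x -> T v -> \forall h \near (0 : R), A (h *: v + x)) ->
  Cinf O F -> of_class r A T f.
Proof.
move=> oO AO + AT; elim: r f F => [|r IH] f F fF cF.
all: have cA : {within A, continuous f} by
  apply: (@subspace_eq_continuous _ A _ F);
   [move=> x /set_mem/fF/esym
   |apply: continuous_in_subspaceT => x /set_mem/AO; exact: Cinf_continuous cF].
  exact: cA.
split; first exact: cA.
move=> v Tv.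
have line x : A x -> \forall h \near (0 : R), f (h *: v + x) = F (h *: v + x).
  by move=> Ax; apply: filterS (AT x v Ax Tv) => h; exact: fF.
split=> [x Ax|].
  apply: derivable_eq_line (line x Ax) _; first exact: fF.
  exact/diff_derivable/(Cinf_differentiable cF)/AO.
apply: (IH _ ('D_v F)); last exact: Cinf_derive.
by move=> x Ax; apply: derive_eq_line (line x Ax); exact: fF.
Qed.

End SmoothMatrixMaps.

(** * The matrix exponential *)

Section MatrixExponential.
Context {R : realType}.

Definition mexp_series k (A : 'M[R]_k) := series (fun j : nat => (j`!%:R)^-1 *: A ^+ j).

(** The norm is the largest absolute value of an entry, submultiplicative only up to the factor [k];
    hence the assumption on [k%:R * |A|]. *)
Lemma mx_norm_exp k (A : 'M[R]_k) c j : k%:R * `|A| <= c -> `|A ^+ j| <= c ^+ j.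
Proof.
move=> Ac; have c0 : 0 <= c by apply: le_trans Ac; rewrite mulr_ge0.
elim: j => [|j IH].
  rewrite !expr0; apply: mx_norm_le => // i j.
  by rewrite -[1]/(1%:M) mxE; case: eqP; rewrite ?normr1 ?normr0.
rewrite !exprS -[_ * A ^+ j]/(_ *m _) (le_trans (mx_norm_mul _ _))// mulrA.
by rewrite ler_pM// mulr_ge0.
Qed.

Lemma is_cvg_mexp k (A : 'M[R]_k) : cvgn (mexp_series A).
Proof.
(* Absolute convergence is available in complete normed modules; the structure is assembled here,
   and the series is dominated by the scalar exponential series at [k%:R * |A|]. *)
pose V : completeNormedModType R :=
  HB.pack 'M[R]_k (Uniform_isComplete.Build 'M[R]_k (@mx_complete R k k)).
apply: (@normed_cvg R V).
apply: (@series_le_cvg _ _ (exp_coeff (k%:R * `|A|))).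
- by move=> n; exact: normr_ge0.
- by move=> n; apply: exp_coeff_ge0; rewrite mulr_ge0.
- move=> n; rewrite /exp_coeff /= [leLHS](@normrZ _ 'M[R]_k) mulrC.
  by rewrite ger0_norm ?invr_ge0// ler_wpM2r ?invr_ge0// mx_norm_exp.
- exact: is_cvg_series_exp_coeff.
Qed.

Lemma cvg_mexp k (A : 'M[R]_k) : mexp_series A @ \oo --> mexp A.
Proof. exact: is_cvg_mexp. Qed.

(** It holds for each power, hence for the limit. Since [T] may be rectangular or singular, the
    lemma covers invariant subspaces, eigenvectors and block embeddings alike. *)
Lemma mexp_intertwine m n (M : 'M[R]_m) (N : 'M[R]_n) (T : 'M[R]_(m, n)) :
  M *m T = T *m N -> mexp M *m T = T *m mexp N.
Proof.
move=> MT.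
have powMT j : M ^+ j *m T = T *m N ^+ j.
  elim: j => [|j IH]; first exact: etrans (mul1mx _) (esym (mulmx1 _)).
  rewrite !exprS -[M * _]/(M *m _) -[N * _]/(N *m _).
  by rewrite -mulmxA IH mulmxA MT -mulmxA.
have cM : (mexp_series M n *m T) @[n --> \oo] --> mexp M *m T.
  apply: (@continuous_cvg _ _ _ _ _ _ (mulmxr T)); last exact: cvg_mexp.
  exact: linear_mx_continuous.
have cN : (T *m mexp_series N n) @[n --> \oo] --> T *m mexp N.
  apply: (@continuous_cvg _ _ _ _ _ _ (mulmx T)); last exact: cvg_mexp.
  exact: linear_mx_continuous.
apply: norm_cvg_unique cM _; rewrite (_ : (fun n => _) = fun n => T *m mexp_series N n)//.
apply/funext => n'; rewrite /mexp_series /series/= mulmx_suml mulmx_sumr.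
by apply: eq_bigr => j _; rewrite -scalemxAl -scalemxAr powMT.
Qed.

(** Telescoping gives a bound of the form j c^(j-1); the cruder [(2 * c) ^+ j] keeps the induction
    simple and still sums to [expR (2 * c)]. *)
Lemma mx_norm_subX k (X Y : 'M[R]_k) c j : 1 <= c ->
  k%:R * `|X| <= c -> k%:R * `|Y| <= c ->
  `|X ^+ j - Y ^+ j| <= (2 * c) ^+ j * (k%:R * `|X - Y|).
Proof.
move=> c1 Xc Yc; have c0 : 0 <= c by apply: le_trans c1.
have d0 : 0 <= k%:R * `|X - Y| by rewrite mulr_ge0.
elim: j => [|j IH]; first by rewrite !expr0 subrr normr0 mul1r.
have -> : X ^+ j.+1 - Y ^+ j.+1 = X *m (X ^+ j - Y ^+ j) + (X - Y) *m Y ^+ j.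
  rewrite mulmxBr mulmxBl !exprS -![X * _]/(X *m _) -![Y * _]/(Y *m _).
  by rewrite addrA subrK.
rewrite (le_trans (ler_normD _ _))// (le_trans (lerD (mx_norm_mul _ _) (mx_norm_mul _ _)))//.
rewrite mulrA (mulrA k%:R) exprS.
have pj : 1 <= 2 ^+ j :> R by rewrite exprn_ege1// ler1n.
have cj : 0 <= c ^+ j by rewrite exprn_ge0.
have h1 : k%:R * `|X| * `|X ^+ j - Y ^+ j| <= c * ((2 * c) ^+ j * (k%:R * `|X - Y|)).
  by rewrite ler_pM// mulr_ge0.
have h2 : k%:R * `|X - Y| * `|Y ^+ j| <= k%:R * `|X - Y| * (c * (2 * c) ^+ j).
  rewrite ler_wpM2l// (le_trans (mx_norm_exp j Yc))// exprMn mulrCA -[leLHS]mul1r.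
  by rewrite ler_pM ?ler_peMl ?mulr_ge0//; rewrite -[leLHS]mulr1 ler_pM.
apply: le_trans (lerD h1 h2) _; rewrite le_eqVlt; apply/orP; left; apply/eqP; ring.
Qed.

Lemma mexp_lipschitz k (X Y : 'M[R]_k) c : 1 <= c ->
  k%:R * `|X| <= c -> k%:R * `|Y| <= c ->
  `|mexp X - mexp Y| <= expR (2 * c) * (k%:R * `|X - Y|).
Proof.
move=> c1 Xc Yc; have c0 : 0 <= 2 * c by rewrite mulr_ge0// (le_trans _ c1).
have d0 : 0 <= k%:R * `|X - Y| by rewrite mulr_ge0.
have cd : `|mexp_series X n - mexp_series Y n| @[n --> \oo] --> `|mexp X - mexp Y|.
  by apply: cvg_norm; apply: cvgB; exact: cvg_mexp.
rewrite -(cvg_lim _ cd)//; apply: limr_le; first exact: cvgP cd.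
near=> n.
apply: (@le_trans _ _ (series (exp_coeff (2 * c)) n * (k%:R * `|X - Y|))); last first.
  rewrite ler_wpM2r//; apply: nondecreasing_cvgn_le; last exact: is_cvg_series_exp_coeff.
  by apply: nondecreasing_series => i _ _; exact: exp_coeff_ge0.
rewrite /mexp_series /series/= -sumrB (le_trans (ler_norm_sum _ _ _))// mulr_suml.
apply: ler_sum => j _; rewrite -scalerBr normrZ ger0_norm ?invr_ge0//.
by rewrite /exp_coeff/= [leRHS]mulrAC [leRHS]mulrC ler_wpM2l ?invr_ge0// mx_norm_subX.
Unshelve. all: by end_near. Qed.

(** This block is the integral of exp((1-s)X) H exp(sY) over s in [0, 1]. Keeping [X] and [Y]
    distinct makes it a divided difference as well as, on the diagonal, the derivative. *)
Definition dexp k (X Y H : 'M[R]_k) : 'M[R]_k := ursubmx (mexp (block_mx X H 0 Y)).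

Lemma mexp_ulsubmx m n (X : 'M[R]_m) (H : 'M[R]_(m, n)) (Y : 'M[R]_n) :
  ulsubmx (mexp (block_mx X H 0 Y)) = mexp X.
Proof.
have := @mexp_intertwine _ _ (block_mx X H 0 Y) X (col_mx 1%:M 0).
rewrite mul_block_col !mul_col_mx !mul0mx !mulmx0 !mulmx1 mul1mx !addr0 => /(_ erefl).
rewrite -{1}[mexp (block_mx _ _ _ _)]submxK mul_block_col !mulmx1 !mulmx0 !addr0 mul1mx.
by move=> /eq_col_mx[].
Qed.

(** The block column (-1; 1) intertwines the block matrix with [Y]. *)
Lemma dexp_subr k (X Y : 'M[R]_k) : dexp X Y (X - Y) = mexp X - mexp Y.
Proof.
have := @mexp_intertwine _ _ (block_mx X (X - Y) 0 Y) Y (col_mx (- 1%:M) 1%:M).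
rewrite mul_block_col !mul_col_mx !mul0mx !mulmx1 !mulmxN !mulmx1 !mulNmx !mul1mx.
rewrite add0r addrA addNr sub0r => /(_ erefl).
rewrite -{1}[mexp (block_mx _ _ _ _)]submxK mul_block_col !mulmxN !mulmx1.
move=> /eq_col_mx[+ _]; rewrite mexp_ulsubmx -/(dexp _ _ _) => E.
by rewrite -[LHS](addKr (- mexp X)) E opprK.
Qed.

(** Intertwining with the block diagonal matrix (a, 1) requires no inverse, so [a = 0] is
    included. *)
Lemma dexpZ k (X Y H : 'M[R]_k) a : dexp X Y (a *: H) = a *: dexp X Y H.
Proof.
have := @mexp_intertwine _ _ (block_mx X (a *: H) 0 Y) (block_mx X H 0 Y)
  (block_mx a%:M 0 0 1%:M).
rewrite !mulmx_block !mul0mx !mulmx0 !mulmx1 !mul1mx !addr0 !add0r mul_scalar_mx.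
rewrite mul_mx_scalar mul_scalar_mx => /(_ erefl).
rewrite -[mexp (block_mx X (a *: H) 0 Y)]submxK -[mexp (block_mx X H 0 Y)]submxK !mulmx_block.
move=> /eq_block_mx[_ + _ _]; rewrite -!/(dexp _ _ _).
by rewrite !mulmx0 !mul0mx mulmx1 addr0 add0r mul_scalar_mx.
Qed.

(** One larger matrix [M] carries both directions side by side. The selectors (1; 0), (0; 1) and (1;
    1) extract the directions [H1], [H2] and [H1 + H2] from the same block of [mexp M], and the
    extraction is additive in the selector. *)
Lemma dexpD k (X Y H1 H2 : 'M[R]_k) : dexp X Y (H1 + H2) = dexp X Y H1 + dexp X Y H2.
Proof.
pose M := block_mx X (row_mx H1 H2) 0 (block_mx Y 0 0 Y).
pose u (c : 'M[R]_(k + k, k)) := ursubmx (mexp M) *m c.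
have E (c : 'M[R]_(k + k, k)) H : row_mx H1 H2 *m c = H ->
    block_mx Y 0 0 Y *m c = c *m Y -> u c = dexp X Y H.
  move=> HcE cYE.
  have := @mexp_intertwine _ _ M (block_mx X H 0 Y) (block_mx 1%:M 0 0 c).
  rewrite !mulmx_block !mul0mx !mulmx0 !mulmx1 !mul1mx !addr0 !add0r HcE cYE.
  move=> /(_ erefl).
  rewrite -[mexp M]submxK -[mexp (block_mx X H 0 Y)]submxK !mulmx_block.
  move=> /eq_block_mx[_ + _ _].
  rewrite -/(dexp _ _ _).
  by rewrite !mulmx0 !mul0mx mul1mx addr0 add0r.
rewrite -(E (col_mx 1%:M 1%:M)).
  rewrite -(E (col_mx 1%:M 0)) -?(E (col_mx 0 1%:M)) /u -?mulmxDr ?add_col_mx ?addr0 ?add0r//.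
  all: rewrite ?mul_row_col ?mul_block_col ?mul_col_mx.
  all: by rewrite ?mul0mx ?mulmx0 ?mulmx1 ?mul1mx ?addr0 ?add0r.
Qed.

Lemma mx_norm_block m1 m2 n1 n2 (A : 'M[R]_(m1, n1)) (B : 'M[R]_(m1, n2))
    (C : 'M[R]_(m2, n1)) (D : 'M[R]_(m2, n2)) c :
  `|A| <= c -> `|B| <= c -> `|C| <= c -> `|D| <= c -> `|block_mx A B C D| <= c.
Proof.
move=> Ac Bc Cc Dc; apply: mx_norm_le => [|i j]; first exact: le_trans Ac.
case: (split_ordP i) => i' ->; case: (split_ordP j) => j' ->.
- by rewrite block_mxEul (le_trans (mx_entry_le_norm _ _ _)).
- by rewrite block_mxEur (le_trans (mx_entry_le_norm _ _ _)).
- by rewrite block_mxEdl (le_trans (mx_entry_le_norm _ _ _)).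
- by rewrite block_mxEdr (le_trans (mx_entry_le_norm _ _ _)).
Qed.

End MatrixExponential.

(** * Differentiability and smoothness of the exponential *)

Section MexpSmooth.
Context {R : realType}.

Lemma dexp_is_linear k (X Y : 'M[R]_k) : linear (dexp X Y).
Proof. by move=> a H1 H2; rewrite dexpD dexpZ. Qed.

HB.instance Definition _ k (X Y : 'M[R]_k) :=
  GRing.isLinear.Build R 'M[R]_k 'M[R]_k _ (dexp X Y) (@dexp_is_linear k X Y).

Lemma dexp_lipschitz k (A Y H : 'M[R]_k) c : 1 <= c ->
  (k + k)%:R * (`|A| + 1) <= c -> `|Y| <= `|A| + 1 ->
  `|dexp Y A H - dexp A A H| <= `|H| * (expR (2 * c) * ((k + k)%:R * `|Y - A|)).
Proof.
move=> c1 Ac YA.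
have [->|H0] := eqVneq H 0; first by rewrite 2!raddf0 subrr !normr0 mul0r.
have nH : `|H| != 0 by rewrite normr_eq0.
(* [mexp_lipschitz] is not homogeneous in [H]: the direction is normalised first, and linearity of
   [dexp] restores its length. *)
have [U HE U1] : exists2 U, H = `|H| *: U & `|U| = 1.
  exists (`|H|^-1 *: H); first by rewrite scalerA divff// scale1r.
  by rewrite normrZ ger0_norm ?invr_ge0// mulVf.
rewrite {1 2}HE !dexpZ -scalerBr normrZ normr_id ler_wpM2l//=.
have leA : `|A| <= `|A| + 1 by rewrite lerDl.
have leU : `|U| <= `|A| + 1 by rewrite U1 lerDr.
have le0 m n : `|0 : 'M[R]_(m, n)| <= `|A| + 1 by rewrite normr0 addr_ge0.
have n1 : (k + k)%:R * `|block_mx Y U 0 A| <= c.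
  by apply: le_trans Ac; rewrite ler_wpM2l// mx_norm_block.
have n2 : (k + k)%:R * `|block_mx A U 0 A| <= c.
  by apply: le_trans Ac; rewrite ler_wpM2l// mx_norm_block.
apply: (@le_trans _ _ `|mexp (block_mx Y U 0 A) - mexp (block_mx A U 0 A)|).
  apply: mx_norm_le => // i j; rewrite /dexp !mxE.
  by apply: le_trans (mx_entry_le_norm _ (lshift k i) (rshift k j)); rewrite !mxE.
apply: le_trans (mexp_lipschitz c1 n1 n2) _.
rewrite ler_wpM2l ?expR_ge0// ler_wpM2l// opp_block_mx add_block_mx !subrr.
by rewrite mx_norm_block ?normr0.
Qed.

(** By [dexp_subr] the increment is exactly [dexp Y A (Y - A)]; replacing the first argument by [A]
    costs a quadratic error, by [dexp_lipschitz]. *)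
Lemma differentiable_mexp k (A : 'M[R]_k) :
  differentiable mexp A /\ 'd mexp A = dexp A A :> ('M[R]_k -> 'M[R]_k).
Proof.
apply: differentiable_epsP; first exact: linear_mx_continuous.
move=> e e0; pose c := 1 + (k + k)%:R * (`|A| + 1).
have c1 : 1 <= c by rewrite lerDl mulr_ge0// addr_ge0.
pose C := expR (2 * c) * (k + k)%:R + 1.
have C0 : 0 < C by rewrite ltr_wpDl// mulr_ge0 ?expR_ge0.
near=> Y.
have Y1 : `|Y - A| <= 1 by near: Y; apply: cvgr_distC_le.
have Ye : `|Y - A| <= e / C by near: Y; apply: cvgr_distC_le; rewrite // divr_gt0.
rewrite -dexp_subr; apply: le_trans (@dexp_lipschitz _ _ _ _ c c1 _ _) _.
- by rewrite lerDr.
- by rewrite -[Y](subrK A) addrC (le_trans (ler_normD _ _))// lerD2l.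
rewrite mulrC ler_wpM2r// mulrA (@le_trans _ _ (C * `|Y - A|)) ?ler_wpM2r ?lerDl//.
by rewrite mulrC -ler_pdivlMr.
Unshelve. all: by end_near. Qed.

Lemma derive_mexp k (A U : 'M[R]_k) : 'D_U mexp A = dexp A A U.
Proof. by have [df E] := differentiable_mexp A; rewrite deriveE// E. Qed.

(* The derivative of [mexp] is a block of [mexp] in twice the dimension, so that
   one derivative at every dimension yields all derivatives. *)
Lemma Cinf_mexp k : Cinf setT (@mexp R k).
Proof.
move=> r; elim: r k => [|r IH] k i j.
  move=> A _; apply: (@continuous_comp _ _ _ mexp (fun M : 'M[R]_k => M i j) A).
    by apply: differentiable_continuous; have [] := differentiable_mexp A.
  exact: coord_continuous.
split=> [A _|v].
  apply: (differentiable_comp (g := fun M : 'M[R]_k => M i j)).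
    by have [] := differentiable_mexp A.
  exact: differentiable_coord.
apply: (@Cr_eq _ r _ setT ((fun M => mexp M (lshift k i) (rshift k j)) \o
    (fun A => block_mx A v 0 A))) => [|A _|].
- exact: openT.
- rewrite derive_entry; last by have [] := differentiable_mexp A.
  by rewrite derive_mexp /dexp !mxE.
apply: (@Cr_comp _ _ _ _ _ _ setT); [exact: openT|exact: openT| |exact: IH|by []].
move=> a b; case: (split_ordP a) => a' ->; case: (split_ordP b) => b' ->.
- by apply: Cr_eq (Cr_coord r setT a' b') => [|x _]; [exact: openT|rewrite block_mxEul].
- by apply: Cr_eq (Cr_cst r setT (v a' b')) => [|x _]; [exact: openT|rewrite block_mxEur].
- by apply: Cr_eq (Cr_cst r setT 0) => [|x _]; [exact: openT|rewrite block_mxEdl mxE].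
- by apply: Cr_eq (Cr_coord r setT a' b') => [|x _]; [exact: openT|rewrite block_mxEdr].
Qed.

End MexpSmooth.

(** * Spectral theorem and trace inequalities *)

Section Spectral.
Context {R : realType}.

Definition sqn m n (x : 'M[R]_(m, n)) : R := \sum_i \sum_j x i j ^+ 2.

Lemma sqn_ge0 m n (x : 'M[R]_(m, n)) : 0 <= sqn x.
Proof. by apply: sumr_ge0 => i _; apply: sumr_ge0 => j _; exact: sqr_ge0. Qed.

Lemma sqr_norm_le_sqn m n (x : 'M[R]_(m, n)) : `|x| ^+ 2 <= sqn x.
Proof.
rewrite -[leRHS]sqr_sqrtr ?sqn_ge0// ler_pXn2r ?nnegrE ?sqrtr_ge0//.
apply: mx_norm_le => [|i j]; first exact: sqrtr_ge0.
rewrite -sqrtr_sqr ler_wsqrtr// /sqn (bigD1 i)//= (bigD1 j)//= -addrA lerDl.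
by rewrite addr_ge0 ?sumr_ge0// => *; rewrite ?sumr_ge0// => *; exact: sqr_ge0.
Qed.

Lemma sqn_eq0 m n (x : 'M[R]_(m, n)) : sqn x = 0 -> x = 0.
Proof.
move=> x0; apply/eqP; rewrite -normr_eq0 -sqrf_eq0 eq_le sqr_ge0 andbT.
by rewrite -x0 sqr_norm_le_sqn.
Qed.

Lemma sqn0 m n : sqn (0 : 'M[R]_(m, n)) = 0.
Proof. by apply: big1 => i _; apply: big1 => j _; rewrite mxE expr0n. Qed.

Lemma sqn_gt0 m n (x : 'M[R]_(m, n)) : x != 0 -> 0 < sqn x.
Proof. by move=> x0; rewrite lt_neqAle sqn_ge0 andbT; apply: contraNneq x0 => /esym/sqn_eq0 ->. Qed.

Lemma sqn_row n (v : 'rV[R]_n) : (v *m v^T) 0 0 = sqn v.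
Proof. by rewrite mxE /sqn big_ord1; apply: eq_bigr => j _; rewrite mxE expr2. Qed.

Lemma sqn_col n (v : 'cV[R]_n) : (v^T *m v) 0 0 = sqn v.
Proof. by rewrite mxE; apply: eq_bigr => j _; rewrite big_ord1 mxE expr2. Qed.

Lemma sqnZ m n a (x : 'M[R]_(m, n)) : sqn (a *: x) = a ^+ 2 * sqn x.
Proof.
rewrite /sqn mulr_sumr; apply: eq_bigr => i _; rewrite mulr_sumr.
by apply: eq_bigr => j _; rewrite mxE exprMn.
Qed.

(** First-order optimality without derivatives: for small [t] of the sign of [b] the linear term
    would dominate. *)
Lemma linear_form_eq0 (b C : R) : (forall t : R, 2 * t * b <= t ^+ 2 * C) -> b = 0.
Proof.
move=> H; have c0 : 0 < `|C| + 1 by rewrite ltr_wpDl.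
have := H (b / (`|C| + 1)); rewrite -subr_ge0.
have -> : (b / (`|C| + 1)) ^+ 2 * C - 2 * (b / (`|C| + 1)) * b =
    (b / (`|C| + 1)) ^+ 2 * (C - 2 * (`|C| + 1)).
  by field; rewrite gt_eqF.
have Cle : C - 2 * (`|C| + 1) < 0 by have := ler_norm C; have := normr_ge0 C; lra.
rewrite nmulr_lge0// => H2.
have : (b / (`|C| + 1)) ^+ 2 = 0 by apply/eqP; rewrite eq_le H2 sqr_ge0.
by move/eqP; rewrite sqrf_eq0 mulf_eq0 invr_eq0 (gt_eqF c0) orbF => /eqP.
Qed.

Section Rayleigh.
Variables (m n : nat) (A : 'M[R]_n) (P : 'M[R]_(m, n)) (d : 'rV[R]_m).
Hypotheses (AT : A^T = A) (PA : P *m A = diag_mx d *m P).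
Hypothesis mn : (m < n)%N.

Let q (v : 'rV[R]_n) := (v *m A *m v^T) 0 0.
Let S := [set v : 'rV[R]_n | v *m v^T = 1%:M /\ v *m P^T = 0].

Let cont_q : continuous (fun v : 'rV[R]_n => v *m A *m v^T).
Proof.
move=> v; apply: (@Cinf_continuous _ _ _ _ setT) => //.
have ot : open [set: 'rV[R]_n] by exact: openT.
apply: Cinf_mul => //; last exact: Cinf_linear.
exact: (Cinf_linear (mulmxr A)).
Qed.

Let cont_sq : continuous (fun v : 'rV[R]_n => v *m v^T).
Proof.
move=> v; apply: (@Cinf_continuous _ _ _ _ setT) => //.
have ot : open [set: 'rV[R]_n] by exact: openT.
apply: Cinf_mul => //; last exact: Cinf_linear.
exact: (Cinf_linear idfun).
Qed.

Let closed_mx1 p r (M : 'M[R]_(p, r)) : closed [set M].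
Proof. by apply: accessible_closed_set1; exact/hausdorff_accessible/norm_hausdorff. Qed.

Let compact_S : compact S.
Proof.
apply: bounded_closed_compact.
  exists 1; split; first exact: num_real.
  move=> x x1 v [v1 _]; rewrite /= (le_trans _ (ltW x1))//.
  rewrite -(@expr_le1 _ 2)// (le_trans (sqr_norm_le_sqn _))// -sqn_row v1 mxE.
  by rewrite eqxx.
have -> : S = (fun v => v *m v^T) @^-1` [set 1%:M] `&` (mulmxr P^T) @^-1` [set 0] by [].
apply: closedI.
  by apply: preimage_closed (@closed_mx1 _ _ _) => v _; exact: cont_sq.
by apply: preimage_closed (@closed_mx1 _ _ _) => v _; exact: linear_mx_continuous.
Qed.

Let nonempty_S : S !=set0.
Proof.
have : kermx P^T != 0.
  rewrite -mxrank_eq0 mxrank_ker subn_eq0 -ltnNge.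
  exact: leq_ltn_trans (rank_leq_col _) mn.
move=> /rowV0Pn[v /sub_kermxP vP v0].
exists ((Num.sqrt (sqn v))^-1 *: v); split; last by rewrite -scalemxAl vP scaler0.
apply/matrixP => i j; rewrite !ord1 sqn_row sqnZ exprVn sqr_sqrtr ?sqn_ge0//.
by rewrite mulVf ?mxE// gt_eqF// sqn_gt0.
Qed.

(* The maximum of the Rayleigh quotient on the orthogonal complement of the rows
   of [P] is attained at an eigenvector. *)
Lemma new_eigenvector : exists (v : 'rV[R]_n) (a : R),
  [/\ v *m v^T = 1%:M, v *m P^T = 0 & v *m A = a *: v].
Proof.
have cq : continuous q.
  move=> v; exact: (continuous_comp (@cont_q v) (@coord_continuous _ _ _ 0 0 _)).
have cqS : {within S, continuous q} by exact: continuous_subspaceT.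
have [v /set_mem[v1 vP] vmax] := compact_EVT_max nonempty_S compact_S cqS.
exists v, (q v); split=> //.
(* Compare [v] with the normalised [v + t *: w], which stays in [S]: maximality bounds the term
   linear in [t] by a quadratic one. *)
have ortho (w : 'rV[R]_n) : w *m v^T = 0 -> w *m P^T = 0 -> (v *m A *m w^T) 0 0 = 0.
  move=> wv wP; apply: (@linear_form_eq0 _ (q v * sqn w - q w)) => t.
  have vw : v *m w^T = 0 by rewrite -[v]trmxK -trmx_mul wv trmx0.
  have usq : sqn (v + t *: w) = 1 + t ^+ 2 * sqn w.
    rewrite -!sqn_row linearD linearZ/= mulmxDl !mulmxDr -!scalemxAl -!scalemxAr.
    by rewrite wv vw v1 !scaler0 addr0 add0r scalerA !mxE eqxx -expr2.
  have u0 : 0 < sqn (v + t *: w).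
    by rewrite usq ltr_wpDr// mulr_ge0 ?sqr_ge0 ?sqn_ge0.
  have uS : (Num.sqrt (sqn (v + t *: w)))^-1 *: (v + t *: w) \in S.
    apply/mem_set; split; last by rewrite -scalemxAl mulmxDl -scalemxAl vP wP scaler0 addr0 scaler0.
    apply/matrixP => i j; rewrite !ord1 sqn_row sqnZ exprVn sqr_sqrtr ?sqn_ge0//.
    by rewrite mulVf ?mxE// gt_eqF.
  have qZ a x : q (a *: x) = a ^+ 2 * q x.
    by rewrite /q linearZ/= -!scalemxAl -scalemxAr scalerA mxE expr2.
  have := vmax _ uS.
  rewrite qZ exprVn sqr_sqrtr ?(ltW u0)// ler_pdivrMl//.
  have sym : (w *m A *m v^T) 0 0 = (v *m A *m w^T) 0 0.
    by rewrite -[in LHS]AT -[w]trmxK -trmx_mul -trmx_mul trmxK mulmxA mxE.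
  have eD (X Y : 'M[R]_1) : (X + Y) 0 0 = X 0 0 + Y 0 0 by rewrite mxE.
  have eZ a (X : 'M[R]_1) : (a *: X) 0 0 = a * X 0 0 by rewrite mxE.
  have qD : q (v + t *: w) = q v + 2 * t * (v *m A *m w^T) 0 0 + t ^+ 2 * q w.
    rewrite /q linearD linearZ/= !mulmxDl !mulmxDr -!scalemxAl -!scalemxAr scalerA.
    by rewrite !eD !eZ sym; ring.
  rewrite usq qD; lra.
(* The residual is itself an admissible direction, orthogonal to [v] and to the rows of [P], so
   [ortho] shows that its squared length is zero. *)
pose w := v *m A - q v *: v.
have wv : w *m v^T = 0.
  rewrite mulmxBl -scalemxAl v1; apply/matrixP => i j; rewrite !ord1 /q.
  by rewrite !mxE mulr1 subrr.
have wP : w *m P^T = 0.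
  rewrite mulmxBl -scalemxAl vP scaler0 subr0 -mulmxA -{1}AT -trmx_mul PA trmx_mul.
  by rewrite mulmxA vP mul0mx.
have := ortho w wv wP.
have -> : v *m A = w + q v *: v by rewrite subrK.
rewrite mulmxDl -scalemxAl -[v *m w^T]trmxK trmx_mul trmxK wv trmx0 scaler0 addr0.
by rewrite sqn_row => /sqn_eq0 ->; rewrite add0r.
Qed.

End Rayleigh.

Lemma spectral_theorem n (A : 'M[R]_n) : A^T = A ->
  exists (P : 'M[R]_n) (d : 'rV[R]_n), P *m P^T = 1%:M /\ A = P^T *m diag_mx d *m P.
Proof.
move=> AT.
(* The rows of the rectangular [P] are [m] orthonormal eigenvectors; at [m = n] the relation
   [P A = D P] becomes a diagonalisation. *)
suff H m : (m <= n)%N -> exists (P : 'M[R]_(m, n)) (d : 'rV[R]_m),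
    P *m P^T = 1%:M /\ P *m A = diag_mx d *m P.
  have [P [d [PP PA]]] := H n (leqnn n); exists P, d; split=> //.
  by rewrite -mulmxA -PA mulmxA (mulmx1C PP) mul1mx.
elim: m => [_|m IH mn].
  by exists 0, 0; split; apply/matrixP => -[].
have [P [d [PP PA]]] := IH (ltnW mn).
have [v [a [v1 vP vA]]] := new_eigenvector AT PA mn.
(* Restated with [1 + m] rows, convertible to [m.+1], so that block matrices apply. *)
suff : exists (P : 'M[R]_(1 + m, n)) (d : 'rV[R]_(1 + m)),
  P *m P^T = 1%:M /\ P *m A = diag_mx d *m P by [].
exists (col_mx v P), (row_mx a%:M d); split.
  rewrite tr_col_mx mul_col_row v1 vP PP -[P *m v^T]trmxK trmx_mul trmxK vP trmx0.
  by rewrite -scalar_mx_block.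
rewrite diag_mx_row mul_col_mx mul_block_col !mul0mx addr0 add0r vA PA; congr (col_mx _ _).
apply/matrixP => i j; rewrite !ord1 !mxE big_ord1 !mxE.
by rewrite eqxx mulr1n.
Qed.

End Spectral.

(** * Functional calculus in an eigenbasis and lower bounds of quadratic forms *)

Section SpectralCalculus.
Context {R : realType} {k : nat}.
Implicit Types (A B X Y U P Q : 'M[R]_k) (d e : 'rV[R]_k).

Definition spec P d : 'M[R]_k := P^T *m diag_mx d *m P.

Lemma spec_sym P d : (spec P d)^T = spec P d.
Proof. by rewrite /spec !trmx_mul trmxK tr_diag_mx mulmxA. Qed.

Lemma mul_spec P d e : P *m P^T = 1%:M ->
  spec P d *m spec P e = spec P (\row_i (d 0 i * e 0 i)).
Proof.
move=> PP; rewrite /spec -!mulmxA (mulmxA P) PP mul1mx; congr (_ *m _).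
rewrite mulmxA; congr (_ *m _); rewrite mul_diag_mx; apply/matrixP => i j.
by rewrite !mxE mulrnAr.
Qed.

Lemma spec_cst P a : P *m P^T = 1%:M -> spec P (const_mx a) = a%:M.
Proof.
move=> PP; rewrite /spec diag_const_mx mul_mx_scalar -scalemxAl (mulmx1C PP).
by rewrite scalemx1.
Qed.

Lemma quad_spec P d (x : 'cV[R]_k) :
  (x^T *m spec P d *m x) 0 0 = \sum_i d 0 i * (P *m x) i 0 ^+ 2.
Proof.
have -> : x^T *m spec P d *m x = (P *m x)^T *m (diag_mx d *m (P *m x)).
  by rewrite /spec trmx_mul !mulmxA.
rewrite mxE; apply: eq_bigr => i _; rewrite mul_diag_mx !mxE expr2; ring.
Qed.

Lemma sqn_orth P (x : 'cV[R]_k) : P *m P^T = 1%:M -> sqn (P *m x) = sqn x.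
Proof.
by move=> PP; rewrite -!sqn_col trmx_mul -mulmxA (mulmxA P^T) (mulmx1C PP) mul1mx.
Qed.

Lemma sqn_colE (x : 'cV[R]_k) : sqn x = \sum_i x i 0 ^+ 2.
Proof. by apply: eq_bigr => i _; rewrite big_ord1. Qed.

Lemma quad_spec_row P d i : P *m P^T = 1%:M ->
  ((P^T *m delta_mx i (0 : 'I_1))^T *m spec P d *m (P^T *m delta_mx i (0 : 'I_1))) 0 0 = d 0 i.
Proof.
move=> PP; rewrite quad_spec mulmxA PP mul1mx (bigD1 i)//= big1 ?addr0.
  by rewrite mxE !eqxx expr1n mulr1.
by move=> j ji; rewrite mxE (negbTE ji) expr0n mulr0.
Qed.

Lemma sqn_spec_row P i : P *m P^T = 1%:M -> sqn (P^T *m delta_mx i (0 : 'I_1)) = 1.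
Proof.
move=> PP; rewrite sqn_orth ?trmxK ?(mulmx1C PP)// sqn_colE (bigD1 i)//= big1 ?addr0.
  by rewrite mxE !eqxx expr1n.
by move=> j ji; rewrite mxE (negbTE ji) expr0n.
Qed.

Lemma frob_spec P d Q e : frob (spec P d) (spec Q e) =
  \sum_i \sum_j d 0 i * e 0 j * ((P *m Q^T) i j) ^+ 2.
Proof.
rewrite /frob; have -> : spec P d *m spec Q e =
    P^T *m (diag_mx d *m (P *m Q^T) *m diag_mx e *m Q) by rewrite /spec !mulmxA.
rewrite mxtrace_mulC -(mulmxA _ Q) -[Q *m P^T]trmxK trmx_mul trmxK.
rewrite /mxtrace; apply: eq_bigr => i _; rewrite mxE; apply: eq_bigr => j _.
by rewrite mul_mx_diag mul_diag_mx !mxE expr2; ring.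
Qed.

Lemma frob_symmetric A B : frob A B = frob B A.
Proof. by rewrite /frob mxtrace_mulC. Qed.

Lemma frobDl A B U : frob (A + B) U = frob A U + frob B U.
Proof. by rewrite /frob mulmxDl linearD. Qed.
Lemma frobBl A B U : frob (A - B) U = frob A U - frob B U.
Proof. by rewrite /frob mulmxBl linearB. Qed.
Lemma frobZl a B U : frob (a *: B) U = a * frob B U.
Proof. by rewrite /frob -scalemxAl linearZ. Qed.
Lemma frobDr A B U : frob U (A + B) = frob U A + frob U B.
Proof. by rewrite /frob mulmxDr linearD. Qed.
Lemma frobBr A B U : frob U (A - B) = frob U A - frob U B.
Proof. by rewrite /frob mulmxBr linearB. Qed.
Lemma frobZr a B U : frob U (a *: B) = a * frob U B.
Proof. by rewrite /frob -scalemxAr linearZ. Qed.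

Lemma frob_sqn U : U^T = U -> frob U U = sqn U.
Proof.
move=> UT; rewrite /frob /mxtrace; apply: eq_bigr => i _; rewrite mxE.
by apply: eq_bigr => j _; rewrite -{2}UT mxE expr2.
Qed.

Lemma frob_le_norm A B : `|frob A B| <= k%:R * (k%:R * (`|A| * `|B|)).
Proof.
rewrite /frob /mxtrace (le_trans (ler_norm_sum _ _ _))//.
rewrite (@le_trans _ _ (\sum_(i < k) k%:R * (`|A| * `|B|)))//.
  by apply: ler_sum => i _; apply: le_trans (mx_entry_le_norm _ _ _) (mx_norm_mul _ _).
by rewrite sumr_const card_ord !mulr_natl.
Qed.

(** A lower bound of the spectrum stated through the quadratic form: it makes sense for nonsymmetric
    [X] and is stable under perturbation. *)
Definition quad_ge c X := forall x : 'cV[R]_k, c * sqn x <= (x^T *m X *m x) 0 0.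

(** Each term is bounded by |x_i x_j| <= (x_i^2 + x_j^2) / 2; summing over [i] and [j] produces the
    factor [k]. *)
Lemma quad_ge_perturb c X Y : quad_ge c X -> quad_ge (c - k%:R * `|X - Y|) Y.
Proof.
move=> cX x; rewrite mulrBl lerBlDr (le_trans (cX x))// -lerBlDl.
have -> : (x^T *m X *m x) 0 0 - (x^T *m Y *m x) 0 0 = (x^T *m (X - Y) *m x) 0 0.
  by rewrite mulmxBr mulmxBl [in RHS]mxE [X in _ = _ + X]mxE.
apply: le_trans (ler_norm _) _.
have -> : (x^T *m (X - Y) *m x) 0 0 = \sum_j \sum_i x i 0 * (X - Y) i j * x j 0.
  rewrite mxE; apply: eq_bigr => j _; rewrite mxE mulr_suml.
  by apply: eq_bigr => i _; rewrite mxE.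
apply: (@le_trans _ _ (\sum_j \sum_i (`|X - Y| / 2 * (x i 0 ^+ 2 + x j 0 ^+ 2)))).
  rewrite (le_trans (ler_norm_sum _ _ _))//; apply: ler_sum => j _.
  rewrite (le_trans (ler_norm_sum _ _ _))//; apply: ler_sum => i _.
  rewrite !normrM -(real_normK (num_real (x i 0))) -(real_normK (num_real (x j 0))).
  have h1 := mx_entry_le_norm (X - Y) i j.
  have h2 : 0 <= (`|x i 0| - `|x j 0|) ^+ 2 by exact: sqr_ge0.
  have h3 : `|x i 0| * `|x j 0| <= 2^-1 * (`|x i 0| ^+ 2 + `|x j 0| ^+ 2).
    by move: h2; rewrite sqrrB; lra.
  rewrite mulrAC [leLHS]mulrC -mulrA ler_pM//; exact: mulr_ge0.
rewrite le_eqVlt; apply/orP; left; apply/eqP.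
have E : \sum_(i < k) x i 0 ^+ 2 = sqn x by apply: eq_bigr => i _; rewrite big_ord1.
under eq_bigr do rewrite -mulr_sumr big_split/= E sumr_const card_ord.
rewrite -mulr_sumr big_split/= sumr_const card_ord sumrMnl E -[sqn x *+ k]mulr_natl; by field.
Qed.

Lemma SymPos_quad_ge X : SymPos R k X -> exists2 c, 0 < c & quad_ge c X.
Proof.
move=> [XT Xpos]; have [P [d [PP XE]]] := spectral_theorem XT.
have dpos i : 0 < d 0 i.
  have := Xpos (P^T *m delta_mx i 0); rewrite XE quad_spec_row//; apply.
  apply/eqP => E; have := sqn_spec_row i PP; rewrite E sqn0 => /esym/eqP.
  by rewrite oner_eq0.
(* The initial value [1] keeps the minimum positive when [k = 0]. *)
exists (\big[Num.min/1]_i d 0 i); first exact: lt_bigmin.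
move=> x; rewrite XE quad_spec -(sqn_orth x PP) /sqn mulr_sumr.
by apply: ler_sum => i _; rewrite big_ord1 ler_wpM2r ?sqr_ge0// bigmin_le_cond.
Qed.

Lemma quad_ge_spec c P d i : P *m P^T = 1%:M -> quad_ge c (spec P d) -> c <= d 0 i.
Proof.
move=> PP /(_ (P^T *m delta_mx i 0)).
by rewrite quad_spec_row// sqn_spec_row// mulr1.
Qed.

Lemma quad_ge_SymPos c X : 0 < c -> X^T = X -> quad_ge c X -> SymPos R k X.
Proof.
move=> c0 XT cX; split=> // x x0; apply: lt_le_trans (cX x).
by rewrite mulr_gt0// sqn_gt0.
Qed.

(** The lower bound is uniform over a neighbourhood, which is what the Lipschitz estimates need.
    Positivity is conditional because [Y] ranges over all matrices near [X]. *)
Lemma SymPos_near X : SymPos R k X -> exists2 c, 0 < c &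
  \forall Y \near X, quad_ge c Y /\ (Y^T = Y -> SymPos R k Y).
Proof.
move=> /SymPos_quad_ge[c c0 cX]; exists (c / 2); first by rewrite divr_gt0.
near=> Y.
have cY : quad_ge (c / 2) Y.
  move=> x; apply: le_trans (quad_ge_perturb Y cX x).
  rewrite ler_wpM2r ?sqn_ge0//.
  have : `|X - Y| <= c / (2 * (k%:R + 1)).
    near: Y; apply: cvgr_dist_le => //; rewrite divr_gt0// mulr_gt0// ltr_wpDl//.
  rewrite ler_pdivlMr ?mulr_gt0 ?ltr_wpDl//.
  have : 0 <= `|X - Y| by [].
  lra.
by split=> // YT; apply: quad_ge_SymPos cY => //; rewrite divr_gt0.
Unshelve. all: by end_near. Qed.

Lemma mexp_scalar n (a : R) : mexp (a%:M : 'M[R]_n) = (expR a)%:M.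
Proof.
have Xj (j : nat) : (a%:M : 'M[R]_n) ^+ j = (a ^+ j)%:M.
  elim: j => [|j IH]; first by rewrite !expr0.
  by rewrite exprS IH -[_ * _]/(_ *m _) -scalar_mxM exprS.
have c1 := @cvg_mexp R n a%:M.
apply: norm_cvg_unique c1 _; rewrite -[(expR a)%:M]scalemx1.
rewrite (_ : mexp_series _ = fun N => series (exp_coeff a) N *: (1%:M : 'M[R]_n)).
  by apply: cvgZr_tmp; exact: is_cvg_series_exp_coeff.
apply/funext => N; rewrite /series/= scaler_suml; apply: eq_bigr => j _.
by rewrite Xj -scalemx1 scalerA /exp_coeff/= mulrC.
Qed.

Lemma mexp_diag d : mexp (diag_mx d) = diag_mx (map_mx expR d).
Proof.
apply/matrixP => i j.
(* Each basis vector is an eigenvector: intertwining with the 1 by 1 matrix of its eigenvalue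
   computes one column of the exponential. *)
have E : diag_mx d *m delta_mx j (0 : 'I_1) = delta_mx j 0 *m (d 0 j)%:M.
  rewrite mul_mx_scalar mul_diag_mx; apply/matrixP => a b; rewrite !mxE.
  by case: (eqVneq a j) => [->|]; rewrite ?mulr0.
have /matrixP/(_ i 0) := mexp_intertwine E.
rewrite mexp_scalar mul_mx_scalar -colE mxE => ->.
by rewrite !mxE eqxx andbT mulrnAr mulr1; case: (eqVneq i j) => [->|]; rewrite ?mulr1n ?mulr0n.
Qed.

Lemma mexp_spec P d : P *m P^T = 1%:M -> mexp (spec P d) = spec P (map_mx expR d).
Proof.
move=> PP; have E : spec P d *m P^T = P^T *m diag_mx d.
  by rewrite /spec -!mulmxA PP mulmx1.
have := mexp_intertwine E; rewrite mexp_diag => /(congr1 (mulmxr P)) /=.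
by rewrite -mulmxA (mulmx1C PP) mulmx1.
Qed.

End SpectralCalculus.

Lemma cvg_line (R : realType) (V : normedModType R) (x v : V) :
  h *: v + x @[h --> (0 : R)] --> x.
Proof.
have : h *: v + x @[h --> (0 : R)] --> 0 *: v + x.
  by apply: cvgD; [apply: cvgZr_tmp; exact: cvg_id|exact: cvg_cst].
by rewrite scale0r add0r.
Qed.

(** * The exponential as a bijection from symmetric to positive definite matrices *)

Section MexpSym.
Context {R : realType} {k : nat}.
Implicit Types (A B X Y U : 'M[R]_k).

Lemma mexp_SymPos A : Sym R k A -> SymPos R k (mexp A).
Proof.
move=> /spectral_theorem[P [d [PP ->]]]; rewrite -/(spec P d) mexp_spec//.
split=> [|x x0]; first exact: spec_sym.
have : 0 < sqn (P *m x) by rewrite sqn_orth// sqn_gt0.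
have E : sqn (P *m x) = \sum_i (P *m x) i 0 ^+ 2 by apply: eq_bigr => i _; rewrite big_ord1.
rewrite quad_spec E !lt_def => /andP[n0 _]; apply/andP; split; last first.
  by apply: sumr_ge0 => i _; rewrite mxE mulr_ge0 ?expR_ge0 ?sqr_ge0.
apply: contraNneq n0 => /eqP; rewrite psumr_eq0; last first.
  by move=> i _; rewrite mxE mulr_ge0 ?expR_ge0 ?sqr_ge0.
move=> /allP H; apply/eqP/big1 => i _; apply/eqP.
have := H i (mem_index_enum i); rewrite mxE mulf_eq0.
by rewrite gt_eqF ?expR_gt0.
Qed.

Lemma mexp_surj X : SymPos R k X -> exists2 A, Sym R k A & mexp A = X.
Proof.
move=> Xpos; have [c c0 cX] := SymPos_quad_ge Xpos.
have [P [d [PP XE]]] := spectral_theorem Xpos.1.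
exists (spec P (map_mx (@ln R) d)); first exact: spec_sym.
rewrite mexp_spec// [in RHS]XE; congr (_ *m diag_mx _ *m _).
apply/rowP => i; rewrite !mxE lnK// posrE; apply: lt_le_trans c0 _.
by rewrite XE in cX; exact: quad_ge_spec cX.
Qed.

(** For [b <= a], exp a - exp b = exp b (exp (a - b) - 1) is at least exp b (a - b), hence at least
    c (a - b). *)
Lemma exp_mono (a b c : R) : c <= expR a -> c <= expR b ->
  c * (a - b) ^+ 2 <= (expR a - expR b) * (a - b).
Proof.
wlog ab : a b / b <= a => [H ca cb|ca cb].
  have [ba|/ltW ab] := leP b a; first exact: H.
  by have := H b a ab cb ca; rewrite !expr2; lra.
rewrite expr2 mulrA ler_wpM2r ?subr_ge0//.
have -> : expR a = expR b * expR (a - b) by rewrite -expRD addrC subrK.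
have := expR_ge1Dx (a - b); have := expR_ge0 b.
have : 0 <= a - b by rewrite subr_ge0.
move: (expR (a - b)) => E ab0 b0 H.
rewrite (@le_trans _ _ (expR b * (a - b)))// ?ler_wpM2r//.
have : expR b * (1 + (a - b)) <= expR b * E by rewrite ler_wpM2l.
by lra.
Qed.

Section TwoSpectra.
Variables P Q : 'M[R]_k.
Hypotheses (PP : P *m P^T = 1%:M) (QQ : Q *m Q^T = 1%:M).

(** Writing the identity in the other eigenbasis spreads a trace over pairs of eigenvectors, with
    the same weights as in [frob_spec]; all terms of [klein] and [mexp_monotone] can then be
    compared pair by pair. *)
Lemma trace_specl d : \tr (spec P d) = \sum_i \sum_j d 0 i * ((P *m Q^T) i j) ^+ 2.
Proof.
rewrite -[spec P d]mulmx1 -(spec_cst 1 QQ) -/(frob _ _) frob_spec.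
by apply: eq_bigr => i _; apply: eq_bigr => j _; rewrite mxE mulr1.
Qed.

Lemma trace_specr d : \tr (spec Q d) = \sum_i \sum_j d 0 j * ((P *m Q^T) i j) ^+ 2.
Proof.
rewrite -[spec Q d]mul1mx -(spec_cst 1 PP) -/(frob _ _) frob_spec.
by apply: eq_bigr => i _; apply: eq_bigr => j _; rewrite mxE mul1r.
Qed.

Lemma frob_specl d e : frob (spec P d) (spec P e) =
  \sum_i \sum_j d 0 i * e 0 i * ((P *m Q^T) i j) ^+ 2.
Proof.
rewrite /frob mul_spec// trace_specl.
by apply: eq_bigr => i _; apply: eq_bigr => j _; rewrite mxE.
Qed.

Lemma frob_specr d e : frob (spec Q d) (spec Q e) =
  \sum_i \sum_j d 0 j * e 0 j * ((P *m Q^T) i j) ^+ 2.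
Proof.
rewrite /frob mul_spec// trace_specr.
by apply: eq_bigr => i _; apply: eq_bigr => j _; rewrite mxE.
Qed.

End TwoSpectra.

(* Klein's inequality: both sides expand over the squared scalar products of the
   eigenvectors of [A] and [B], where it is the tangent inequality for [expR]. *)
Lemma klein A B : Sym R k A -> Sym R k B ->
  \tr (mexp A) + frob (mexp A) (B - A) <= \tr (mexp B).
Proof.
move=> /spectral_theorem[P [a [PP AE]]] /spectral_theorem[Q [b [QQ BE]]].
rewrite -[_ *m P]/(spec P a) in AE; rewrite -[_ *m Q]/(spec Q b) in BE.
rewrite frobBr AE BE !mexp_spec// (trace_specl P QQ) (trace_specr Q PP).
rewrite (frob_specl PP QQ) frob_spec -sumrB -big_split/=; apply: ler_sum => i _.
rewrite -sumrB -big_split/=; apply: ler_sum => j _; rewrite !mxE.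
rewrite -mulrBl -mulrDl ler_wpM2r ?sqr_ge0//.
have -> : expR (b 0 j) = expR (a 0 i) * expR (b 0 j - a 0 i) by rewrite -expRD addrC subrK.
rewrite -mulrBr -[X in X + _]mulr1 -mulrDr ler_wpM2l ?expR_ge0//.
exact: expR_ge1Dx.
Qed.

Lemma mexp_monotone A B c : Sym R k A -> Sym R k B ->
  quad_ge c (mexp A) -> quad_ge c (mexp B) ->
  c * sqn (A - B) <= frob (mexp A - mexp B) (A - B).
Proof.
move=> As Bs; rewrite -frob_sqn ?linearB/= ?As ?Bs//.
have eig P a : P *m P^T = 1%:M -> quad_ge c (mexp (spec P a)) -> forall i, c <= expR (a 0 i).
  by move=> PP; rewrite mexp_spec// => cA i; have := quad_ge_spec i PP cA; rewrite mxE.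
move: As Bs => /spectral_theorem[P [a [PP AE]]] /spectral_theorem[Q [b [QQ BE]]].
rewrite -[_ *m P]/(spec P a) in AE; rewrite -[_ *m Q]/(spec Q b) in BE.
rewrite AE BE => /(eig _ P a PP) ca /(eig _ Q b QQ) cb.
rewrite !frobBr !frobBl !mexp_spec//.
rewrite [frob (spec Q b) (spec P a)]frob_symmetric.
rewrite [frob (spec Q (map_mx _ _)) (spec P a)]frob_symmetric.
rewrite !(frob_specl PP QQ) !(frob_specr PP QQ) !frob_spec -!sumrB mulr_sumr.
apply: ler_sum => i _; rewrite -!sumrB mulr_sumr; apply: ler_sum => j _.
have := @exp_mono (a 0 i) (b 0 j) c (ca i) (cb j).
move=> /(ler_wpM2r (sqr_ge0 ((P *m Q^T) i j))).
move: (((P *m Q^T) i j) ^+ 2) => w; rewrite !mxE !expr2.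
by lra.
Qed.

Lemma SymPos_subset : SymPos R k `<=` Sym R k.
Proof. by move=> X []. Qed.

(** Only orthogonality of the two differences is assumed. In [calD_unique] the exponentials share
    their diagonal while the arguments differ by a diagonal matrix, which gives exactly that. *)
Lemma mexp_inj A B : Sym R k A -> Sym R k B ->
  frob (mexp A - mexp B) (A - B) = 0 -> A = B.
Proof.
move=> As Bs; have [c c0 cA] := SymPos_quad_ge (mexp_SymPos As).
have [c' c'0 cB] := SymPos_quad_ge (mexp_SymPos Bs) => E.
pose m := Num.min c c'.
have m0 : 0 < m by rewrite lt_min c0.
have le_quad a X : quad_ge a X -> m <= a -> quad_ge m X.
  by move=> aX ma x; apply: le_trans (aX x); rewrite ler_wpM2r ?sqn_ge0.
have := mexp_monotone As Bs (le_quad _ _ cA _) (le_quad _ _ cB _).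
rewrite !ge_min !lexx orbT E => /(_ isT isT); rewrite pmulr_rle0// => AB.
by apply/eqP; rewrite -subr_eq0; apply/eqP/sqn_eq0/eqP; rewrite eq_le AB sqn_ge0.
Qed.

(** The limit of [mexp_monotone] along the line through [A] in direction [U], with a constant
    uniform near [A]. This positivity makes the linearised equations for [mlog] and [unlog]
    injective. *)
Lemma dexp_gt0 A U : Sym R k A -> Sym R k U -> U != 0 -> 0 < frob (dexp A A U) U.
Proof.
move=> As Us U0; have [c c0 cnear] := SymPos_near (mexp_SymPos As).
have [dA _] := differentiable_mexp A.
have line : \forall h \near 0^', (h : R) != 0 /\ quad_ge c (mexp (h *: U + A)).
  apply: filterI; first by near=> h; near: h; exact: nbhs_dnbhs_neq.
  apply: cvg_within; have H : mexp (h *: U + A) @[h --> (0 : R)] --> mexp A.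
    apply: continuous_cvg; first exact: differentiable_continuous.
    exact: cvg_line.
  by apply: H; apply: filterS cnear => Y [].
have lim1 : frob (h^-1 *: (mexp (h *: U + A) - mexp A)) U @[h --> 0^'] --> frob (dexp A A U) U.
  have der : h^-1 *: (mexp (h *: U + A) - mexp A) @[h --> 0^'] --> dexp A A U.
    by rewrite -derive_mexp; apply: (diff_derivable (v := U) dA).
  have lin : linear (fun M : 'M[R]_k => frob M U).
    by move=> a M N; rewrite frobDl frobZl.
  pose L : {linear 'M[R]_k -> R} := HB.pack (fun M : 'M[R]_k => frob M U)
    (GRing.isLinear.Build _ _ _ _ (fun M : 'M[R]_k => frob M U) lin).
  by apply: (@continuous_cvg _ _ _ _ _ _ L); [exact: linear_mx_continuous|exact: der].
apply: (@lt_le_trans _ _ (c * sqn U)); first by rewrite mulr_gt0// sqn_gt0.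
rewrite -(cvg_lim _ lim1)//; apply: limr_ge; first exact: cvgP lim1.
apply: filterS line => h [h0 ch].
have hs : Sym R k (h *: U + A) by rewrite /Sym/= linearD linearZ/= Us As.
have := mexp_monotone hs As ch (nbhs_singleton cnear).1.
rewrite addrK sqnZ frobZr frobZl => H.
have h20 : 0 < h ^+ 2 by rewrite exprn_even_gt0.
rewrite -(ler_pM2l h20) mulrCA (le_trans H)// le_eqVlt; apply/orP; left; apply/eqP.
by field.
Unshelve. all: by end_near. Qed.

Lemma inv_onK (V W : normedModType R) (A : set V) (B : set W) (f : V -> W) :
  set_bij A B f -> forall y, B y -> A (inv_on A f y) /\ f (inv_on A f y) = y.
Proof.
move=> fbij y By; have [fAB finj fsurj] := fbij; split.
  by have [+ _ _] := bijpinv_bij (fun=> 0) fbij; apply.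
exact: (surjpK (fun=> 0) fsurj (mem_set By)).
Qed.

Lemma inv_on_eq (V W : normedModType R) (A : set V) (B : set W) (f : V -> W) x :
  set_bij A B f -> A x -> inv_on A f (f x) = x.
Proof. by move=> [_ finj _] Ax; exact: (pinvKV (fun=> 0) finj (mem_set Ax)). Qed.

Lemma mexp_bij : set_bij (Sym R k) (SymPos R k) mexp.
Proof.
split=> [X|A B /set_mem As /set_mem Bs AB|X /mexp_surj[A As <-]].
- exact: mexp_SymPos.
- by apply: mexp_inj => //; rewrite AB subrr /frob mul0mx linear0.
- by exists A.
Qed.

Lemma Sym_mlog X : SymPos R k X -> Sym R k (mlog X).
Proof. by move=> Xpos; have [] := inv_onK mexp_bij Xpos. Qed.

Lemma mlogK X : SymPos R k X -> mexp (mlog X) = X.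
Proof. by move=> Xpos; have [] := inv_onK mexp_bij Xpos. Qed.

Lemma mexpK A : Sym R k A -> mlog (mexp A) = A.
Proof. exact: inv_on_eq mexp_bij. Qed.

(** Strong monotonicity bounds the square of the distance between logarithms by its product with |X
    - Y|; one factor cancels. *)
Lemma mlog_lipschitz X Y c : 0 < c -> SymPos R k X -> SymPos R k Y ->
  quad_ge c X -> quad_ge c Y -> `|mlog X - mlog Y| <= k%:R * k%:R / c * `|X - Y|.
Proof.
move=> c0 Xpos Ypos cX cY.
have := @mexp_monotone (mlog X) (mlog Y) c (Sym_mlog Xpos) (Sym_mlog Ypos).
rewrite !mlogK// => /(_ cX cY) H.
have [->|N0] := eqVneq (mlog X - mlog Y) 0.
  by rewrite normr0 !mulr_ge0// invr_ge0 ltW.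
have N : 0 < `|mlog X - mlog Y| by rewrite normr_gt0.
have H2 : c * `|mlog X - mlog Y| ^+ 2 <= k%:R * (k%:R * (`|X - Y| * `|mlog X - mlog Y|)).
  apply: le_trans (frob_le_norm _ _); apply: le_trans (ler_norm _); apply: le_trans H.
  by rewrite ler_pM2l// sqr_norm_le_sqn.
rewrite -(ler_pM2r N) -(ler_pM2l c0) -expr2 (le_trans H2)// le_eqVlt.
by apply/orP; left; apply/eqP; field; rewrite gt_eqF.
Qed.

End MexpSym.

(** * The matrix logarithm *)

Section LinearDerivatives.
Context {R : realType}.

Lemma derive_comp_linear (V V' W : normedModType R) (L : {linear V -> V'}) (F : V' -> W) x u :
  'D_u (F \o L) x = 'D_(L u) F (L x).
Proof.
have E : (fun h => h^-1 *: ((F \o L) (h *: u + x) - (F \o L) x)) =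
    (fun h => h^-1 *: (F (h *: L u + L x) - F (L x))).
  by apply/funext => h /=; rewrite linearP.
by rewrite /derive E.
Qed.

Lemma derive_linear (V W : normedModType R) (L : {linear V -> W}) x u :
  'D_u L x = L u.
Proof.
rewrite -[LHS]/('D_u (idfun \o L) x) derive_comp_linear.
by rewrite (_ : (idfun : W -> W) = id)// derive_id.
Qed.

Lemma derive_linear_comp (V : normedModType R) m n (W : normedModType R)
    (L : {linear 'M[R]_(m, n) -> W}) (F : V -> 'M[R]_(m, n)) x u :
  differentiable F x -> 'D_u (L \o F) x = L ('D_u F x).
Proof.
move=> dF; have dL y : differentiable L y by exact/linear_differentiable/linear_mx_continuous.
rewrite !deriveE//; last exact: differentiable_comp.
by rewrite diff_comp//= diff_lin//; exact: linear_mx_continuous.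
Qed.

Lemma derive_closed (V W : normedModType R) (f : V -> W) x v (C : set W) :
  closed C -> derivable f x v ->
  (\forall h \near (0 : R)^', C (h^-1 *: (f (h *: v + x) - f x))) -> C ('D_v f x).
Proof. by move=> clC df nC; apply: (closed_cvg C clC nC); exact: df. Qed.

Lemma continuous_dist_le (V W : normedModType R) (f : V -> W) x :
  {for x, continuous f} <->
  forall e, 0 < e -> \forall y \near x, `|f x - f y| <= e.
Proof. by split=> [/cvgrPdist_le|H]; [|apply/cvgrPdist_le]. Qed.

End LinearDerivatives.

(** * The logarithm extended to an open set by symmetrisation *)

Section SymmetricPart.
Context {R : realType} {k : nat}.
Implicit Types (A B X Y U S K : 'M[R]_k).

Definition symm A : 'M[R]_k := 2^-1 *: (A + A^T).

Lemma symm_is_linear : linear symm.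
Proof.
move=> a A B; rewrite /symm linearP/= scalerA mulrC -scalerA -scalerDr scalerDr.
by rewrite !scalerDr; rewrite addrACA.
Qed.

HB.instance Definition _ := GRing.isLinear.Build R 'M[R]_k 'M[R]_k _ symm symm_is_linear.

Lemma symm_Sym A : Sym R k (symm A).
Proof. by rewrite /Sym/= /symm linearZ/= linearD/= trmxK addrC. Qed.

Lemma symm_id A : Sym R k A -> symm A = A.
Proof.
move=> As; rewrite /symm As; have -> : A + A = 2 *: A by rewrite scaler_nat mulr2n.
by rewrite scalerA mulVf ?scale1r// pnatr_eq0.
Qed.

Lemma tr_sub_symm A : (A - symm A)^T = - (A - symm A).
Proof.
rewrite linearB/= symm_Sym opprB; apply/eqP; rewrite subr_eq addrAC eq_sym subr_eq.
have -> : symm A + symm A = 2 *: symm A by rewrite scaler_nat mulr2n.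
by rewrite /symm scalerA divff ?pnatr_eq0// scale1r addrC.
Qed.

Lemma sym_skew_eq0 S K : Sym R k S -> K^T = - K -> S + K = 0 -> S = 0 /\ K = 0.
Proof.
move=> Ss KT SK0; have KE : K = - S by apply/eqP; rewrite -addr_eq0 addrC SK0.
have : S = 0.
  move: KT; rewrite KE linearN/= Ss opprK => /eqP; rewrite eq_sym -addr_eq0 -mulr2n.
  by rewrite -scaler_nat scaler_eq0 pnatr_eq0 => /eqP.
by move=> S0; rewrite KE S0 oppr0.
Qed.

Lemma frob_skew K S : Sym R k S -> K^T = - K -> frob K S = 0.
Proof.
move=> Ss KT; have : frob K S = - frob K S.
  rewrite {1}/frob -mxtrace_tr trmx_mul Ss KT mulmxN linearN/=.
  by rewrite -/(frob _ _) frob_symmetric.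
move: (frob K S) => x E; lra.
Qed.

Definition symm_SymPos := [set X | SymPos R k (symm X)].

Lemma open_symm_SymPos : open symm_SymPos.
Proof.
rewrite openE => X Xpos; have [c c0 cX] := SymPos_near Xpos.
have : \forall Y \near X, quad_ge c (symm Y) /\ (Sym R k (symm Y) -> SymPos R k (symm Y)).
  exact: (@linear_mx_continuous _ _ _ _ symm X _ cX).
by apply: filterS => Y [_]; apply; exact: symm_Sym.
Qed.

Lemma SymPos_symm X : SymPos R k X -> symm_SymPos X.
Proof. by move=> [XT Xpos]; rewrite /symm_SymPos/= symm_id//. Qed.

Lemma continuous_mlog_symm X : symm_SymPos X -> {for X, continuous (mlog \o symm)}.
Proof.
move=> Xpos; have [c c0 cX] := SymPos_near Xpos.
have symmc : {for X, continuous symm} by exact: linear_mx_continuous.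
apply/continuous_dist_le => e e0; have [cX0 _] := nbhs_singleton cX.
have c2 : \forall Y \near X, quad_ge c (symm Y) /\ (Sym R k (symm Y) -> SymPos R k (symm Y)).
  exact: symmc _ cX.
pose C := k%:R * k%:R / c + 1.
have C0 : 0 < C by rewrite ltr_wpDl// !mulr_ge0// invr_ge0 ltW.
have : \forall Y \near X, `|symm X - symm Y| <= e / C.
  by move/continuous_dist_le : symmc; apply; rewrite divr_gt0.
apply: filterS2 c2 => Y [cY Ypos] XY.
rewrite (le_trans (mlog_lipschitz c0 Xpos (Ypos (symm_Sym Y)) cX0 cY))//.
apply: (@le_trans _ _ (C * `|symm X - symm Y|)); first by rewrite ler_wpM2r// lerDl.
by rewrite mulrC -ler_pdivlMr.
Qed.

(** The matrix [A = mlog (symm X)] solves [mexp (symm A) + (A - symm A) = symm X], an equation on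
    all matrices whose second term constrains the skew directions. *)
Lemma Cinf_mlog : Cinf symm_SymPos (mlog \o symm).
Proof.
have ot : open [set: 'M[R]_k] by exact: openT.
have Csymm O : open O -> Cinf O symm by move=> oO; exact: Cinf_linear.
have Cid O : open O -> Cinf O (@idfun 'M[R]_k) by move=> oO; exact: Cinf_linear.
have C1 : Cinf setT (mexp \o symm).
  by apply: (Cinf_comp ot ot) => //; [exact: Csymm|exact: Cinf_mexp].
have C2 : Cinf setT (fun A => A - symm A) by apply: CinfB => //; [exact: Cid|exact: Csymm].
apply: (@Cinf_implicit R _ _ _ _ setT (fun A => (mexp \o symm) A + (A - symm A)) _ symm).
- exact: open_symm_SymPos.
- exact: openT.
- exact: CinfD.
- exact/Csymm/open_symm_SymPos.
- by [].
- by move=> X Xpos /=; rewrite symm_id ?subrr ?addr0 ?mlogK//; exact: Sym_mlog.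
- exact: continuous_mlog_symm.
move=> X u Xpos; set A := (mlog \o symm) X.
rewrite [X in X = 0](_ : _ = dexp (symm A) (symm A) (symm u) + (u - symm u)); last first.
  rewrite [LHS]deriveD; first last.
  - exact/diff_derivable/(Cinf_differentiable C2).
  - exact/diff_derivable/(Cinf_differentiable C1).
  rewrite derive_comp_linear derive_mexp; congr (_ + _).
  rewrite [LHS]deriveB ?derive_id ?derive_linear//.
  exact/diff_derivable/(Cinf_differentiable (Csymm _ ot)).
move=> E.
have s0 : symm u = 0.
  apply/eqP; apply: contraPT E => u0 E.
  have := dexp_gt0 (symm_Sym A) (symm_Sym u) u0.
  (* The linearised equation makes this derivative skew, hence orthogonal to [symm u], against
     [dexp_gt0]. *)
  have -> : dexp (symm A) (symm A) (symm u) = - (u - symm u).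
    by apply/eqP; rewrite -addr_eq0 E.
  by rewrite -tr_sub_symm frob_skew ?ltxx//; [exact: symm_Sym|rewrite trmxK tr_sub_symm opprK].
by move: E; rewrite s0 raddf0 add0r subr0.
Qed.

End SymmetricPart.

(** * Off-log coordinates *)

Section CoerciveMin.
Context {R : realType}.

Lemma coercive_min n (phi : 'rV[R]_n -> R) (M : R) : continuous phi ->
  (forall (d : 'rV[R]_n) i, M < `|d 0 i| -> phi 0 < phi d) -> exists c, forall d, phi c <= phi d.
Proof.
move=> cphi coer; pose N := Num.max M 0.
pose K := [set d : 'rV[R]_n | `|d| <= N].
have K0 : K !=set0 by exists 0; rewrite /K/= normr0 le_max lexx orbT.
have Kc : compact K.
  apply: bounded_closed_compact.
    by exists N; split; [exact: num_real|move=> x Nx d /= /le_trans; apply; exact: ltW].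
  by apply: (preimage_closed (f := fun d : 'rV[R]_n => `|d|) _ (@closed_le R N)) => d _; exact: norm_continuous.
have [c _ cmin] := compact_EVT_min K0 Kc (continuous_subspaceT cphi).
exists c => d; have [dN|Nd] := leP `|d| N; first by apply: cmin; exact/mem_set.
have : exists i, M < `|d 0 i|.
  apply: contrapT => H; move: Nd; rewrite ltNge => /negP; apply.
  apply: mx_norm_le => [|i j]; first by rewrite le_max lexx orbT.
  rewrite ord1 le_max; apply/orP; left; rewrite leNgt; apply/negP => Mj.
  by apply: H; exists j.
move=> [i /coer/ltW/(le_trans _)]; apply; apply: cmin.
by apply/mem_set; rewrite /K/= normr0 le_max lexx orbT.
Qed.

(** Source of the coercivity of both potentials. For [t >= 0] and E = exp (t / 2) >= 1 + t / 2, one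
    has E^2 >= 4 E - 4 >= 2 t. *)
Lemma expR_sub_ge_norm (t : R) : `|t| <= expR t - t.
Proof.
have := expR_gt0 t; have [t0|t0] := ger0P t; last by lra.
have -> : expR t = expR (t / 2) ^+ 2 by rewrite expr2 -expRD; congr expR; field.
have := expR_ge1Dx (t / 2); have : 0 <= (expR (t / 2) - 2) ^+ 2 by exact: sqr_ge0.
move: (expR (t / 2)) => E; rewrite sqrrB; nra.
Qed.

End CoerciveMin.

(** * The unit diagonal equation: existence and uniqueness *)

Section UnitDiagonal.
Context {R : realType} {k : nat}.
Implicit Types (A B X Y U S D : 'M[R]_k) (d e : 'rV[R]_k).

Lemma frob_diag A d : frob A (diag_mx d) = \sum_i A i i * d 0 i.
Proof. by rewrite /frob /mxtrace; apply: eq_bigr => i _; rewrite mul_mx_diag mxE. Qed.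

Lemma Hol_Sym S : Hol R k S -> Sym R k S.
Proof. by case. Qed.

Lemma Sym_diag_mx d : Sym R k (diag_mx d).
Proof. exact: tr_diag_mx. Qed.

Lemma SymD A B : Sym R k A -> Sym R k B -> Sym R k (A + B).
Proof. by rewrite /Sym/= linearD/= => -> ->. Qed.

(** Klein's inequality at [diag_mx d]: the first-order term pairs a diagonal matrix with the hollow
    [S] and vanishes. *)
Lemma trace_mexp_ge S d : Hol R k S ->
  \sum_i expR (d 0 i) <= \tr (mexp (diag_mx d + S)).
Proof.
move=> [Ss S0]; have := klein (Sym_diag_mx d) (SymD (Sym_diag_mx d) Ss).
rewrite addrAC subrr add0r frob_symmetric mexp_diag frob_diag [X in _ + X]big1 ?addr0.
  by rewrite mxtrace_diag; under [in X in X -> _]eq_bigr do rewrite mxE.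
by move=> i _; rewrite S0 mul0r.
Qed.

(* The potential whose critical points are the solutions of the unit diagonal
   equation. *)
Definition diag_potential S d := \tr (mexp (diag_mx d + S)) - \sum_i d 0 i.

Lemma diag_potential_ge S d i : Hol R k S -> `|d 0 i| <= diag_potential S d.
Proof.
move=> HS; rewrite /diag_potential lerBrDr.
apply: le_trans (trace_mexp_ge d HS).
rewrite -lerBrDr -sumrB (bigD1 i)//= ler_wpDr ?expR_sub_ge_norm//.
by apply: sumr_ge0 => j _; exact: le_trans (expR_sub_ge_norm _).
Qed.

Lemma continuous_diag_potential S : continuous (diag_potential S).
Proof.
have ot : open [set: 'rV[R]_k] by exact: openT.
have C1 : Cinf setT (fun d : 'rV[R]_k => mexp (diag_mx d + S)).
  apply: (@Cinf_comp _ _ _ _ _ _ _ setT (fun d : 'rV[R]_k => diag_mx d + S) mexp) => //.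
  - exact: openT.
  - by apply: CinfD => //; [exact: (Cinf_linear diag_mx)|exact: Cinf_cst].
  - exact: Cinf_mexp.
suff H : Cr 0 setT (diag_potential S) by move=> d; exact: H.
apply: CrB; [exact: ot| |].
  by apply: Cr_sum => [|i _]; [exact: ot|exact: C1].
by apply: Cr_sum => [|i _]; [exact: ot|exact: Cr_coord].
Qed.

Lemma calD_exists S : Hol R k S -> exists d, forall i, mexp (diag_mx d + S) i i = 1.
Proof.
move=> HS.
have [d dmin] : exists d, forall e, diag_potential S d <= diag_potential S e.
  apply: (@coercive_min _ _ _ (diag_potential S 0)).
    exact: continuous_diag_potential.
  by move=> e i /lt_le_trans; apply; exact: diag_potential_ge.
exists d => i; pose H : 'rV[R]_k := delta_mx 0 i.
pose B := diag_mx d + S; pose A (t : R) := t *: diag_mx H + B.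
have AE t : A t = diag_mx (d + t *: H) + S.
  by rewrite /A /B linearD linearZ/= addrA (addrC (diag_mx d)).
have Bs : Sym R k B by exact: SymD (Sym_diag_mx _) (Hol_Sym HS).
have As t : Sym R k (A t) by rewrite AE; exact: SymD (Sym_diag_mx _) (Hol_Sym HS).
(* Minimality of [d] is combined with Klein's inequality at [A t] instead of differentiating the
   trace; letting [t] tend to 0 from either side then gives both inequalities for the diagonal
   entry. *)
have ineq t : 0 <= t * (mexp (A t) i i - 1).
  have := klein (As t) Bs; have := dmin (d + t *: H).
  have -> : B - A t = - t *: diag_mx H by rewrite /A opprD addrC addrNK scaleNr.
  rewrite frobZr frob_diag (bigD1 i)//= big1 ?addr0; last first.
    by move=> j /negbTE ji; rewrite mxE eqxx ji mulr0.
  rewrite mxE !eqxx mulr1 /diag_potential -AE -/B.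
  have -> : \sum_j (d + t *: H) 0 j = \sum_j d 0 j + t.
    under eq_bigr do rewrite mxE; rewrite big_split/=; congr (_ + _).
    rewrite (bigD1 i)//= big1 ?addr0; first by rewrite !mxE !eqxx mulr1.
    by move=> j /negbTE ji; rewrite !mxE eqxx ji mulr0.
  lra.
have lim0 : mexp (A t) i i @[t --> (0 : R)] --> mexp B i i.
  apply: (@continuous_cvg _ _ _ _ _ _ (fun M : 'M[R]_k => M i i)).
    exact: coord_continuous.
  apply: continuous_cvg; last exact: cvg_line.
  exact: (Cinf_continuous (@Cinf_mexp R k)).
apply/eqP; rewrite eq_le; apply/andP; split.
  have liml := cvg_at_left_filter lim0.
  rewrite -(cvg_lim _ liml)//; apply: limr_le; first exact: cvgP liml.
  near=> t; have := ineq t; have : t < 0 by near: t; exact: nbhs_left_lt.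
  by move=> t0; rewrite nmulr_rge0// subr_le0.
have limr := cvg_at_right_filter lim0.
rewrite -(cvg_lim _ limr)//; apply: limr_ge; first exact: cvgP limr.
near=> t; have := ineq t; have : 0 < t by near: t; exact: nbhs_right_gt.
by move=> t0; rewrite pmulr_rge0// subr_ge0.
Unshelve. all: by end_near. Qed.

Lemma frob_diag_diff A B D D' : is_diag_mx D -> is_diag_mx D' ->
  (forall i, A i i = 1) -> (forall i, B i i = 1) -> frob (A - B) (D - D') = 0.
Proof.
move=> /is_diag_mxP dD /is_diag_mxP dD' A1 B1.
have -> : D - D' = diag_mx (\row_i (D i i - D' i i)).
  apply/matrixP => i j; rewrite !mxE; case: (eqVneq i j) => [->|ij]; first by rewrite mulr1n.
  by rewrite dD// dD'// subrr.
by rewrite frob_diag big1// => i _; rewrite !mxE A1 B1 subrr mul0r.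
Qed.

Lemma is_diag_Sym D : is_diag_mx D -> Sym R k D.
Proof. by move=> /diag_mxP[d ->]; exact: Sym_diag_mx. Qed.

Lemma calD_unique S D D' : Sym R k S -> is_diag_mx D -> is_diag_mx D' ->
  (forall i, mexp (D + S) i i = 1) -> (forall i, mexp (D' + S) i i = 1) -> D = D'.
Proof.
move=> Ss dD dD' D1 D'1; apply: (addIr S); apply: mexp_inj.
- exact: SymD (is_diag_Sym dD) Ss.
- exact: SymD (is_diag_Sym dD') Ss.
- by rewrite opprD addrACA subrr addr0 frob_diag_diff.
Qed.

Lemma calD_spec S : Hol R k S -> is_diag_mx (calD S) /\ Cor R k (mexp (calD S + S)).
Proof.
move=> HS; have [d d1] := calD_exists HS.
have : [set D | Diag R k D /\ Cor R k (mexp (D + S))] (diag_mx d).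
  split; first exact: diag_mx_is_diag.
  by split=> //; apply: mexp_SymPos; exact: SymD (Sym_diag_mx _) (Hol_Sym HS).
by move=> /(xgetI 0)[].
Qed.

(** The logarithm of the correlation matrix whose off-log coordinate is [S]. *)
Definition unlog S : 'M[R]_k := calD S + S.

Lemma Sym_unlog S : Hol R k S -> Sym R k (unlog S).
Proof. by move=> HS; apply: SymD (Hol_Sym HS); apply: is_diag_Sym; case: (calD_spec HS). Qed.

Lemma off_is_linear : linear (@off R k).
Proof.
by move=> a A B; apply/matrixP => i j; rewrite /off /diag_part !mxE; case: (i == j); rewrite ?mulr1n ?mulr0n; ring.
Qed.

HB.instance Definition _ := GRing.isLinear.Build R 'M[R]_k 'M[R]_k _ (@off R k) off_is_linear.

Lemma off_entry A i j : off A i j = if i == j then 0 else A i j.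
Proof.
by rewrite /off /diag_part !mxE; case: eqVneq => [->|]; rewrite ?subrr// mulr0n subr0.
Qed.

Lemma Hol_off A : Sym R k A -> Hol R k (off A).
Proof.
move=> As; split=> [|i]; last by rewrite off_entry eqxx.
by apply/matrixP => i j; rewrite mxE !off_entry eq_sym; case: eqP => // _; rewrite -{2}As mxE.
Qed.

Lemma off_Hol S : Hol R k S -> off S = S.
Proof. by move=> [_ S0]; apply/matrixP => i j; rewrite off_entry; case: eqP => // ->. Qed.

Lemma off_diag D : is_diag_mx D -> off D = 0.
Proof.
by move=> /is_diag_mxP dD; apply/matrixP => i j; rewrite off_entry mxE; case: eqVneq => // /dD.
Qed.

Lemma diag_partE A : diag_part A = A - off A.
Proof. by rewrite /off opprB addrC subrK. Qed.

Lemma is_diag_diag_part A : is_diag_mx (diag_part A).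
Proof. exact: diag_mx_is_diag. Qed.

Lemma off_unlog S : Hol R k S -> off (unlog S) = S.
Proof. by move=> HS; rewrite /unlog linearD/= off_diag ?add0r ?off_Hol//; case: (calD_spec HS). Qed.

Lemma unlog_off A : Sym R k A -> Cor R k (mexp A) -> unlog (off A) = A.
Proof.
move=> As [_ A1]; rewrite /unlog; have [dD [_ D1]] := calD_spec (Hol_off As).
have E : diag_part A + off A = A by rewrite diag_partE subrK.
rewrite (@calD_unique _ _ (diag_part A) (Hol_Sym (Hol_off As)) dD (is_diag_diag_part A) D1)//.
by rewrite E.
Qed.

End UnitDiagonal.

(** * Smooth dependence of the unit diagonal solution *)

Section UnlogSmooth.
Context {R : realType} {k : nat}.
Implicit Types (A B X Y U S D : 'M[R]_k) (d e : 'rV[R]_k).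

Lemma diag_part_is_linear : linear (@diag_part R k).
Proof.
move=> a A B; apply/matrixP => i j.
by rewrite /diag_part !mxE; case: (i == j); rewrite ?mulr1n ?mulr0n; ring.
Qed.

HB.instance Definition _ :=
  GRing.isLinear.Build R 'M[R]_k 'M[R]_k _ (@diag_part R k) diag_part_is_linear.

Lemma quad_ge_mexp A N : Sym R k A -> `|A| <= N -> quad_ge (expR (- (k%:R * N))) (mexp A).
Proof.
move=> /spectral_theorem[P [a [PP AE]]] AN; rewrite -/(spec P a) in AE.
have a_ge i : - (k%:R * N) <= a 0 i.
  (* Seeing [A] as a perturbation of zero bounds its eigenvalues from below by [- (k%:R * |A|)]. *)
  have q0 : quad_ge 0 (0 : 'M[R]_k) by move=> x; rewrite mul0r mulmx0 mul0mx mxE.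
  have := quad_ge_perturb A q0; rewrite AE => /(quad_ge_spec i PP); apply: le_trans.
  by rewrite -AE !sub0r normrN lerN2 ler_wpM2l.
rewrite AE mexp_spec// => x; rewrite quad_spec -(sqn_orth x PP) sqn_colE mulr_sumr.
by apply: ler_sum => i _; rewrite [map_mx _ _ _ _]mxE ler_wpM2r ?sqr_ge0// ler_expR.
Qed.

(** Both exponentials have unit diagonal, so the diagonal part of [unlog S - unlog S'] drops out of
    the pairing and only [S - S'] remains. The monotonicity constant depends on [N], hence the
    restriction to bounded sets. *)
Lemma unlog_lipschitz N : exists2 K, 0 <= K & forall S S', Hol R k S -> Hol R k S' ->
  `|unlog S| <= N -> `|unlog S'| <= N -> `|unlog S - unlog S'| <= K * `|S - S'|.
Proof.
pose c := expR (- (k%:R * N)); pose b := 1 + k%:R * `|N|.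
have c0 : 0 < c by exact: expR_gt0.
have b1 : 1 <= b by rewrite lerDl mulr_ge0.
pose L := expR (2 * b) * k%:R.
exists (k%:R * k%:R * L / c); first by rewrite !mulr_ge0 ?expR_ge0// invr_ge0 ltW.
move=> S S' HS HS' AN BN; set A := unlog S; set B := unlog S'.
have As := Sym_unlog HS; have Bs := Sym_unlog HS'.
have le_b M : `|M| <= N -> k%:R * `|M : 'M[R]_k| <= b.
  by move=> MN; rewrite ler_wpDl// ler_wpM2l// (le_trans MN)// ler_norm.
have := mexp_monotone As Bs (quad_ge_mexp As AN) (quad_ge_mexp Bs BN).
have -> : frob (mexp A - mexp B) (A - B) = frob (mexp A - mexp B) (S - S').
  have -> : A - B = (calD S - calD S') + (S - S') by rewrite opprD addrACA.
  have [dD [_ D1]] := calD_spec HS; have [dD' [_ D1']] := calD_spec HS'.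
  by rewrite frobDr frob_diag_diff ?add0r.
rewrite -/A -/B -/c => H.
have [->|N0] := eqVneq (A - B) 0.
  by rewrite normr0 !mulr_ge0 ?expR_ge0// invr_ge0 ltW.
have nAB : 0 < `|A - B| by rewrite normr_gt0.
have H2 : c * `|A - B| ^+ 2 <= k%:R * (k%:R * (L * `|A - B| * `|S - S'|)).
  apply: (@le_trans _ _ (k%:R * (k%:R * (`|mexp A - mexp B| * `|S - S'|)))).
    apply: le_trans (frob_le_norm _ _); apply: le_trans (ler_norm _); apply: le_trans H.
    by rewrite ler_pM2l// sqr_norm_le_sqn.
  do 2! apply: ler_wpM2l => //; rewrite ler_wpM2r// /L -mulrA.
  exact: mexp_lipschitz b1 (le_b _ AN) (le_b _ BN).
rewrite -(ler_pM2r nAB) -(ler_pM2l c0) -expr2 (le_trans H2)// le_eqVlt.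
by apply/orP; left; apply/eqP; field; rewrite gt_eqF.
Qed.

(** By Klein's inequality the potential at the solution is at most its value [\tr (mexp S)] at zero,
    and the potential controls the diagonal. *)
Lemma norm_unlog_le S : Hol R k S -> `|unlog S| <= `|\tr (mexp S)| + `|S|.
Proof.
move=> HS; have [dD [_ D1]] := calD_spec HS; have As := Sym_unlog HS.
rewrite (le_trans (ler_normD _ _))// lerD2r.
move: dD => /diag_mxP[d dE].
have frobD : frob (mexp (unlog S)) (calD S) = \sum_i d 0 i.
  by rewrite dE frob_diag; apply: eq_bigr => i _; rewrite /unlog D1 mul1r.
have := klein As (Hol_Sym HS); have -> : S - unlog S = - calD S.
  by rewrite opprD addrCA subrr addr0.
rewrite -scaleN1r frobZr mulN1r frobD => H.
rewrite dE; apply: mx_norm_le => // i j; rewrite mxE.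
case: eqP => [_|_]; last by rewrite mulr0n normr0.
rewrite mulr1n (le_trans (diag_potential_ge _ _ HS))// (le_trans _ (ler_norm _))//.
by rewrite /diag_potential -dE.
Qed.

Definition hol_proj A : 'M[R]_k := off (symm A).

Lemma hol_proj_is_linear : linear hol_proj.
Proof. by move=> a A B; rewrite /hol_proj (linearP (@symm R k)) (linearP (@off R k)). Qed.

HB.instance Definition _ :=
  GRing.isLinear.Build R 'M[R]_k 'M[R]_k _ hol_proj hol_proj_is_linear.

Lemma Hol_hol_proj A : Hol R k (hol_proj A).
Proof. exact/Hol_off/symm_Sym. Qed.

Lemma hol_proj_id S : Hol R k S -> hol_proj S = S.
Proof. by move=> HS; rewrite /hol_proj symm_id ?off_Hol//; exact: Hol_Sym. Qed.

Lemma continuous_unlog : continuous (unlog \o hol_proj).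
Proof.
move=> X; apply/continuous_dist_le => e e0.
have ch : {for X, continuous hol_proj} by exact: linear_mx_continuous.
(* The bound of [norm_unlog_le] at [X], plus 1 for the variation of each of its two terms. *)
pose T := `|\tr (mexp (hol_proj X))| + `|hol_proj X| + 2.
have [K K0 KH] := unlog_lipschitz T.
have n1 : \forall Y \near X, `|hol_proj X - hol_proj Y| <= 1.
  by move/continuous_dist_le : ch; apply.
have n2 : \forall Y \near X, `|hol_proj X - hol_proj Y| <= e / (K + 1).
  by move/continuous_dist_le : ch; apply; rewrite divr_gt0// ltr_wpDl.
have ct : {for X, continuous (fun Y => \tr (mexp (hol_proj Y)) : R)}.
  have cm : {for X, continuous (mexp \o hol_proj)}.
    apply: continuous_comp; first exact: ch.
    exact: (Cinf_continuous (@Cinf_mexp R k)).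
  exact: (continuous_comp cm (@linear_mx_continuous _ _ _ _ (@mxtrace R k) _)).
have n3 : \forall Y \near X, `|\tr (mexp (hol_proj X)) - \tr (mexp (hol_proj Y))| <= 1.
  by move/continuous_dist_le : ct; apply.
have bound Y : `|hol_proj X - hol_proj Y| <= 1 ->
    `|\tr (mexp (hol_proj X)) - \tr (mexp (hol_proj Y))| <= 1 -> `|unlog (hol_proj Y)| <= T.
  move=> h1 h2; rewrite (le_trans (norm_unlog_le (Hol_hol_proj Y)))//.
  have := lerB_dist (hol_proj Y) (hol_proj X).
  have := lerB_dist (\tr (mexp (hol_proj Y))) (\tr (mexp (hol_proj X))).
  rewrite distrC => /le_trans/(_ h2); rewrite lerBlDr => h3.
  rewrite distrC => /le_trans/(_ h1); rewrite lerBlDr => h4.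
  by apply: le_trans (lerD h3 h4) _; rewrite addrACA addrC /T -(natrD _ 1 1).
have bX : `|unlog (hol_proj X)| <= T by apply: bound; rewrite subrr normr0.
apply: filterS3 n1 n2 n3 => Y h1 h2 h3 /=.
rewrite (le_trans (KH _ _ (Hol_hol_proj X) (Hol_hol_proj Y) bX (bound Y h1 h3)))//.
apply: (@le_trans _ _ ((K + 1) * `|hol_proj X - hol_proj Y|)).
  by rewrite ler_wpM2r// lerDl.
by rewrite mulrC -ler_pdivlMr// ltr_wpDl.
Qed.

(** The equation prescribes three complementary parts: the hollow part of [A], the diagonal of the
    exponential and the skew part. In its linearisation [symm u] is diagonal while the derivative of
    the exponential has zero diagonal; their pairing vanishes, so [dexp_gt0] forces [symm u = 0]. *)
Lemma Cinf_unlog : Cinf setT (unlog \o hol_proj).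
Proof.
have ot : open [set: 'M[R]_k] by exact: openT.
have Clin (L : {linear 'M[R]_k -> 'M[R]_k}) : Cinf setT L by exact: Cinf_linear.
have C1 : Cinf setT (@mexp R k \o @symm R k).
  exact: (Cinf_comp ot ot (Clin symm) (@Cinf_mexp R k) (fun _ _ => I)).
have C2 : Cinf setT (@diag_part R k \o (@mexp R k \o @symm R k)).
  exact: (@Cinf_comp _ _ _ _ _ _ _ setT (@mexp R k \o @symm R k) (@diag_part R k)
    ot ot C1 (Clin _) (fun _ _ => I)).
have C3 : Cinf setT (fun A => A - symm A) by apply: CinfB; [exact: ot|exact: (Clin idfun)|exact: Clin].
have C4 : Cinf setT (fun A => hol_proj A + (@diag_part R k \o (@mexp R k \o @symm R k)) A).
  by apply: CinfD; [exact: ot|exact: Clin|exact: C2].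
apply: (@Cinf_implicit R _ _ _ _ setT
  (fun A => (hol_proj A + (@diag_part R k \o (@mexp R k \o @symm R k)) A) + (A - symm A)) _
  (fun X => hol_proj X + 1%:M)).
- exact: ot.
- exact: ot.
- by apply: CinfD; [exact: ot|exact: C4|exact: C3].
- by apply: CinfD; [exact: ot|exact: Clin|exact: Cinf_cst].
- by [].
- move=> X _ /=; have HS := Hol_hol_proj X; have As := Sym_unlog HS.
  rewrite (symm_id As) subrr addr0; congr (_ + _).
    by rewrite /hol_proj (symm_id As) off_unlog.
  have [_ [_ D1]] := calD_spec HS.
  by apply/matrixP => i j; rewrite !mxE; case: eqP => [->|]; rewrite ?D1 ?mulr0n.
- by move=> X _; exact: continuous_unlog.
move=> X u _; set A := (unlog \o hol_proj) X.
rewrite [X in X = 0](_ : _ = (hol_proj u +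
    diag_part (dexp (symm A) (symm A) (symm u))) + (u - symm u)); last first.
  rewrite [LHS]deriveD; first last.
  - exact/diff_derivable/(Cinf_differentiable C3).
  - exact/diff_derivable/(Cinf_differentiable C4).
  congr (_ + _); last first.
    rewrite [LHS]deriveB ?derive_id ?derive_linear//.
    exact/diff_derivable/(Cinf_differentiable (Clin _)).
  rewrite [LHS]deriveD; first last.
  - exact/diff_derivable/(Cinf_differentiable C2).
  - exact/diff_derivable/(Cinf_differentiable (Clin _)).
  rewrite derive_linear; congr (_ + _).
  rewrite derive_linear_comp; last exact: Cinf_differentiable C1 _.
  by rewrite derive_comp_linear derive_mexp.
set E := dexp _ _ _; move=> /sym_skew_eq0[].
- apply: SymD; first exact/Hol_Sym/Hol_hol_proj.
  exact/is_diag_Sym/is_diag_diag_part.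
- exact: tr_sub_symm.
move=> H us0.
have offdiag i j : i != j -> symm u i j = 0.
  move=> ij; move/matrixP : H => /(_ i j); rewrite mxE off_entry (negbTE ij) !mxE.
  by rewrite (negbTE ij) mulr0n addr0.
have Ediag i : E i i = 0.
  move/matrixP : H => /(_ i i); rewrite mxE off_entry eqxx !mxE eqxx.
  by rewrite mulr1n add0r.
have s0 : symm u = 0.
  apply/eqP; apply: contraT => u0.
  have := dexp_gt0 (symm_Sym A) (symm_Sym u) u0; rewrite -/E.
  have -> : symm u = diag_mx (\row_i symm u i i).
    apply/matrixP => i j; rewrite [RHS]mxE [X in X *+ _]mxE.
    case: (eqVneq i j) => [->|/offdiag ->]; first by rewrite mulr1n.
    by rewrite mulr0n.
  by rewrite frob_diag big1 ?ltxx// => i _; rewrite Ediag mul0r.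
by move: us0; rewrite s0 subr0.
Qed.

End UnlogSmooth.

(** * Log-scaling coordinates *)

(** For the polynomial map [scale_eqn], whose expansions along the lines considered stop at degree
    two. *)
Lemma derive_quadratic (R : realType) (V W : normedModType R) (F : V -> W) x u a b :
  (forall h : R, F (h *: u + x) = F x + h *: a + h ^+ 2 *: b) -> 'D_u F x = a.
Proof.
move=> FE; apply: cvg_lim => //.
have la : a + h *: b @[h --> (0 : R)^'] --> a.
  apply: cvg_within_filter; have : a + h *: b @[h --> (0 : R)] --> a + 0 *: b.
    by apply: cvgD; [exact: cvg_cst|apply: cvgZr_tmp; exact: cvg_id].
  by rewrite scale0r addr0.
apply: cvg_trans la; apply: near_eq_cvg; near=> h.
have h0 : h != 0 by near: h; exact: nbhs_dnbhs_neq.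
rewrite /= FE -(addrA (F x)) (addrC (F x)) addrK scalerDr !scalerA mulVf// scale1r.
by rewrite expr2 mulrA mulVf// mul1r.
Unshelve. all: by end_near. Qed.

(** * Scaling to unit row sums: existence and uniqueness *)

Section Scaling.
Context {R : realType} {k : nat}.
Implicit Types (A B X Y U S D : 'M[R]_k) (d e : 'rV[R]_k) (x y s : 'cV[R]_k).

Definition ones : 'cV[R]_k := const_mx 1.

Lemma Row0_ones A : Row0 R k A <-> A^T = A /\ A *m ones = 0.
Proof.
split=> -[As A0]; split=> //.
  apply/matrixP => i j; rewrite mxE [RHS]mxE; apply: etrans (A0 i).
  by apply: eq_bigr => l _; rewrite mxE mulr1.
move=> i; move/matrixP : A0 => /(_ i 0); rewrite mxE [X in _ = X]mxE => E; apply: etrans E.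
by apply: eq_bigr => l _; rewrite mxE mulr1.
Qed.

Lemma mexp_ones A : A *m ones = 0 -> mexp A *m ones = ones.
Proof.
move=> A1; have E : A *m ones = ones *m (0 : R)%:M.
  by rewrite A1 -[0 in RHS]/(0 : R) raddf0 mulmx0.
by rewrite (mexp_intertwine E) mexp_scalar expR0 mulmx1.
Qed.

(* [exp a = 1] only for [a = 0], so the eigenvalue 1 of [mexp A] comes from the
   kernel of [A]. *)
Lemma ones_mexp A : Sym R k A -> mexp A *m ones = ones -> A *m ones = 0.
Proof.
move=> /spectral_theorem[P [a [PP AE]]]; rewrite -/(spec P a) in AE.
rewrite AE mexp_spec// => E.
have E2 : diag_mx (map_mx expR a) *m (P *m ones) = P *m ones.
  by rewrite -[in RHS]E /spec !mulmxA PP mul1mx.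
rewrite /spec -!mulmxA (_ : diag_mx a *m _ = 0) ?mulmx0//.
apply/matrixP => i j; rewrite mul_diag_mx [RHS]mxE mxE.
move/matrixP : E2 => /(_ i j); rewrite mul_diag_mx mxE [map_mx _ _ _ _]mxE.
move: ((P *m ones) i j) => t /eqP.
rewrite -subr_eq0 -[X in _ - X]mul1r -mulrBl mulf_eq0 => /orP[|/eqP->]; last by rewrite mulr0.
by rewrite subr_eq0 -(expR0 R) => /eqP/expR_inj ->; rewrite mul0r.
Qed.

Lemma Row0_mlog X : SymPos R k X -> Row0 R k (mlog X) <-> X *m ones = ones.
Proof.
move=> Xpos; rewrite Row0_ones; split=> [[_ /mexp_ones]|H]; first by rewrite mlogK.
by split; [exact: Sym_mlog|apply: ones_mexp; [exact: Sym_mlog|rewrite mlogK]].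
Qed.

Lemma SymPos_congr X d : (forall i, d 0 i != 0) -> SymPos R k X ->
  SymPos R k (diag_mx d *m X *m diag_mx d).
Proof.
move=> d0 [XT Xpos]; split=> [|x x0].
  by rewrite !trmx_mul tr_diag_mx XT mulmxA.
have -> : x^T *m (diag_mx d *m X *m diag_mx d) *m x =
    (diag_mx d *m x)^T *m X *m (diag_mx d *m x).
  by rewrite trmx_mul tr_diag_mx !mulmxA.
apply: Xpos; apply: contraNneq x0 => /matrixP H; apply/eqP/matrixP => i j.
have := H i j; rewrite mul_diag_mx !mxE => /eqP.
by rewrite mulf_eq0 (negbTE (d0 i)) => /eqP.
Qed.

Definition scales X s := (forall i, 0 < s i 0) /\ (forall i, s i 0 * (X *m s) i 0 = 1).

Lemma scales_ones X s : (forall i, 0 < s i 0) ->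
  scales X s <-> diag_mx s^T *m X *m diag_mx s^T *m ones = ones.
Proof.
move=> s0; have E : diag_mx s^T *m ones = s.
  by apply/matrixP => i j; rewrite mul_diag_mx !mxE mulr1 ord1.
rewrite -!mulmxA E; split=> [[_ H]|H].
  by apply/matrixP => i j; rewrite mul_diag_mx mxE [s^T _ _]mxE ord1 H mxE.
split=> // i; move/matrixP : H => /(_ i 0); rewrite mul_diag_mx mxE [s^T _ _]mxE => ->.
by rewrite mxE.
Qed.

(** The equations say that [X x] and [Y y] are the entrywise inverses of [x] and [y], and inversion
    is decreasing on positive numbers. Allowing [X] and [Y] to differ serves the Lipschitz estimate
    as well as uniqueness. *)
Lemma scales_diff X Y x y : scales X x -> scales Y y ->
  ((x - y)^T *m (X *m x - Y *m y)) 0 0 <= 0.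
Proof.
move=> [x0 Xx] [y0 Yy]; rewrite mxE; apply: sumr_le0 => i _.
have {}Xx : (X *m x) i 0 = (x i 0)^-1.
  by apply: (mulfI (lt0r_neq0 (x0 i))); rewrite Xx divff// lt0r_neq0.
have {}Yy : (Y *m y) i 0 = (y i 0)^-1.
  by apply: (mulfI (lt0r_neq0 (y0 i))); rewrite Yy divff// lt0r_neq0.
rewrite [(x - y)^T _ _]mxE [(x - y) _ _]mxE [(- y) _ _]mxE.
rewrite [(X *m x - Y *m y) _ _]mxE [(- (Y *m y)) _ _]mxE Xx Yy.
have := x0 i; have := y0 i; move: (x i 0) (y i 0) => a b b0 a0.
have -> : (a - b) * (a^-1 - b^-1) = - ((a - b) ^+ 2 / (a * b)).
  by field; rewrite !gt_eqF.
by rewrite oppr_le0 divr_ge0 ?sqr_ge0// ltW// mulr_gt0.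
Qed.

Lemma scales_unique X x y : SymPos R k X -> scales X x -> scales X y -> x = y.
Proof.
move=> [_ Xpos] Xx Xy; apply/eqP; rewrite -subr_eq0; apply/negPn/negP => xy0.
have := Xpos _ xy0; rewrite -mulmxA mulmxBr ltNge => /negP; apply.
exact: scales_diff.
Qed.

(** The expression vanishes at [t = 0], so 0 is a minimum, and its derivative there is [a - 1]. *)
Lemma exp_min_slope (a b : R) :
  (forall t, 0 <= a * (expR t - 1) + b * (expR t - 1) ^+ 2 - t) -> a = 1.
Proof.
move=> H; pose f (t : R) := a * (expR t - 1) + b * (expR t - 1) ^+ 2 - t.
have df (t : R) : is_derive t (1 : R) f (a * expR t + b * (2 * (expR t - 1) * expR t) - 1).
  apply: is_derive_eq.
  rewrite /GRing.scale/=. ring.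
have f0 : f 0 = 0 by rewrite /f expR0 subrr expr0n/= !mulr0 addr0 subr0.
have [_ D0] : is_derive (0 : R) (1 : R) f 0.
  apply: (@derive1_at_min R f (-1) 1 0).
  - lra.
  - by move=> t _; case: (df t).
  - by rewrite in_itv/= ltrN10 ltr01.
  - by move=> t _; rewrite f0; exact: H.
have [_] := df 0; rewrite D0 expR0 subrr !mulr0 mul0r mulr0 addr0 mulr1.
by move/eqP; rewrite eq_sym subr_eq0 => /eqP.
Qed.

Lemma scales_exists X : SymPos R k X -> exists s, scales X s.
Proof.
move=> Xpos; have [c c0 cX] := SymPos_quad_ge Xpos.
(* With [s = exp u] the constraint of positivity disappears and the potential lives on the whole
   space. *)
pose ex (u : 'rV[R]_k) : 'cV[R]_k := \col_i expR (u 0 i).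
pose q x : R := (x^T *m X *m x) 0 0.
pose phi u := 2^-1 * q (ex u) - \sum_i u 0 i.
pose L := ln c.
(* Since c exp(2u) = exp(2u + L), [expR_sub_ge_norm] at 2u + L bounds each summand below by |u| -
   |L|. *)
have phi_ge (u : 'rV[R]_k) i : `|u 0 i| - k%:R * `|L| <= phi u.
  apply: (@le_trans _ _ (\sum_j (`|u 0 j| - `|L|))).
    rewrite sumrB sumr_const card_ord -[`|L| *+ k]mulr_natl lerD2r (bigD1 i)//= lerDl.
    exact: sumr_ge0.
  have : c * sqn (ex u) <= q (ex u) by exact: cX.
  rewrite -(ler_pM2l (_ : 0 < 2^-1 :> R))// => H.
  rewrite /phi; apply: le_trans (lerB H (lexx _)).
  rewrite sqn_colE !mulr_sumr -sumrB; apply: ler_sum => j _.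
  have -> : c * ex u j 0 ^+ 2 = expR (2 * u 0 j + L).
    rewrite mxE expRD [expR L]lnK ?posrE// mulrC; congr (_ * _).
    by rewrite expr2 -expRD; congr expR; ring.
  have := expR_sub_ge_norm (2 * u 0 j + L).
  have := ler_normB (2 * u 0 j + L) L; rewrite addrK normrM ger0_norm//.
  have := ler_norm (- L); rewrite normrN.
  move: (`|2 * u 0 j + L|) (`|u 0 j|) (`|L|) (expR _) => n1 n2 n3 E; lra.
have cphi : continuous phi.
  have ot : open [set: 'rV[R]_k] by exact: openT.
  suff H : Cr 0 setT phi by move=> u; exact: H.
  have ce i : Cr 0 setT (fun u : 'rV[R]_k => ex u i 0).
    move=> u _; rewrite (_ : (fun u => _) = expR \o (fun u : 'rV[R]_k => u 0 i)).
      by apply: continuous_comp; [exact: coord_continuous|exact: continuous_expR].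
    by apply/funext => v; rewrite mxE.
  apply: CrB; [exact: ot| |by apply: Cr_sum => [|i _]; [exact: ot|exact: Cr_coord]].
  apply: CrZ; first exact: ot.
  apply: (@Cr_eq _ _ _ _ (fun u => \sum_j (\sum_i ex u i 0 * X i j) * ex u j 0)).
  - exact: ot.
  - move=> u _; rewrite /q mxE; apply: eq_bigr => j _; rewrite [(_ *m X) _ _]mxE; congr (_ * _).
    by apply: eq_bigr => i _; rewrite [_^T _ _]mxE.
  apply: Cr_sum => [|j _]; first exact: ot.
  apply: CrM; [exact: ot| |exact: ce].
  apply: Cr_sum => [|i _]; first exact: ot.
  by apply: CrM; [exact: ot|exact: ce|exact: Cr_cst].
have [u umin] : exists u, forall v, phi u <= phi v.
  apply: (@coercive_min _ _ _ (phi 0 + k%:R * `|L|)) => // v i.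
  by rewrite -ltrBrDr => /lt_le_trans; apply; exact: phi_ge.
exists (ex u); split=> i; first by rewrite mxE expR_gt0.
(* Moving [u] by [t] in coordinate [i] multiplies that scale by exp t, so the quadratic form is a
   polynomial in [r = expR t - 1]; the witness is half its coefficient of [r ^+ 2]. *)
apply: (@exp_min_slope _ (2^-1 * (ex u i 0 ^+ 2 * X i i))) => t.
pose v := u + t *: delta_mx 0 i; set r := expR t - 1.
have exv : ex v = ex u + (r * ex u i 0) *: delta_mx i 0.
  apply/matrixP => j l; rewrite !mxE eqxx (ord1 l) eqxx andbT /=.
  case: (eqVneq j i) => [->|ji]; last by rewrite !mulr0 !addr0.
  by rewrite !mulr1 expRD /r; ring.
have sumv : \sum_j v 0 j = \sum_j u 0 j + t.
  under eq_bigr do rewrite mxE; rewrite big_split/=; congr (_ + _).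
  rewrite (bigD1 i)//= big1 ?addr0; first by rewrite !mxE !eqxx mulr1.
  by move=> j /negbTE ji; rewrite !mxE eqxx ji mulr0.
have qv : q (ex v) = q (ex u) + 2 * (r * (ex u i 0 * (X *m ex u) i 0)) +
    r ^+ 2 * (ex u i 0 ^+ 2 * X i i).
  rewrite exv; set w := delta_mx i 0 : 'cV[R]_k; set a := r * ex u i 0.
  have e1 : (w^T *m X *m ex u) 0 0 = (X *m ex u) i 0.
    by rewrite -mulmxA /w trmx_delta -rowE mxE.
  have e2 : ((ex u)^T *m X *m w) 0 0 = (X *m ex u) i 0.
    rewrite -e1 -[w^T *m X *m ex u]trmxK [in RHS]mxE !trmx_mul trmxK Xpos.1.
    by rewrite mulmxA.
  have e3 : (w^T *m X *m w) 0 0 = X i i.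
    by rewrite -mulmxA /w trmx_delta -rowE mxE -colE mxE.
  have trD : (ex u + a *: w)^T = (ex u)^T + a *: w^T by rewrite linearD linearZ.
  rewrite /q trD !mulmxDl !mulmxDr -!scalemxAl -!scalemxAr scalerA.
  have eD (M N : 'M[R]_1) : (M + N) 0 0 = M 0 0 + N 0 0 by rewrite mxE.
  have eZ c' (M : 'M[R]_1) : (c' *: M) 0 0 = c' * M 0 0 by rewrite mxE.
  by rewrite !eD !eZ e1 e2 e3 /a; ring.
have := umin v; rewrite /phi qv sumv -subr_ge0.
by congr (0 <= _); field.
Qed.

Definition scale_vec X : 'cV[R]_k := \col_i calDstar X i i.

Lemma scale_vec_spec X : SymPos R k X ->
  scales X (scale_vec X) /\ calDstar X = diag_mx (scale_vec X)^T.
Proof.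
move=> Xpos.
have diagE D : is_diag_mx D -> D = diag_mx (\col_i D i i)^T.
  by move=> /diag_mxP[d ->]; congr diag_mx; apply/rowP => i; rewrite !mxE eqxx mulr1n.
have : [set D | DiagPos R k D /\ Row0 R k (mlog (D *m X *m D))] (calDstar X).
  have [s [s0 Xs]] := scales_exists Xpos.
  apply: (@xgetI _ 0 _ (diag_mx s^T)); split; last first.
    rewrite /= Row0_mlog; first exact/(scales_ones _ s0).
    by apply: SymPos_congr => // i; rewrite mxE gt_eqF.
  split; first exact: diag_mx_is_diag.
  by move=> i; rewrite !mxE eqxx mulr1n.
move=> [[dD D0] H]; have E := diagE _ dD; split; last exact: E.
have s0 i : 0 < scale_vec X i 0 by rewrite mxE.
apply/scales_ones => //; rewrite -E; apply/Row0_mlog => //.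
by rewrite E; apply: SymPos_congr => // i; rewrite mxE gt_eqF.
Qed.

Lemma scale_vec_unique X s : SymPos R k X -> scales X s -> scale_vec X = s.
Proof. by move=> Xpos; apply: scales_unique => //; have [] := scale_vec_spec Xpos. Qed.

End Scaling.

(** * Smooth dependence of the scaling, and smooth normalisation *)

Section ScalingSmooth.
Context {R : realType} {k : nat}.
Implicit Types (A B X Y U S D : 'M[R]_k) (d e : 'rV[R]_k) (x y s : 'cV[R]_k).

Lemma mx_norm_tr m n (M : 'M[R]_(m, n)) : `|M^T| = `|M|.
Proof.
suff H p q (N : 'M[R]_(p, q)) : `|N^T| <= `|N|.
  by apply/eqP; rewrite eq_le H -{1}[M]trmxK H.
by apply: mx_norm_le => // i j; rewrite mxE mx_entry_le_norm.
Qed.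

(** Expand (x - y)^T Y (x - y): the part carrying X x - Y y is nonpositive by [scales_diff], leaving
    only a term in [Y - X]. *)
Lemma scale_vec_lipschitz X Y c : 0 < c -> SymPos R k X -> SymPos R k Y -> quad_ge c Y ->
  `|scale_vec X - scale_vec Y| <= k%:R * (k%:R * `|scale_vec X|) / c * `|X - Y|.
Proof.
move=> c0 Xpos Ypos cY; have [Xx _] := scale_vec_spec Xpos.
have [Yy _] := scale_vec_spec Ypos.
set x := scale_vec X in Xx *; set y := scale_vec Y in Yy *.
have H : c * sqn (x - y) <= ((x - y)^T *m ((Y - X) *m x)) 0 0.
  apply: le_trans (cY _) _.
  have -> : (x - y)^T *m Y *m (x - y) =
      (x - y)^T *m ((Y - X) *m x) + (x - y)^T *m (X *m x - Y *m y).
    rewrite -mulmxDr -mulmxA; congr (_ *m _).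
    by rewrite mulmxBr mulmxBl addrA subrK.
  by rewrite mxE gerDl; exact: scales_diff.
have H2 : c * `|x - y| ^+ 2 <= k%:R * (`|x - y| * (k%:R * (`|X - Y| * `|x|))).
  apply: (@le_trans _ _ `|(x - y)^T *m ((Y - X) *m x)|).
    apply: (@le_trans _ _ (c * sqn (x - y))); first by rewrite ler_pM2l// sqr_norm_le_sqn.
    by apply: le_trans H _; apply: le_trans (ler_norm _) (mx_entry_le_norm _ _ _).
  apply: le_trans (mx_norm_mul _ _) _; rewrite ler_wpM2l// mx_norm_tr ler_wpM2l//.
  by apply: le_trans (mx_norm_mul _ _) _; rewrite ler_wpM2l// distrC.
have [->|N0] := eqVneq (x - y) 0; first by rewrite normr0 !mulr_ge0// invr_ge0 ltW.
have N : 0 < `|x - y| by rewrite normr_gt0.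
rewrite -(ler_pM2r N) -(ler_pM2l c0) -expr2 (le_trans H2)// le_eqVlt.
by apply/orP; left; apply/eqP; field; rewrite gt_eqF.
Qed.

Lemma continuous_scale_vec X : symm_SymPos X -> {for X, continuous (@scale_vec R k \o @symm R k)}.
Proof.
move=> Xpos; have [c c0 cX] := SymPos_near Xpos.
have symmc : {for X, continuous (@symm R k)} by exact: linear_mx_continuous.
apply/continuous_dist_le => e e0.
have c2 : \forall Y \near X, quad_ge c (symm Y) /\ (Sym R k (symm Y) -> SymPos R k (symm Y)).
  exact: symmc _ cX.
pose C := k%:R * (k%:R * `|scale_vec (symm X)|) / c + 1.
have C0 : 0 < C by rewrite ltr_wpDl// !mulr_ge0// invr_ge0 ltW.
have : \forall Y \near X, `|symm X - symm Y| <= e / C.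
  by move/continuous_dist_le : symmc; apply; rewrite divr_gt0.
apply: filterS2 c2 => Y [cY Ypos] XY.
rewrite (le_trans (scale_vec_lipschitz c0 Xpos (Ypos (symm_Sym Y)) cY))//.
apply: (@le_trans _ _ (C * `|symm X - symm Y|)); first by rewrite ler_wpM2r// lerDl.
by rewrite mulrC -ler_pdivlMr.
Qed.

Let Rl (M : 'M[R]_(k, 1 + k)) : 'cV[R]_k := lsubmx M.
Let Rr (M : 'M[R]_(k, 1 + k)) : 'M[R]_k := rsubmx M.

(* The solution of [scales X s] together with its parameter [X] is a zero of a
   polynomial map. *)
Let scale_eqn (M : 'M[R]_(k, 1 + k)) : 'M[R]_(k, 1 + k) :=
  row_mx (\col_i (Rl M i 0 * (Rr M *m Rl M) i 0)) (Rr M).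

Lemma Cinf_row_mx (V : normedModType R) m n1 n2 (O : set V)
    (f : V -> 'M[R]_(m, n1)) (g : V -> 'M[R]_(m, n2)) : open O ->
  Cinf O f -> Cinf O g -> Cinf O (fun z => row_mx (f z) (g z)).
Proof.
move=> oO cf cg r i j; case: (split_ordP j) => j' ->.
  by apply: Cr_eq (cf r i j') => // x _; rewrite row_mxEl.
by apply: Cr_eq (cg r i j') => // x _; rewrite row_mxEr.
Qed.

Let Cinf_scale_eqn : Cinf setT scale_eqn.
Proof.
have ot : open [set: 'M[R]_(k, 1 + k)] by exact: openT.
have Cl : Cinf setT Rl by exact: (Cinf_linear lsubmx).
have Cr' : Cinf setT Rr by exact: (Cinf_linear rsubmx).
apply: Cinf_row_mx; [exact: ot| |exact: Cr'].
move=> r i j.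
apply: (@Cr_eq _ _ _ _ (fun M => Rl M i 0 * (Rr M *m Rl M) i 0)); first exact: ot.
  by move=> M _; rewrite [RHS]mxE.
apply: CrM; [exact: ot|exact: Cl|].
exact: (@Cinf_mul _ _ _ _ _ _ Rr Rl ot Cr' Cl).
Qed.

(** In [Cinf_implicit] the map [f] sees only the unknown. The parameter [X] therefore becomes part
    of the unknown, stored beside [s] in a k by 1 + k matrix. *)
Lemma Cinf_scale_vec : Cinf (@symm_SymPos R k) (@scale_vec R k \o @symm R k).
Proof.
have oO := @open_symm_SymPos R k.
have ot : open [set: 'M[R]_(k, 1 + k)] by exact: openT.
have Csymm : Cinf (@symm_SymPos R k) (@symm R k) by exact: Cinf_linear.
pose g X := row_mx (scale_vec (symm X)) (symm X).
suff Cg : Cinf (@symm_SymPos R k) g.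
  move=> r i j; apply: Cr_eq (Cg r i (lshift k j)) => // X _.
  by rewrite /g row_mxEl.
apply: (@Cinf_implicit R _ _ _ _ setT scale_eqn _ (fun X => row_mx (@ones R k) (symm X))).
- exact: oO.
- exact: ot.
- exact: Cinf_scale_eqn.
- by apply: Cinf_row_mx; [exact: oO|exact: Cinf_cst|exact: Csymm].
- by [].
- move=> X Xpos; rewrite /scale_eqn /Rl /Rr /g row_mxKl row_mxKr; congr row_mx.
  have [[_ H] _] := scale_vec_spec Xpos.
  by apply/matrixP => i j; rewrite mxE H mxE.
- move=> X Xpos; apply: continuous_mx => i j; case: (split_ordP j) => j' -> {j}.
    rewrite (_ : (fun Y => _) = (fun Y => (scale_vec \o symm) Y i j')); last first.
      by apply/funext => Y; rewrite /g row_mxEl.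
    exact: (continuous_comp (continuous_scale_vec Xpos) (@coord_continuous _ _ _ i j' _)).
  rewrite (_ : (fun Y => _) = (fun Y => symm Y i j')); last first.
    by apply/funext => Y; rewrite /g row_mxEr.
  exact: (continuous_comp (@linear_mx_continuous _ _ _ _ (@symm R k) X)
     (@coord_continuous _ _ _ i j' _)).
move=> X u Xpos E; have [[x0 H] _] := scale_vec_spec Xpos.
set x := scale_vec (symm X) in x0 H.
have Ee i j : 'D_u (fun M => scale_eqn M i j) (g X) = 0.
  rewrite derive_entry ?E ?mxE//; exact: Cinf_differentiable Cinf_scale_eqn _.
have ur : rsubmx u = 0.
  apply/matrixP => i j; rewrite [RHS]mxE -(Ee i (rshift 1 j)).
  apply/esym; apply: (@derive_quadratic R _ _ _ _ _ _ 0) => h.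
  rewrite /scale_eqn !row_mxEr /Rr scaler0 addr0 linearD linearZ/=.
  by rewrite [LHS]mxE [X in X + _]mxE addrC.
pose dx := lsubmx u; have uE : u = row_mx dx 0 by rewrite -ur hsubmxK.
have dxE i : dx i 0 * (symm X *m x) i 0 + x i 0 * (symm X *m dx) i 0 = 0.
  rewrite -(Ee i (lshift k 0)); apply/esym.
  apply: (@derive_quadratic R _ _ _ _ _ _ (dx i 0 * (symm X *m dx) i 0)) => h.
  rewrite /scale_eqn !row_mxEl ![(\col__ _) _ _]mxE /Rl /Rr uE !linearD !linearZ/=.
  rewrite /g !row_mxKl !row_mxKr scaler0 add0r.
  have -> : calDstar (symm X) i i = x i 0 by rewrite /x [RHS]mxE.
  rewrite -/x; have mD (a b : 'cV[R]_k) : (a + b) i 0 = a i 0 + b i 0 by rewrite mxE.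
  have mZ c (a : 'cV[R]_k) : (c *: a) i 0 = c * a i 0 by rewrite mxE.
  by rewrite !mD !mZ /GRing.scale/=; ring.
(* The linearised equation reads (X dx)_i = - dx_i / x_i^2, so dx^T X dx is nonpositive, against
   positive definiteness. *)
have dx0 : dx = 0.
  apply/eqP/negPn/negP => /Xpos.2; rewrite ltNge => /negP; apply.
  rewrite -mulmxA mxE; apply: sumr_le0 => i _; rewrite [dx^T _ _]mxE.
  have Hi : (symm X *m x) i 0 = (x i 0)^-1.
    by apply: (mulfI (lt0r_neq0 (x0 i))); rewrite H divff// lt0r_neq0.
  have := dxE i; rewrite Hi => /eqP; rewrite addr_eq0 => /eqP E1.
  have -> : (symm X *m dx) i 0 = - (dx i 0 / (x i 0) ^+ 2).
    apply: (mulfI (lt0r_neq0 (x0 i))); apply: oppr_inj; rewrite -E1.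
    by field; rewrite lt0r_neq0.
  by rewrite mulrN oppr_le0 mulrA -expr2 divr_ge0 ?sqr_ge0.
by rewrite uE dx0 row_mx0.
Qed.

Lemma Cinf_logscaled : Cinf (@symm_SymPos R k) (@logscaled R k \o @symm R k).
Proof.
have oO := @open_symm_SymPos R k.
have Csymm : Cinf (@symm_SymPos R k) (@symm R k) by exact: Cinf_linear.
have Cd : Cinf (@symm_SymPos R k) (fun X => @calDstar R k (symm X)).
  have ot : open [set: 'cV[R]_k] by exact: openT.
  apply: (@Cinf_eq _ _ _ _ _ ((@diag_mx R k \o trmx) \o (@scale_vec R k \o @symm R k))).
  - exact: oO.
  - by move=> X Xpos; have [_ ->] := scale_vec_spec Xpos.
  exact: (@Cinf_comp _ _ _ _ _ _ _ setT _ _ oO ot Cinf_scale_vec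
    (@Cinf_linear _ _ _ _ _ _ (@diag_mx R k \o trmx) ot) (fun _ _ => I)).
pose F X := calDstar (symm X) *m symm X *m calDstar (symm X).
have CF : Cinf (@symm_SymPos R k) F.
  by apply: Cinf_mul; [exact: oO|apply: Cinf_mul; [exact: oO|exact: Cd|exact: Csymm]|exact: Cd].
have Fpos X : symm_SymPos X -> SymPos R k (F X).
  move=> Xpos; have [[s0 _] E] := scale_vec_spec Xpos; rewrite /F E.
  by apply: SymPos_congr => // i; rewrite mxE gt_eqF.
apply: (@Cinf_eq _ _ _ _ _ ((@mlog R k \o @symm R k) \o F)).
- exact: oO.
- move=> X Xpos; rewrite /= symm_id//; exact: (Fpos X Xpos).1.
apply: (@Cinf_comp _ _ _ _ _ _ _ (@symm_SymPos R k)); [exact: oO|exact: oO|exact: CF| |].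
  exact: Cinf_mlog.
by move=> X /Fpos; exact: SymPos_symm.
Qed.

Definition diag_gt0 := [set A : 'M[R]_k | forall i, 0 < A i i].

Lemma open_diag_gt0 : open diag_gt0.
Proof.
rewrite openE => A A0.
have H (i : 'I_k) : \forall B \near A, 0 < (B : 'M[R]_k) i i.
  have c := @coord_continuous R k k i i A.
  exact: (c _ (open_nbhs_nbhs (conj (@open_gt R 0) (A0 i)))).
exact: (filter_forall (nbhs_filter A) H).
Qed.

Lemma SymPos_diag_gt0 X : SymPos R k X -> diag_gt0 X.
Proof.
move=> [_ Xpos] i; have := Xpos (delta_mx i 0).
rewrite trmx_delta -mulmxA -rowE mxE -colE mxE; apply.
apply/eqP => /matrixP/(_ i 0); rewrite !mxE !eqxx => /eqP; by rewrite oner_eq0.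
Qed.

Lemma Cinf_cor_of : Cinf diag_gt0 (@cor_of R k).
Proof.
have oO := open_diag_gt0.
move=> r i j.
apply: (@Cr_eq _ _ _ _ (fun X => (Num.sqrt (X i i))^-1 * X i j * (Num.sqrt (X j j))^-1)).
- exact: oO.
- move=> X _; rewrite /cor_of mul_mx_diag [RHS]mxE mul_diag_mx.
  by rewrite [(\matrix_(_, _) _) i j]mxE ![(\row__ _) _ _]mxE.
have Cs l : Cr r diag_gt0 (fun X => (Num.sqrt (X l l))^-1).
  apply: CrV; [exact: oO|by move=> X X0; rewrite gt_eqF// sqrtr_gt0 X0|].
  by apply: Cr_sqrt; [exact: oO|move=> X; apply|exact: Cr_coord].
apply: CrM; [exact: oO| |exact: Cs].
by apply: CrM; [exact: oO|exact: Cs|exact: Cr_coord].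
Qed.

End ScalingSmooth.

(** * The linear isometries *)

Section PsiOL.
Context {R : realType} {k : nat}.
Implicit Types (A B S : 'M[R]_k) (M : 'M[R]_(1 + k)).

Lemma psiOL_is_linear : linear (@psiOL R k).
Proof.
move=> a A B; rewrite /psiOL scale_block_mx add_block_mx scaler0 addr0.
congr block_mx; last by rewrite linearP.
- by apply/matrixP => i j; rewrite !mxE; ring.
- by apply/matrixP => i j; rewrite !mxE; ring.
Qed.

HB.instance Definition _ :=
  GRing.isLinear.Build R 'M[R]_k 'M[R]_(1 + k) _ (@psiOL R k) psiOL_is_linear.

Definition psiOL_inv M : 'M[R]_k :=
  off (drsubmx M) + diag_mx (Num.sqrt 2 *: (dlsubmx M)^T).

Lemma psiOL_inv_entry M i j : psiOL_inv M i j =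
  if i == j then Num.sqrt 2 * M (rshift 1 i) (lshift k 0) else M (rshift 1 i) (rshift 1 j).
Proof.
rewrite /psiOL_inv mxE off_entry !mxE; case: eqP => _.
  by rewrite mulr1n add0r.
by rewrite mulr0n addr0.
Qed.

Lemma psiOL_inv_is_linear : linear psiOL_inv.
Proof.
move=> a M N; apply/matrixP => i j.
rewrite [RHS]mxE [(a *: psiOL_inv M) i j]mxE !psiOL_inv_entry !mxE; case: eqP => _ //; ring.
Qed.

HB.instance Definition _ :=
  GRing.isLinear.Build R 'M[R]_(1 + k) 'M[R]_k _ psiOL_inv psiOL_inv_is_linear.

Lemma sqrt2_neq0 : Num.sqrt 2 != 0 :> R.
Proof. by rewrite gt_eqF// sqrtr_gt0. Qed.

Lemma psiOLK : cancel (@psiOL R k) psiOL_inv.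
Proof.
move=> S; rewrite /psiOL_inv /psiOL block_mxKdr block_mxKdl; apply/matrixP => i j.
rewrite mxE !off_entry !mxE; case: eqP => [<-|_]; last by rewrite mulr0n addr0.
by rewrite mulr1n add0r mulrA divff ?mul1r// sqrt2_neq0.
Qed.

Lemma psiOL_invK M : Hol R (1 + k) M -> psiOL (psiOL_inv M) = M.
Proof.
move=> [MT M0].
have sK (x : R) : (Num.sqrt 2)^-1 * (Num.sqrt 2 * x) = x.
  by rewrite mulrA mulVf ?mul1r// sqrt2_neq0.
rewrite -[RHS]submxK /psiOL; congr block_mx; apply/matrixP => i j.
- by rewrite !ord1 !mxE M0.
- rewrite [LHS]mxE [_^T _ _]mxE [(\col__ _) _ _]mxE psiOL_inv_entry eqxx sK !mxE.
  by rewrite -[in LHS]MT mxE (ord1 i).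
- by rewrite [LHS]mxE [(\col__ _) _ _]mxE psiOL_inv_entry eqxx sK !mxE (ord1 j).
- by rewrite off_entry psiOL_inv_entry; case: eqP => [->|_]; rewrite !mxE ?M0.
Qed.

Lemma Hol_psiOL S : Sym R k S -> Hol R (1 + k) (psiOL S).
Proof.
move=> Ss; split; rewrite /psiOL.
  by rewrite tr_block_mx trmx0 !linearZ/= trmxK (Hol_off Ss).1.
move=> i; case: (split_ordP i) => i' ->.
  by rewrite block_mxEul mxE.
by rewrite block_mxEdr off_entry eqxx.
Qed.

Lemma Sym_psiOL_inv M : Hol R (1 + k) M -> Sym R k (psiOL_inv M).
Proof.
move=> [MT _]; rewrite /psiOL_inv; apply: SymD; last exact: Sym_diag_mx.
by apply: Hol_Sym; apply: Hol_off; rewrite /Sym/= trmx_drsub MT.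
Qed.

Lemma frob_off A B : frob (off A) (off B) = frob A B - \sum_i A i i * B i i.
Proof.
rewrite /frob /mxtrace -sumrB; apply: eq_bigr => i _.
rewrite !mxE (bigD1 i)//= [in RHS](bigD1 i)//= !off_entry eqxx mul0r add0r addrAC subrr add0r.
by apply: eq_bigr => j ji; rewrite !off_entry (negbTE ji) eq_sym (negbTE ji).
Qed.

(** The diagonal appears twice, in the first row and in the first column; the two factors 1/2 add up
    to the diagonal term removed by [off]. *)
Lemma frob_psiOL A B : frob (psiOL A) (psiOL B) = frob A B.
Proof.
rewrite /frob /psiOL mulmx_block mul0mx add0r mxtrace_block.
rewrite linearD/= -[\tr (off A *m off B)]/(frob _ _) frob_off.
rewrite -!scalemxAl -!scalemxAr !scalerA !linearZ/= [\tr (_ *m (_)^T)]mxtrace_mulC.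
have tE (C D : 'M[R]_k) : \tr ((\col_i C i i)^T *m (\col_i D i i)) = \sum_i C i i * D i i.
  rewrite /mxtrace big_ord1 mxE; apply: eq_bigr => i _; by rewrite !mxE.
rewrite !tE; under [X in _ * _ + (_ * X + _)]eq_bigr do rewrite mulrC.
have -> : (Num.sqrt 2)^-1 * (Num.sqrt 2)^-1 = 2^-1 :> R.
  by rewrite -invfM -expr2 sqr_sqrtr.
by rewrite /frob; field.
Qed.

End PsiOL.

(** * Helmert contrasts *)

Section Helmert.
Context {R : realType} {k : nat}.
Implicit Types (S : 'M[R]_k) (M : 'M[R]_(1 + k)).

Let H : 'M[R]_(k, 1 + k) := helmert.

Let c (i : nat) : R := (Num.sqrt (i.+1 * i.+2)%:R)^-1.

Let hel (i j : nat) : R :=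
  if (j <= i)%N then c i else if j == i.+1 then - (i.+1%:R * c i) else 0.

(** Indexing [F] by natural numbers allows the sum to be split at column [i.+1], the last nonzero
    one of row [i]. *)
Lemma helmert_sum (i : 'I_k) (F : nat -> R) :
  \sum_(j < 1 + k) H i j * F j = c i * (\sum_(0 <= j < i.+1) F j - i.+1%:R * F i.+1).
Proof.
have -> : \sum_(j < 1 + k) H i j * F j = \sum_(0 <= j < 1 + k) hel i j * F j.
  by rewrite big_mkord; apply: eq_bigr => j _; rewrite mxE.
have ik : (i.+2 <= 1 + k)%N by rewrite add1n ltnS.
have Z : \sum_(i.+2 <= j < 1 + k) hel i j * F j = 0.
  rewrite big_nat_cond big1// => j; rewrite andbT => /andP[ij _].
  by rewrite /hel leqNgt (ltnW ij)/= gtn_eqF// mul0r.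
rewrite (big_cat_nat (n := i.+2))//= Z addr0.
rewrite big_nat_recr//= {2}/hel ltnn eqxx mulrBr mulr_sumr; congr (_ + _).
  rewrite big_nat_cond [RHS]big_nat_cond; apply: eq_bigr => j; rewrite andbT => /andP[_ ji].
  by rewrite /hel -ltnS ji.
by ring.
Qed.

Lemma helmert_ones : H *m ones = 0.
Proof.
apply/matrixP => i j; rewrite mxE [RHS]mxE.
under eq_bigr do rewrite [ones _ _]mxE.
rewrite (helmert_sum i (fun=> 1)) sumr_const_nat subn0 mulr1 subrr mulr0//.
Qed.

(** For [i < l], row [l] is constant on the columns where row [i] is supported, and row [i] sums to
    zero. The squared length of row [i] is (i+1) + (i+1)^2 = (i+1)(i+2) times the squared
    normalising factor. *)
Lemma helmert_orth : H *m H^T = 1%:M.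
Proof.
have Hhel (l : 'I_k) (j : 'I_(1 + k)) : H^T j l = hel l j by rewrite !mxE.
have E (i l : 'I_k) : (H *m H^T) i l =
    c i * (\sum_(0 <= j < i.+1) hel l j - i.+1%:R * hel l i.+1).
  by rewrite mxE; under eq_bigr do rewrite Hhel; rewrite helmert_sum.
have lt0 (i l : 'I_k) : (i < l)%N -> (H *m H^T) i l = 0.
  move=> il; rewrite E /hel il big_nat_cond.
  under eq_bigr => j /andP[/andP[_ ji] _] do rewrite (leq_trans _ (ltnW il))//.
  by rewrite -big_nat_cond sumr_const_nat subn0 mulr_natl subrr mulr0.
apply/matrixP => i l; rewrite [RHS]mxE.
have [il|li|/val_inj ->] := ltngtP i l.
- by rewrite lt0// -val_eqE/= ltn_eqF.
- have -> : (H *m H^T) i l = (H *m H^T) l i.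
    by rewrite -{1}[H *m H^T]trmxK [LHS]mxE trmx_mul trmxK.
  by rewrite lt0// -val_eqE/= gtn_eqF.
rewrite eqxx E /hel ltnn eqxx big_nat_cond.
under eq_bigr => j /andP[/andP[_ ji] _] do rewrite -ltnS ji.
rewrite -big_nat_cond sumr_const_nat subn0 -mulr_natl.
have : c l ^+ 2 * (l.+1%:R * l.+2%:R) = 1.
  rewrite -natrM /c exprVn sqr_sqrtr ?ler0n// mulVf// pnatr_eq0 muln_eq0//.
by move=> cE; rewrite mulr1n -[RHS]cE -[l.+2%:R]natr1; ring.
Qed.

Definition helmert_conj S : 'M[R]_(1 + k) := H^T *m S *m H.
Definition helmert_conj_inv M : 'M[R]_k := H *m M *m H^T.

Lemma helmert_conj_is_linear : linear helmert_conj.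
Proof. by move=> a A B; rewrite /helmert_conj mulmxDr mulmxDl -scalemxAr -scalemxAl. Qed.

HB.instance Definition _ :=
  GRing.isLinear.Build R 'M[R]_k 'M[R]_(1 + k) _ helmert_conj helmert_conj_is_linear.

Lemma helmert_conj_inv_is_linear : linear helmert_conj_inv.
Proof. by move=> a A B; rewrite /helmert_conj_inv mulmxDr mulmxDl -scalemxAr -scalemxAl. Qed.

HB.instance Definition _ :=
  GRing.isLinear.Build R 'M[R]_(1 + k) 'M[R]_k _ helmert_conj_inv helmert_conj_inv_is_linear.

Lemma helmert_conjK : cancel helmert_conj helmert_conj_inv.
Proof.
move=> S; rewrite /helmert_conj_inv /helmert_conj !mulmxA helmert_orth mul1mx.
by rewrite -mulmxA helmert_orth mulmx1.
Qed.

(* [H] with the constant row [(1+k)^(-1/2)] adjoined is a square matrix with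
   orthonormal rows, hence orthogonal. *)
Lemma helmert_proj : H^T *m H + (1 + k)%:R^-1 *: (ones *m ones^T) = 1%:M.
Proof.
pose s : R := Num.sqrt (1 + k)%:R.
have s2 : s^-1 * s^-1 = (1 + k)%:R^-1.
  by rewrite -invfM -expr2 sqr_sqrtr ?ler0n.
pose Q : 'M[R]_(1 + k) := col_mx (s^-1 *: ones^T) H.
have QQ : Q *m Q^T = 1%:M.
  rewrite tr_col_mx mul_col_row linearZ/= trmxK -!scalemxAl -!scalemxAr helmert_orth.
  rewrite helmert_ones scaler0 -[ones^T *m H^T]trmxK trmx_mul !trmxK helmert_ones trmx0 scaler0.
  rewrite scalerA s2 [RHS]scalar_mx_block; congr block_mx.
  apply/matrixP => i j; rewrite !ord1 !mxE.
  under eq_bigr do rewrite !mxE mulr1.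
  by rewrite sumr_const card_ord mulVf// pnatr_eq0.
have := mulmx1C QQ; have tE : (s^-1 *: (@ones R (1 + k))^T)^T = s^-1 *: ones by rewrite linearZ/= trmxK.
rewrite tr_col_mx mul_row_col tE -scalemxAl -scalemxAr.
by rewrite scalerA s2 addrC.
Qed.

(** [H^T *m H] is the orthogonal projection off the line of [ones], which [M] kills on both
    sides. *)
Lemma helmert_conj_invK M : Row0 R (1 + k) M -> helmert_conj (helmert_conj_inv M) = M.
Proof.
move=> /Row0_ones[MT M1].
have PE : H^T *m H = 1%:M - (1 + k)%:R^-1 *: (ones *m ones^T).
  by rewrite -helmert_proj addrK.
have M1' : ones^T *m M = 0 by rewrite -[_ *m _]trmxK trmx_mul trmxK MT M1 trmx0.
rewrite /helmert_conj /helmert_conj_inv !mulmxA PE -!mulmxA PE.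
rewrite mulmxBr mulmx1 -scalemxAr mulmxA M1 mul0mx scaler0 subr0.
by rewrite mulmxBl mul1mx -scalemxAl -mulmxA M1' mulmx0 scaler0 subr0.
Qed.

Lemma Row0_helmert_conj S : Sym R k S -> Row0 R (1 + k) (helmert_conj S).
Proof.
move=> Ss; apply/Row0_ones; split.
  by rewrite /helmert_conj !trmx_mul trmxK Ss mulmxA.
by rewrite /helmert_conj -!mulmxA helmert_ones !mulmx0.
Qed.

Lemma Sym_helmert_conj_inv M : Row0 R (1 + k) M -> Sym R k (helmert_conj_inv M).
Proof. by move=> [MT _]; rewrite /Sym/= /helmert_conj_inv !trmx_mul trmxK MT mulmxA. Qed.

Lemma frob_helmert_conj A B : frob (helmert_conj A) (helmert_conj B) = frob A B.
Proof.
rewrite /frob /helmert_conj.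
have -> : H^T *m A *m H *m (H^T *m B *m H) = H^T *m (A *m B *m H).
  by rewrite -!mulmxA (mulmxA H) helmert_orth mul1mx !mulmxA.
by rewrite mxtrace_mulC -(mulmxA (A *m B)) helmert_orth mulmx1.
Qed.

End Helmert.

(** * Maps that are linear in charts *)

Section Charts.
Context {R : realType}.

Definition linear_subset n (V : set 'M[R]_n) := forall a u v, V u -> V v -> V (a *: u + v).

(** The last two fields place the limits of difference quotients of a map into [A] in the tangent
    space [T]. *)
Record manifold n (A T : set 'M[R]_n) : Prop := Manifold {
  manifold_line : forall x v, A x -> T v -> \forall h \near (0 : R), A (h *: v + x);
  manifold_tangent : forall a x y, A x -> A y -> T (a *: (x - y));
  closed_tangent : closed T }.

(* Smoothness on [A] and [V] is expressed by extensions to open sets of matrices, where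
   Frechet derivatives and their chain rule are available. *)
Record chart n (A V : set 'M[R]_n) (phi psi : 'M[R]_n -> 'M[R]_n) : Prop := Chart {
  chart_to : forall x, A x -> V (phi x);
  chart_from : forall v, V v -> A (psi v);
  chartK : forall x, A x -> psi (phi x) = x;
  chartVK : forall v, V v -> phi (psi v) = v;
  chart_linear : linear_subset V;
  chart_ext : exists O F, [/\ open O, A `<=` O, forall x, A x -> F x = phi x & Cinf O F];
  chart_inv_ext : exists2 G, Cinf setT G & forall v, V v -> G v = psi v }.

Lemma inv_on_unique (V W : normedModType R) (A : set V) (B : set W) (f : V -> W) (g : W -> V) :
  set_bij A B f -> (forall y, B y -> A (g y) /\ f (g y) = y) ->
  forall y, B y -> inv_on A f y = g y.
Proof.
move=> fbij gP y By; have [Agy fgy] := gP y By.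
by rewrite -[in LHS]fgy (inv_on_eq fbij).
Qed.

Lemma bij_of_inverse (V W : Type) (A : set V) (B : set W) (f : V -> W) (g : W -> V) :
  (forall x, A x -> B (f x)) -> (forall x, A x -> g (f x) = x) ->
  (forall y, B y -> A (g y) /\ f (g y) = y) -> set_bij A B f.
Proof.
move=> fAB fK gP; split=> [//|x y /set_mem Ax /set_mem Ay fxy|y By].
  by rewrite -(fK x Ax) fxy fK.
by have [Ag fg] := gP y By; exists (g y).
Qed.

Section LinearInCharts.
Variables (p q : nat) (A T VA : set 'M[R]_p) (phiA psiA : 'M[R]_p -> 'M[R]_p).
Variables (B S VB : set 'M[R]_q) (phiB psiB : 'M[R]_q -> 'M[R]_q).
Variables (L : {linear 'M[R]_p -> 'M[R]_q}) (L' : {linear 'M[R]_q -> 'M[R]_p}).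
Variable f : 'M[R]_p -> 'M[R]_q.
Hypotheses (mA : manifold A T) (cA : chart A VA phiA psiA).
Hypotheses (mB : manifold B S) (cB : chart B VB phiB psiB).
Hypotheses (LV : forall v, VA v -> VB (L v)) (LV' : forall v, VB v -> VA (L' v)).
Hypotheses (LK : forall v, VA v -> L' (L v) = v) (LK' : forall v, VB v -> L (L' v) = v).
Hypothesis fE : forall x, A x -> f x = psiB (L (phiA x)).

Let g y := psiA (L' (phiB y)).

Let fAB x : A x -> B (f x).
Proof. by move=> Ax; rewrite fE//; apply: (chart_from cB); apply: LV; exact: chart_to cA _ Ax. Qed.

Let phif x : A x -> phiB (f x) = L (phiA x).
Proof. by move=> Ax; rewrite fE// (chartVK cB)//; apply: LV; exact: chart_to cA _ Ax. Qed.

Let gP y : B y -> A (g y) /\ f (g y) = y.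
Proof.
move=> By; have VL : VA (L' (phiB y)) by apply: LV'; exact: chart_to cB _ By.
have Ag : A (g y) by exact: chart_from cA _ VL.
split=> //; rewrite fE// (chartVK cA)// LK' ?(chartK cB)//.
exact: chart_to cB _ By.
Qed.

Let gK x : A x -> g (f x) = x.
Proof. by move=> Ax; rewrite /g phif// LK ?(chartK cA)//; exact: chart_to cA _ Ax. Qed.

Lemma chart_bij : set_bij A B f.
Proof. exact: (bij_of_inverse fAB gK gP). Qed.

Lemma chart_invE y : B y -> inv_on A f y = psiA (L' (phiB y)).
Proof. exact: (inv_on_unique chart_bij gP). Qed.

(** The charts are quantified here so that the lemma applies to [f] and to its inverse. *)
Lemma smooth_linear_in_charts m n (C U VC : set 'M[R]_m) (phiC psiC : 'M[R]_m -> 'M[R]_m)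
    (D VD : set 'M[R]_n) (phiD psiD : 'M[R]_n -> 'M[R]_n)
    (M : {linear 'M[R]_m -> 'M[R]_n}) (h : 'M[R]_m -> 'M[R]_n) :
  manifold C U -> chart C VC phiC psiC -> chart D VD phiD psiD ->
  (forall v, VC v -> VD (M v)) -> (forall x, C x -> h x = psiD (M (phiC x))) ->
  exists O F, [/\ open O, C `<=` O, forall x, C x -> F x = h x & Cinf O F].
Proof.
move=> mC cC cD MV hE.
have [OC [F [oO CO FE CF]]] := chart_ext cC; have [G CG GE] := chart_inv_ext cD.
have ot a : open [set: 'M[R]_a] by exact: openT.
exists OC, (G \o (M \o F)); split=> //.
- by move=> x Cx /=; rewrite FE// GE ?hE//; apply: MV; exact: chart_to cC _ Cx.
- have CM : Cinf OC (M \o F).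
    exact: (@Cinf_comp _ _ _ _ _ _ _ setT F M oO (ot m) CF (Cinf_linear M (ot m)) (fun _ _ => I)).
  exact: (@Cinf_comp _ _ _ _ _ _ _ setT (M \o F) G oO (ot n) CM CG (fun _ _ => I)).
Qed.

Lemma smooth_of_ext m n (C U : set 'M[R]_m) (h : 'M[R]_m -> 'M[R]_n) :
  manifold C U ->
  (exists O F, [/\ open O, C `<=` O, forall x, C x -> F x = h x & Cinf O F]) ->
  smooth C U h.
Proof.
move=> mC [OC [F [oO CO FE CF]]] r; apply: (@of_class_Cinf R _ _ _ C U OC h F r oO CO _ (manifold_line mC) CF).
by move=> x Cx; rewrite FE.
Qed.

Lemma linear_in_charts_diffeo : diffeo A T B S f.
Proof.
split; first exact: chart_bij.
  by apply: smooth_of_ext => //; exact: (smooth_linear_in_charts mA cA cB LV fE).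
apply: smooth_of_ext => //.
exact: (smooth_linear_in_charts mB cB cA LV' chart_invE).
Qed.

Lemma linear_in_charts_lie :
  lie_isomorphism A T (pullback_law A phiA) B S (pullback_law B phiB) f.
Proof.
split; first exact: linear_in_charts_diffeo.
have lawE n (C V : set 'M[R]_n) phi psi : chart C V phi psi ->
    forall x y, C x -> C y -> pullback_law C phi x y = psi (phi x + phi y) /\ V (phi x + phi y).
  move=> cC x y Cx Cy; have Vs : V (phi x + phi y).
    by rewrite -[phi x]scale1r; apply: (chart_linear cC); exact: chart_to cC _ _.
  split=> //; apply: (@inv_on_unique _ _ _ V) => //.
    apply: (bij_of_inverse (g := psi)) (chart_to cC) (chartK cC) _ => v Vv.
    by split; [exact: chart_from cC _ Vv|exact: chartVK cC _ Vv].
  by move=> v Vv; split; [exact: chart_from cC _ Vv|exact: chartVK cC _ Vv].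
move=> X Y AX AY; have [-> VXY] := lawE _ _ _ _ _ cA X Y AX AY.
have [-> _] := lawE _ _ _ _ _ cB _ _ (fAB AX) (fAB AY).
rewrite fE; last exact: chart_from cA _ VXY.
by rewrite (chartVK cA)// !phif// linearD.
Qed.

Hypothesis closed_VA : closed VA.
Hypothesis Lframe : forall u v, VA u -> VA v -> frob (L u) (L v) = frob u v.

Lemma linear_in_charts_isometry :
  riem_isometry A T (pullback_metric phiA) B S (pullback_metric phiB) f.
Proof.
split; first exact: linear_in_charts_diffeo.
have [OC [F [oO AO FE CF]]] := smooth_linear_in_charts mA cA cB LV fE.
have [OA [FA [oOA AOA FAE CFA]]] := chart_ext cA.
have [OB [FB [oOB BOB FBE CFB]]] := chart_ext cB.
(* The relation [phiB (f x) = L (phiA x)] is differentiated through the extensions. The derivative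
   of [phiA] must be shown to lie in [VA], the only place where [L] is known to be isometric. *)
have key X U : A X -> T U -> VA ('D_U phiA X) /\ 'D_('D_U f X) phiB (f X) = L ('D_U phiA X).
  move=> AX TU.
  have lineA := manifold_line mA AX TU.
  have dF := Cinf_differentiable CF (AO X AX).
  have dFA := Cinf_differentiable CFA (AOA X AX).
  have dFB : differentiable FB (F X) by apply: (Cinf_differentiable CFB); rewrite FE//; exact/BOB/fAB.
  have DfE : 'D_U f X = 'D_U F X.
    by apply: derive_eq_line; [rewrite FE|apply: filterS lineA => h Ah; rewrite FE].
  have DphiE : 'D_U phiA X = 'D_U FA X.
    by apply: derive_eq_line; [rewrite FAE|apply: filterS lineA => h Ah; rewrite FAE].
  have lineA' : \forall h \near (0 : R)^', A (h *: U + X) by exact: cvg_within.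
  split.
    rewrite DphiE; apply: derive_closed closed_VA (diff_derivable (v := U) dFA) _.
    apply: filterS lineA' => h Ah; rewrite !FAE//.
    have V1 := chart_to cA Ah; have V0 := chart_to cA AX.
    have Vsub := chart_linear cA.
    have Vd : VA (phiA (h *: U + X) - phiA X).
      by rewrite addrC -scaleN1r; exact: Vsub.
    have V00 : VA 0 by have := Vsub (-1) _ _ V0 V0; rewrite scaleN1r addNr.
    by rewrite -[X in VA X]addr0; exact: Vsub.
  (* Tangency of the image vector permits replacing [phiB] by its extension in the outer
     derivative. *)
  have SD : S ('D_U f X).
    rewrite DfE; apply: derive_closed (closed_tangent mB) (diff_derivable (v := U) dF) _.
    apply: filterS lineA' => h Ah; rewrite !FE//.
    by apply: (manifold_tangent mB); exact: fAB.
  have lineB := manifold_line mB (fAB AX) SD.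
  have -> : 'D_('D_U f X) phiB (f X) = 'D_('D_U F X) FB (F X).
    rewrite -DfE FE//; apply: derive_eq_line; first by rewrite FBE//; exact: fAB.
    by apply: filterS lineB => h Bh; rewrite FBE.
  rewrite (deriveE _ dFB) (deriveE _ dF).
  have -> : 'd FB (F X) ('d F X U) = 'D_U (FB \o F) X.
    rewrite (deriveE _ (differentiable_comp dF dFB)).
    exact: esym (congr1 (fun l => l U) (diff_comp dF dFB)).
  rewrite DphiE -derive_linear_comp//; apply: derive_eq_line => /=.
    by rewrite FE// FBE ?phif ?FAE//; exact: fAB.
  by apply: filterS lineA => h Ah; rewrite FE// FBE ?phif ?FAE//; exact: fAB.
move=> X AX U U' TU TU'; rewrite /pullback_metric.
have [V1 ->] := key X U AX TU; have [V2 ->] := key X U' AX TU'.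
exact: Lframe.
Qed.

End LinearInCharts.

End Charts.

(** * The three global charts *)

Section Instances.
Context {R : realType} {k : nat}.
Implicit Types (A B X Y U S : 'M[R]_k).

Lemma closed_fixed (L : {linear 'M[R]_k -> 'M[R]_k}) : closed [set A : 'M[R]_k | L A = A].
Proof.
have -> : [set A : 'M[R]_k | L A = A] = (L \- idfun) @^-1` [set 0].
  by apply/seteqP; split=> A /=; [move=> ->; rewrite subrr|move/eqP; rewrite subr_eq0 => /eqP].
apply: preimage_closed; last first.
  by apply: accessible_closed_set1; exact/hausdorff_accessible/norm_hausdorff.
by move=> A _; exact: (@linear_mx_continuous _ _ _ _ (L \- idfun)).
Qed.

Lemma closed_Sym : closed (Sym R k).
Proof.
rewrite (_ : Sym R k = [set A | symm A = A]); first exact: closed_fixed.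
by apply/seteqP; split=> A /=; [exact: symm_id|move=> <-; exact: symm_Sym].
Qed.

Lemma closed_Hol : closed (Hol R k).
Proof.
rewrite (_ : Hol R k = [set A | hol_proj A = A]); first exact: closed_fixed.
by apply/seteqP; split=> A /=; [exact: hol_proj_id|move=> <-; exact: Hol_hol_proj].
Qed.

Lemma subspace_Sym : linear_subset (Sym R k).
Proof. by move=> a A B As Bs; rewrite /Sym/= linearP/= As Bs. Qed.

Lemma subspace_Hol : linear_subset (Hol R k).
Proof.
move=> a A B [As A0] [Bs B0]; split; first exact: subspace_Sym.
by move=> i; rewrite !mxE A0 B0 mulr0 addr0.
Qed.

Lemma subspace_Row0 : linear_subset (Row0 R k).
Proof.
move=> a A B /Row0_ones[As A0] /Row0_ones[Bs B0]; apply/Row0_ones; split.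
  exact: subspace_Sym.
by rewrite mulmxDl -scalemxAl A0 B0 scaler0 addr0.
Qed.

Lemma SymPos_line X U : SymPos R k X -> Sym R k U ->
  \forall h \near (0 : R), SymPos R k (h *: U + X).
Proof.
move=> Xpos Us; have [c c0 cX] := SymPos_near Xpos.
have : \forall h \near (0 : R), quad_ge c (h *: U + X) /\
    (Sym R k (h *: U + X) -> SymPos R k (h *: U + X)).
  exact: (@cvg_line R _ X U _ cX).
by apply: filterS => h [_]; apply; exact: subspace_Sym Us (SymPos_subset Xpos).
Qed.

Lemma manifold_SymPos : manifold (SymPos R k) (Sym R k).
Proof.
split; [exact: SymPos_line| |exact: closed_Sym].
by move=> a X Y [XT _] [YT _]; rewrite /Sym/= linearZ linearB/= XT YT.
Qed.

Lemma manifold_Cor : manifold (Cor R k) (Hol R k).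
Proof.
split; last exact: closed_Hol.
  move=> X U [Xpos X1] HU; apply: filterS (SymPos_line Xpos (Hol_Sym HU)) => h hpos.
  by split=> // i; rewrite !mxE HU.2 X1 mulr0 add0r.
move=> a X Y [[XT _] X1] [[YT _] Y1]; split; first by rewrite linearZ linearB/= XT YT.
by move=> i; rewrite !mxE X1 Y1 subrr mulr0.
Qed.

Lemma chart_mlog : chart (SymPos R k) (Sym R k) mlog mexp.
Proof.
split.
- exact: Sym_mlog.
- exact: mexp_SymPos.
- exact: mlogK.
- exact: mexpK.
- exact: subspace_Sym.
- exists (@symm_SymPos R k), (@mlog R k \o @symm R k); split.
  + exact: open_symm_SymPos.
  + exact: SymPos_symm.
  + by move=> X Xpos /=; rewrite symm_id//; exact: Xpos.1.
  + exact: Cinf_mlog.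
- by exists (@mexp R k) => //; exact: Cinf_mexp.
Qed.

Let ot : open [set: 'M[R]_k]. Proof. exact: openT. Qed.

Lemma chart_offlog : chart (Cor R k) (Hol R k) offlog (@mexp R k \o @unlog R k).
Proof.
split.
- by move=> X [Xpos _]; apply: Hol_off; exact: Sym_mlog.
- by move=> S HS; have [] := calD_spec HS.
- by move=> X CX /=; have Xpos := proj1 CX; rewrite unlog_off ?mlogK//; exact: Sym_mlog.
- by move=> S HS; rewrite /offlog /= mexpK ?off_unlog//; exact: Sym_unlog.
- exact: subspace_Hol.
- exists (@symm_SymPos R k), (@off R k \o (@mlog R k \o @symm R k)); split.
  + exact: open_symm_SymPos.
  + by move=> X [Xpos _]; exact: SymPos_symm.
  + by move=> X [Xpos _] /=; rewrite symm_id//; exact: Xpos.1.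
  + exact: (@Cinf_comp _ _ _ _ _ _ _ setT _ (@off R k) (@open_symm_SymPos R k) ot
      (@Cinf_mlog R k) (Cinf_linear (@off R k) ot) (fun _ _ => I)).
- exists (@mexp R k \o (@unlog R k \o @hol_proj R k)).
    exact: (@Cinf_comp _ _ _ _ _ _ _ setT _ (@mexp R k) ot ot
      (@Cinf_unlog R k) (@Cinf_mexp R k) (fun _ _ => I)).
  by move=> S HS /=; rewrite hol_proj_id.
Qed.

Lemma cor_ofE X (s : 'rV[R]_k) : (forall i, 0 < s 0 i) -> (forall i, X i i = s 0 i ^+ 2) ->
  diag_mx s *m cor_of X *m diag_mx s = X.
Proof.
move=> s0 Xs; apply/matrixP => i j.
rewrite mul_mx_diag mxE mul_diag_mx mxE /cor_of mul_mx_diag mxE mul_diag_mx mxE.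
rewrite ![(\row__ _) _ _]mxE !Xs !sqrtr_sqr !gtr0_norm//.
by field; rewrite !gt_eqF.
Qed.

Lemma Cor_cor_of X : SymPos R k X -> Cor R k (cor_of X).
Proof.
move=> Xpos; have X0 := SymPos_diag_gt0 Xpos.
split=> [|i]; first by apply: SymPos_congr => // i; rewrite mxE gt_eqF// invr_gt0 sqrtr_gt0 X0.
rewrite /cor_of mul_mx_diag mxE mul_diag_mx mxE ![(\row__ _) _ _]mxE.
have := X0 i; move: (X i i) => a a0; rewrite -{2}[a]sqr_sqrtr ?ltW//.
by field; rewrite gt_eqF// sqrtr_gt0.
Qed.

Lemma Row0_mexp_ones S : Row0 R k S -> mexp S *m ones = ones.
Proof. by move=> /Row0_ones[_ /mexp_ones]. Qed.

(** Scaling a matrix of unit diagonal by [s] gives it the diagonal s_i^2, whose square roots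
    [cor_of] divides out. *)
Lemma logscaledK X : Cor R k X -> cor_of (mexp (logscaled X)) = X.
Proof.
move=> [Xpos X1]; have [[s0 _] dE] := scale_vec_spec Xpos.
rewrite /logscaled mlogK; last by rewrite dE; apply: SymPos_congr => // i; rewrite mxE gt_eqF.
set s := scale_vec X in s0 dE; rewrite dE; apply/matrixP => i j.
rewrite /cor_of mul_mx_diag mxE mul_diag_mx mxE ![(\row__ _) _ _]mxE.
have E a b : (diag_mx s^T *m X *m diag_mx s^T) a b = s a 0 * X a b * s b 0.
  by rewrite mul_mx_diag mxE mul_diag_mx mxE !mxE.
rewrite !E !X1 !mulr1 -!expr2 !sqrtr_sqr !gtr0_norm//.
by field; rewrite !gt_eqF.
Qed.

(** Since [mexp S] fixes [ones], the square roots of its diagonal solve the scaling equation for the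
    normalised matrix; uniqueness identifies them with [calDstar]. *)
Lemma cor_of_mexpK S : Row0 R k S -> logscaled (cor_of (mexp S)) = S.
Proof.
move=> HS; have Xpos := mexp_SymPos (proj1 HS); have X0 := SymPos_diag_gt0 Xpos.
pose s : 'cV[R]_k := \col_i Num.sqrt (mexp S i i).
have s0 i : 0 < s i 0 by rewrite mxE sqrtr_gt0 X0.
have cE : diag_mx s^T *m cor_of (mexp S) *m diag_mx s^T = mexp S.
  by apply: cor_ofE => i; rewrite !mxE ?sqrtr_gt0 ?X0// sqr_sqrtr// ltW// X0.
have Cpos := (Cor_cor_of Xpos).1.
have sc : scales (cor_of (mexp S)) s by apply/scales_ones => //; rewrite cE Row0_mexp_ones.
have [_ dE] := scale_vec_spec Cpos.
by rewrite /logscaled dE (scale_vec_unique Cpos sc) cE mexpK//; exact: (proj1 HS).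
Qed.

Lemma Row0_logscaled X : Cor R k X -> Row0 R k (logscaled X).
Proof.
move=> [Xpos X1]; have [[s0 sX] dE] := scale_vec_spec Xpos.
apply/Row0_mlog; first by rewrite dE; apply: SymPos_congr => // i; rewrite mxE gt_eqF.
by rewrite dE; apply/scales_ones.
Qed.

Lemma chart_logscaled : chart (Cor R k) (Row0 R k) logscaled (@cor_of R k \o @mexp R k).
Proof.
split.
- exact: Row0_logscaled.
- by move=> S [Ss _]; apply: Cor_cor_of; exact: mexp_SymPos.
- exact: logscaledK.
- exact: cor_of_mexpK.
- exact: subspace_Row0.
- exists (@symm_SymPos R k), (@logscaled R k \o @symm R k); split.
  + exact: open_symm_SymPos.
  + by move=> X [Xpos _]; exact: SymPos_symm.
  + by move=> X [Xpos _] /=; rewrite symm_id//; exact: Xpos.1.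
  + exact: Cinf_logscaled.
- have Cs : Cinf setT (@mexp R k \o @symm R k).
    exact: (@Cinf_comp _ _ _ _ _ _ _ setT (@symm R k) (@mexp R k) ot ot
      (Cinf_linear (@symm R k) ot) (@Cinf_mexp R k) (fun _ _ => I)).
  exists (@cor_of R k \o (@mexp R k \o @symm R k)).
    apply: (@Cinf_comp _ _ _ _ _ _ _ (@diag_gt0 R k) _ (@cor_of R k) ot (@open_diag_gt0 R k)
      Cs (@Cinf_cor_of R k)).
    by move=> S _; apply: SymPos_diag_gt0; apply: mexp_SymPos; exact: symm_Sym.
  by move=> S [Ss _] /=; rewrite symm_id.
Qed.

End Instances.

Local Close Scope classical_set_scope.

Theorem mainTheorem4 (R : realType) (k : nat) (hk : (2 <= 1 + k)%N) :
  (riem_isometry (SymPos R k) (Sym R k) gLE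
     (Cor R (1 + k)) (Hol R (1 + k)) gOL PhiOL /\
   lie_isomorphism (SymPos R k) (Sym R k) lawLE
     (Cor R (1 + k)) (Hol R (1 + k)) lawOL PhiOL) /\
  (riem_isometry (SymPos R k) (Sym R k) gLE
     (Cor R (1 + k)) (Hol R (1 + k)) gLS PhiLS /\
   lie_isomorphism (SymPos R k) (Sym R k) lawLE
     (Cor R (1 + k)) (Hol R (1 + k)) lawLS PhiLS) /\
  ((forall X : 'M[R]_(1 + k), Cor R (1 + k) X ->
      PhiLS (inv_on (SymPos R k) PhiOL X) =
      cor_of (mexp (helmert^T *m inv_on (Sym R k) psiOL (off (mlog X))
                      *m helmert))) /\
   riem_isometry (Cor R (1 + k)) (Hol R (1 + k)) gOL
     (Cor R (1 + k)) (Hol R (1 + k)) gLS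
     (fun X => PhiLS (inv_on (SymPos R k) PhiOL X)) /\
   lie_isomorphism (Cor R (1 + k)) (Hol R (1 + k)) lawOL
     (Cor R (1 + k)) (Hol R (1 + k)) lawLS
     (fun X => PhiLS (inv_on (SymPos R k) PhiOL X))).
Proof.
have mS := @manifold_SymPos R k; have mC := @manifold_Cor R (1 + k).
have cLE := @chart_mlog R k; have cOL := @chart_offlog R (1 + k).
have cLS := @chart_logscaled R (1 + k).
have fOL X : SymPos R k X -> PhiOL X = (mexp \o unlog) (psiOL (mlog X)) by [].
have fLS X : SymPos R k X -> PhiLS X = (@cor_of R (1 + k) \o mexp) (helmert_conj (mlog X)) by [].
have psiK S : Sym R k S -> psiOL_inv (psiOL S) = S by rewrite psiOLK.
have conjK S : Sym R k S -> helmert_conj_inv (helmert_conj S) = S by rewrite helmert_conjK.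
have fr1 A B : Sym R k A -> Sym R k B -> frob (psiOL A) (psiOL B) = frob A B.
  by rewrite frob_psiOL.
have fr2 A B : Sym R k A -> Sym R k B -> frob (helmert_conj A) (helmert_conj B) = frob A B.
  by rewrite frob_helmert_conj.
have invE X : Cor R (1 + k) X -> inv_on (SymPos R k) PhiOL X = mexp (psiOL_inv (offlog X)).
  exact: (chart_invE cLE cOL (@Hol_psiOL R k) (@Sym_psiOL_inv R k) psiK (@psiOL_invK R k) fOL).
have f3E X : Cor R (1 + k) X -> PhiLS (inv_on (SymPos R k) PhiOL X) =
    (@cor_of R (1 + k) \o mexp) ((helmert_conj \o psiOL_inv) (offlog X)).
  move=> CX; rewrite (invE X CX) /PhiLS (mexpK (Sym_psiOL_inv (chart_to cOL CX))).
  exact: erefl.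
split; [|split].
- split.
    exact: (linear_in_charts_isometry mS cLE mC cOL (@Hol_psiOL R k) (@Sym_psiOL_inv R k)
      psiK (@psiOL_invK R k) fOL (@closed_Sym R k) fr1).
  exact: (linear_in_charts_lie mS cLE mC cOL (@Hol_psiOL R k) (@Sym_psiOL_inv R k)
      psiK (@psiOL_invK R k) fOL).
- split.
    exact: (linear_in_charts_isometry mS cLE mC cLS (@Row0_helmert_conj R k)
      (@Sym_helmert_conj_inv R k) conjK (@helmert_conj_invK R k) fLS (@closed_Sym R k) fr2).
  exact: (linear_in_charts_lie mS cLE mC cLS (@Row0_helmert_conj R k)
      (@Sym_helmert_conj_inv R k) conjK (@helmert_conj_invK R k) fLS).
pose L : {linear 'M[R]_(1 + k) -> 'M[R]_(1 + k)} := @helmert_conj R k \o @psiOL_inv R k.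
pose L' : {linear 'M[R]_(1 + k) -> 'M[R]_(1 + k)} := @psiOL R k \o @helmert_conj_inv R k.
have LV S : Hol R (1 + k) S -> Row0 R (1 + k) (L S).
  by move=> /Sym_psiOL_inv; exact: Row0_helmert_conj.
have LV' S : Row0 R (1 + k) S -> Hol R (1 + k) (L' S).
  by move=> /Sym_helmert_conj_inv; exact: Hol_psiOL.
have LK S : Hol R (1 + k) S -> L' (L S) = S.
  by move=> HS; rewrite /L /L' /= helmert_conjK psiOL_invK.
have LK' S : Row0 R (1 + k) S -> L (L' S) = S.
  by move=> HS; rewrite /L /L' /= psiOLK helmert_conj_invK.
(* The isometry property of [psiOL_inv] on hollow matrices is read backwards from that of
   [psiOL]. *)
have fr3 A B : Hol R (1 + k) A -> Hol R (1 + k) B -> frob (L A) (L B) = frob A B.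
  by move=> HA HB; rewrite /L /= frob_helmert_conj -frob_psiOL !psiOL_invK.
split; [|split].
- move=> X CX; have HX := chart_to cOL CX.
  have psibij : set_bij (Sym R k) (Hol R (1 + k)) (@psiOL R k).
    apply: (bij_of_inverse (g := @psiOL_inv R k)); [exact: Hol_psiOL|exact: psiK|].
    by move=> M HM; split; [exact: Sym_psiOL_inv|exact: psiOL_invK].
  have -> : inv_on (Sym R k) psiOL (off (mlog X)) = psiOL_inv (offlog X).
    apply: (inv_on_unique (g := @psiOL_inv R k) psibij) HX => M HM.
    by split; [exact: Sym_psiOL_inv|exact: psiOL_invK].
  exact: f3E X CX.
- exact: (linear_in_charts_isometry mC cOL mC cLS LV LV' LK LK' f3E (@closed_Hol R (1 + k)) fr3).
- exact: (linear_in_charts_lie mC cOL mC cLS LV LV' LK LK' f3E).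
Qed.
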